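(* All critical points of $\mathcal{B}_{av}:\mathcal{H}_{av}\to\mathbb{R}$ are nondegenerate, i.e. the kernel of the Hessian of $\mathcal{B}_{av}$ at each critical point has dimension precisely $1$.
   Context: Let $S^1=\mathbb{R}/\mathbb{Z}$ and $\|\cdot\|$ the $L^2$-norm on $S^1$. Set $$\mathcal{H}_{av}=\Big\{(z_1,z_2)\in H^2(S^1,\mathbb{R}^2)\;\Big|\;\|z_1\|>0,\ \|z_2\|>0,\ \frac{\|z_1^2\|^2}{\|z_1\|^2}>\frac{\|z_2^2\|^2}{\|z_2\|^2}\Big\}$$ and $$\mathcal{B}_{av}(z_1,z_2)=2\sum_{i=1}^2\Big(\|z_i\|^2\|z_i'\|^2+\frac{1}{\|z_i\|^2}\Big)-\frac{\|z_1\|^2\|z_2\|^2}{\|z_1^2\|^2\|z_2\|^2-\|z_2^2\|^2\|z_1\|^2}.$$ The $L^2$-gradient $\nabla\mathcal{B}_{av}:\mathcal{H}_{av}\to L^2(S^1,\mathbb{R}^2)$ is of class $C^1$; its derivative at a critical point (zero of the gradient) is called the Hessian, a linear map $H^2(S^1,\mathbb{R}^2)\to L^2(S^1,\mathbb{R}^2)$. For each critical point $(z_1,z_2)$ the component $z_1$ is constant (known from earlier work), and by invariance under time shift the Hessian has kernel of dimension at least one; the critical point is called nondegenerate if this kernel has dimension precisely $1$.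
   Formalization: The theorem is stated for critical points whose component z_1 is constant; the context asserts this of all critical points, but on H_av as given there are also critical points with nonconstant z_1, and these are degenerate. *)

(* Defs.v *)
From HB Require Import structures.
From mathcomp Require Import all_boot all_order all_algebra.
From mathcomp Require Import all_classical all_reals all_analysis.
Set Implicit Arguments.
Unset Strict Implicit.
Unset Printing Implicit Defensive.
Import Order.TTheory GRing.Theory Num.Theory.
Import numFieldNormedType.Exports.
Local Open Scope classical_set_scope.
Local Open Scope ring_scope.

(* Functions on the circle S^1 = R/Z are the 1-periodic functions R -> R, and
   integrals over S^1 are integrals over [0, 1]. *)
Section circle.
Context {R : realType}.
Implicit Types f g : R -> R^o.
Local Notation mu := (@lebesgue_measure R).

Definition l2 f : Prop :=
  [/\ periodic f 1, measurable_fun setT f &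
      mu.-integrable `[0, 1] (fun t => (f t ^+ 2)%:E)].

Definition l2dot f g : R := \int[mu]_(t in `[0, 1]) (f t * g t).

Definition l2norm f : R := Num.sqrt (l2dot f f).

(* Equivalently: f is absolutely continuous and its a.e. derivative is the
   square integrable function g. *)
Definition l2_derivative f g : Prop :=
  l2 g /\ forall s t, s <= t -> f t - f s = \int[mu]_(x in `[s, t]) g x.

(* H^2(S^1): each class is represented by its unique C^1 element, whose
   derivative is absolutely continuous with square integrable derivative.
   Equality in H^2 is thus plain equality of functions. *)
Definition h2 f : Prop :=
  [/\ periodic f 1, forall t, derivable f t 1 &
      exists g, l2_derivative (derive1 f) g].

(* The second derivative of an element of H^2, unique up to null sets
   (unspecified when f is not in H^2). *)
Definition second_derivative f : R -> R^o := get (l2_derivative (derive1 f)).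

Definition h2norm f : R :=
  Num.sqrt (l2norm f ^+ 2 + l2norm (derive1 f) ^+ 2
            + l2norm (second_derivative f) ^+ 2).

End circle.

Section pairs.
Context {R : realType}.
Local Notation V := ((R -> R^o) * (R -> R^o))%type.
Local Notation mu := (@lebesgue_measure R).
Implicit Types (z h g : V) (B : V -> R) (G A : V -> V).

Definition L2 z : Prop := l2 z.1 /\ l2 z.2.
Definition L2dot z h : R := l2dot z.1 h.1 + l2dot z.2 h.2.
Definition L2norm z : R := Num.sqrt (L2dot z z).
Definition L2eq z h : Prop := z.1 = h.1 %[ae mu] /\ z.2 = h.2 %[ae mu].

Definition H2 z : Prop := h2 z.1 /\ h2 z.2.
Definition H2norm z : R := Num.sqrt (h2norm z.1 ^+ 2 + h2norm z.2 ^+ 2).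

(* The Frechet derivative of B at z along H^2 is h |-> <g, h>_{L^2}. *)
Definition is_L2_gradient B z g : Prop :=
  L2 g /\
  forall e : R, 0 < e -> exists2 d : R, 0 < d &
    forall h, H2 h -> H2norm h < d ->
      `|B (z + h) - B z - L2dot g h| <= e * H2norm h.

(* A is the Frechet derivative at z of G, as a map from H^2 to L^2: a bounded
   linear map approximating G to first order. Values are functions considered
   up to null sets. *)
Definition is_L2_differential G z A : Prop :=
  [/\ forall h, H2 h -> L2 (A h),
      forall (a : R) h k, H2 h -> H2 k ->
        L2eq (A (a *: h + k)) (a *: A h + A k),
      exists C : R, forall h, H2 h -> L2norm (A h) <= C * H2norm h &
      forall e : R, 0 < e -> exists2 d : R, 0 < d &
        forall h, H2 h -> H2norm h < d ->
          L2norm (G (z + h) - G z - A h) <= e * H2norm h].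

(* H^2-kernel of an operator from H^2 to L^2. *)
Definition h2_kernel A : set V := [set h | H2 h /\ L2eq (A h) 0].

Definition dimension_one (K : set V) : Prop :=
  exists2 h0 : V, h0 <> 0 & K = [set a *: h0 | a in [set: R]].

Definition sq (f : R -> R^o) : R -> R^o := fun t => f t ^+ 2.

Definition Hav : set V := [set z |
  [/\ H2 z, 0 < l2norm z.1, 0 < l2norm z.2 &
      l2norm (sq z.1) ^+ 2 / l2norm z.1 ^+ 2
      > l2norm (sq z.2) ^+ 2 / l2norm z.2 ^+ 2]].

Definition Bav z : R :=
  2 * ((l2norm z.1 ^+ 2 * l2norm (derive1 z.1) ^+ 2 + (l2norm z.1 ^+ 2)^-1)
       + (l2norm z.2 ^+ 2 * l2norm (derive1 z.2) ^+ 2 + (l2norm z.2 ^+ 2)^-1))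
  - (l2norm z.1 ^+ 2 * l2norm z.2 ^+ 2)
    / (l2norm (sq z.1) ^+ 2 * l2norm z.2 ^+ 2
       - l2norm (sq z.2) ^+ 2 * l2norm z.1 ^+ 2).

Definition critical_point z : Prop := Hav z /\ is_L2_gradient Bav z 0.

(* A is the derivative at z of the L^2-gradient of Bav. The values outside Hav
   of the function G giving the gradient on Hav do not matter, since Hav is
   open in H^2. *)
Definition is_hessian z A : Prop :=
  exists2 G : V -> V, forall w, Hav w -> is_L2_gradient Bav w (G w)
                    & is_L2_differential G z A.

(* The Hessian exists at z and its kernel has dimension 1. The Hessian is
   unique up to null sets of its values, so its kernel is well defined. *)
Definition nondegenerate_at z : Prop :=
  exists2 A : V -> V, is_hessian z A & dimension_one (h2_kernel A).

End pairs.

(* Main.v *)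
(* The first component of the gradient at (c, z) gives c^4 = 2 E^2 with
   E = c^2 - |z^2|^2 / |z|^2, and the second says that z solves a Duffing
   equation z'' = al z - be z^3 with be > 0 and positive energy e. The Hessian
   at (c, z), applied to (h1, h2), is a positive multiple of h1 - m plus a
   negative multiple of h1'', where m is a number depending on (h1, h2), and a
   nonlocal perturbation of L h2 = h2'' - al h2 + 3 be z^2 h2. So h1 is a
   constant eta when (h1, h2) is in the kernel, and L h2 is a combination of z
   and z^3.
   The space of solutions of L h = 0 is spanned by z' and by a function phi that
   is not periodic; L z and L w0, with w0 = Z z' - z^3 and Z' = z^2 - |z|^2,
   span the combinations of z and z^3. Hence h2 = x z + y w0 + d z'. Inserting
   this in the nonlocal terms gives a linear system for (eta, x, y) whose
   coefficients only involve the moments of z. Identities between these moments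
   reduce it to Y * bracket = 0 with Y a multiple of y, and the bracket is
   positive by the Cauchy-Schwarz inequalities |z|^4 <= |z^2|^2 and
   |z^2|^4 <= |z|^2 |z^3|^2. *)

Require Import Defs.
From mathcomp Require Import all_boot all_order all_algebra.
From mathcomp Require Import all_classical all_reals all_analysis.
From mathcomp Require Import measurable_realfun ring lra.
Set Implicit Arguments.
Unset Strict Implicit.
Unset Printing Implicit Defensive.
Import Order.TTheory GRing.Theory Num.Theory.
Import numFieldNormedType.Exports.
Local Open Scope classical_set_scope.
Local Open Scope ring_scope.

(** The positive energy comes from the term [1 / |z|^2] of the functional alone: the formula for
    [al], inserted in the mean of the energy identity, leaves [2 e = |z|^(-4)]. The function [w0]
    repairs a secular solution: the scaling [lambda z(lambda t)] produces [z + t z'], whose factor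
    [t] destroys periodicity. Replacing [t] by the periodic [Z] creates a [z^5] term in [L (Z z')],
    which [- z^3] cancels thanks to the energy identity. No elliptic function is needed, because
    [h2] enters the nonlocal terms only through the means of [z h2] and [z^3 h2], and those of
    [z w0] and [z^3 w0] become moments on integrating [(Z z^2)'] and [(Z z^4)']. Since
    [c^2 = sqrt 2 E], the quotient [|z^2|^2 / |z|^2] equals [(sqrt 2 - 1) E]; this is the origin of
    [k]. On the analytic side, second derivatives are known only up to null sets: weak stationarity
    must first become an almost everywhere equation, then a classical one by continuity of its
    right-hand side. *)

(** * Integrals over intervals and primitives *)

Section integrals.
Context {R : realType}.
Implicit Types (f g F : R -> R^o) (a b s t : R).
Local Notation mu := (@lebesgue_measure R).

Lemma continuous_integrable f a b :
  continuous f -> mu.-integrable `[a, b] (EFin \o f).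
Proof.
move=> cf; apply: continuous_compact_integrable; first exact: segment_compact.
exact: continuous_subspaceT.
Qed.

Lemma is_derive_continuous F f : (forall t, is_derive t 1 F (f t)) ->
  continuous F.
Proof.
move=> dF t; apply: differentiable_continuous; apply/derivable1_diffP.
exact: (@ex_derive _ _ _ _ _ _ _ (dF t)).
Qed.

Lemma integral_derive F f a b : a <= b -> continuous f ->
  (forall t, is_derive t 1 F (f t)) ->
  \int[mu]_(t in `[a, b]) f t = F b - F a.
Proof.
rewrite le_eqVlt => /predU1P[<-|ab] cf dF.
  by rewrite set_itv1 Rintegral_set1 subrr.
have cF := is_derive_continuous dF.
rewrite /Rintegral (@continuous_FTC2 _ f F)//.
- exact: continuous_subspaceT.
- split.
  + by move=> t _; exact: (@ex_derive _ _ _ _ _ _ _ (dF t)).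
  + by apply: cvg_at_right_filter; exact: cF.
  + by apply: cvg_at_left_filter; exact: cF.
- by move=> t _; rewrite derive1E; exact: (@derive_val _ _ _ _ _ _ _ (dF t)).
Qed.

(* With [`[a, b] = set0] for [b < a], this is the oriented integral from 0. *)
Definition primitive f t : R^o :=
  \int[mu]_(x in `[0, t]) f x - \int[mu]_(x in `[t, 0]) f x.

Lemma integral_itv_split f a b t : mu.-integrable `[a, b] (EFin \o f) ->
  a <= t -> t <= b ->
  \int[mu]_(x in `[a, b]) f x
    = \int[mu]_(x in `[a, t]) f x + \int[mu]_(x in `[t, b]) f x.
Proof.
move=> fi at_ tb.
have H1 := @Rintegral_itvB _ f (BLeft a) (BRight b) t fi at_ tb.
have H2 : mu.-integrable `]t, b] (EFin \o f).
  by apply: integrableS fi => //; apply: subset_itvr; rewrite bnd_simp.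
have H3 := @Rintegral_itv_obnd_cbnd _ t (BRight b) f H2.
by rewrite -H3 -H1 addrC subrK.
Qed.

Lemma primitiveB f s t : (forall a b, mu.-integrable `[a, b] (EFin \o f)) ->
  s <= t -> primitive f t - primitive f s = \int[mu]_(x in `[s, t]) f x.
Proof.
move=> fi st; rewrite /primitive.
have i0 a b : b < a -> \int[mu]_(x in `[a, b]) f x = 0.
  by move=> ba; rewrite set_itv_ge ?Rintegral_set0// bnd_simp -ltNge.
have i1 a : \int[mu]_(x in `[a, a]) f x = 0 by rewrite set_itv1 Rintegral_set1.
have [t0|t0] := ltP t 0.
  rewrite (i0 0 t)// (i0 0 s) ?(le_lt_trans st)//.
  rewrite (@integral_itv_split _ s 0 t) ?(ltW t0)//; lra.
have [s0|s0] := ltP s 0.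
  rewrite (@integral_itv_split _ s t 0) ?(ltW s0)// (i0 0 s)//.
  case: (ltgtP t 0) t0 => // [t0 _|-> _]; rewrite ?i1 ?(i0 t 0)//; lra.
rewrite (@integral_itv_split _ 0 t s)//.
have -> : \int[mu]_(x in `[t, 0]) f x = 0.
  by case: (ltgtP t 0) t0 => // [t0 _|-> _]; rewrite ?i1 ?(i0 t 0).
have -> : \int[mu]_(x in `[s, 0]) f x = 0.
  by case: (ltgtP s 0) s0 => // [t0' _|-> _]; rewrite ?i1 ?(i0 s 0).
lra.
Qed.

Lemma primitive0 f : primitive f 0 = 0.
Proof. by rewrite /primitive subrr. Qed.

Lemma is_derive_primitive f t : continuous f ->
  is_derive t 1 (primitive f) (f t).
Proof.
(* Integrating from [t - 1] rather than from 0 treats both signs of [t] at once; near [t] the result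
   differs from [primitive f] by a constant. *)
move=> cf; pose a := t - 1; pose G x := \int[mu]_(y in `[a, x]) f y.
have fi u v := continuous_integrable u v cf.
have [||dG G't] := @continuous_FTC1_closed _ f a t (t + 1) _ (fi _ _) _ (cf t).
- by rewrite ltrDl.
- by rewrite /a ltrBlDr ltrDl.
have GE : {near t, (fun x => G x + primitive f a) =1 primitive f}.
  have ta : a < t by rewrite /a ltrBlDr ltrDl.
  near=> x; rewrite /G -primitiveB ?subrK//.
  by apply: ltW; near: x; exact: lt_nbhsr.
have : is_derive t 1 (fun x => G x + primitive f a : R^o) (f t + 0).
  by apply: is_deriveD; split; [exact: dG|rewrite -derive1E].
rewrite addr0; exact: near_eq_is_derive GE.
Unshelve. all: by end_near. Qed.

End integrals.

(** * Square integrable periodic functions *)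

Section l2_theory.
Context {R : realType}.
Implicit Types (f g h F : R -> R^o) (a b c s t : R).
Local Notation mu := (@lebesgue_measure R).

(** Lebesgue measure is determined by the lengths of half-open intervals, and these are invariant
    under the shift. *)
Lemma lebesgue_measure_translate c (A : set R) : measurable A ->
  pushforward mu ((fun x => x + c) : _ -> measurableTypeR R) A = mu A.
Proof.
move=> mA.
have mc : measurable_fun setT ((fun x => x + c) : R -> measurableTypeR R).
  by apply: continuous_measurable_fun => x; apply: cvgD; [exact: cvg_id|exact: cvg_cst].
apply/esym/lebesgue_measure_unique => //= _ [[a b]] _ <-.
rewrite /pushforward (_ : _ @^-1` _ = `]a - c, b - c]%classic); last first.
  by apply/seteqP; split => x /=; rewrite !in_itv/= lerBrDr ltrBlDr.
rewrite !lebesgue_measure_itv/= !lte_fin ltrD2r.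
by case: ifPn => // _; congr (_%:E); lra.
Qed.

Lemma integrable_translate f c a b : measurable_fun setT f ->
  (forall x, f (x + c) = f x) ->
  mu.-integrable `[a, b] (EFin \o f) ->
  mu.-integrable `[a + c, b + c] (EFin \o f).
Proof.
move=> mf fc fi.
have mc : measurable_fun setT ((fun x => x + c) : R -> measurableTypeR R).
  by apply: continuous_measurable_fun => x; apply: cvgD; [exact: cvg_id|exact: cvg_cst].
have E : (fun x => x + c) @^-1` `[a + c, b + c]%classic = `[a, b]%classic.
  by apply/seteqP; split => x /=; rewrite !in_itv/= !lerD2r.
have : (pushforward mu ((fun x => x + c) : R -> measurableTypeR R)).-integrable
    `[a + c, b + c] (EFin \o f).
  apply: integrable_pushforward => //; first exact/measurable_EFinP.
  by rewrite E (_ : _ \o _ = EFin \o f) //; apply/funext => x /=; rewrite fc.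
move/integrableP => [mf' fi']; apply/integrableP; split => //.
apply: le_lt_trans fi'; rewrite le_eqVlt; apply/orP; left; apply/eqP.
by apply: eq_measure_integral => //= A mA _; exact/esym/lebesgue_measure_translate.
Qed.

Lemma integrable_itvU f a b c d : mu.-integrable `[a, b] (EFin \o f) ->
  mu.-integrable `[c, d] (EFin \o f) -> a <= c -> c <= b ->
  mu.-integrable `[a, d] (EFin \o f).
Proof.
move=> fab fcd ac cb.
have H1 : mu.-integrable setT (EFin \o (f \_ `[a, b])).
  by rewrite -restrict_EFin -integrable_mkcond.
have H2 : mu.-integrable setT (EFin \o (f \_ (`]b, d]))).
  rewrite -restrict_EFin -integrable_mkcond//.
  apply: integrableS fcd => // x /=; rewrite !in_itv/= => /andP[bx ->].
  by rewrite (le_trans cb (ltW bx)).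
have H3 : mu.-integrable `[a, d] (EFin \o (fun x => (f \_ `[a, b]) x + (f \_ (`]b, d])) x)).
  apply: (@integrableS _ _ _ _ setT) => //.
  have := @integrableD _ _ _ mu setT measurableT _ _ H1 H2.
  by apply: eq_integrable.
apply: eq_integrable H3 => // x; rewrite inE/= in_itv/= => /andP[ax xd].
rewrite !patchE; congr EFin.
have [xb|xb] := leP x b.
  by rewrite mem_set ?memNset ?addr0//= in_itv/= ?ax ?xb// ltNge xb.
have ? : ~ `[a, b]%classic x by rewrite /= in_itv/= ax/= leNgt xb.
by rewrite memNset// mem_set ?add0r//= in_itv/= xb.
Qed.

Lemma periodicB1 f : periodic f 1 -> forall x, f (x - 1) = f x.
Proof. by move=> fp x; rewrite -[in RHS](subrK 1 x) fp. Qed.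

(** Translating [[- n, n + 1]] by 1 and by -1 enlarges it to [[- (n + 1), n + 2]], and these
    intervals exhaust the line. *)
Lemma periodic_integrable f a b : measurable_fun setT f -> periodic f 1 ->
  mu.-integrable `[0, 1] (EFin \o f) -> mu.-integrable `[a, b] (EFin \o f).
Proof.
move=> mf fp fi.
have H (n : nat) : mu.-integrable `[- n%:R, n%:R + 1] (EFin \o f).
  elim: n => [|n IH]; first by rewrite oppr0 add0r.
  have I1 := @integrable_translate f 1 _ _ mf fp IH.
  have I2 := @integrable_translate f (-1) _ _ mf (periodicB1 fp) IH.
  rewrite -natr1 opprD; have := ler0n R n => n0.
  have I3 := @integrable_itvU f _ _ _ _ I2 IH ltac:(lra) ltac:(lra).
  apply: integrable_itvU I3 I1 _ _; lra.
pose n := Num.truncn (`|a| + `|b|).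
have nP : `|a| + `|b| < n.+1%:R by apply: truncnS_gt.
apply: integrableS (H n.+1) => // x; rewrite /= !in_itv/= => /andP[ax xb].
have := ler_norm b; have := ler_norm (- a); rewrite normrN => ??.
have ? := normr_ge0 a; have ? := normr_ge0 b.
apply/andP; split; lra.
Qed.

Lemma l2_mul_integrable f g : l2 f -> l2 g ->
  mu.-integrable `[0, 1] (fun t => (f t * g t)%:E).
Proof.
move=> [_ mf f2] [_ mg g2].
have H := @integrableD _ _ _ mu `[0, 1] (measurable_itv _) _ _ f2 g2.
apply: le_integrable H => //.
  by apply/measurable_EFinP; apply: measurable_funTS; exact: measurable_funM.
move=> t _ /=; rewrite lee_fin normrM.
rewrite [leRHS]ger0_norm ?addr_ge0 ?sqr_ge0// -(real_normK (num_real (f t))).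
rewrite -(real_normK (num_real (g t))).
have := sqr_ge0 (`|f t| - `|g t|); have := normr_ge0 (f t).
have := normr_ge0 (g t); nra.
Qed.

Lemma continuous_measurable f : continuous f -> measurable_fun setT f.
Proof. exact: continuous_measurable_fun. Qed.

Lemma l2_continuous f : continuous f -> periodic f 1 -> l2 f.
Proof.
move=> cf fp; split => //; first exact: continuous_measurable.
apply: (@continuous_integrable _ (fun t => f t ^+ 2)) => t.
by apply: continuousM; exact: cf.
Qed.

Lemma l2_cst c : l2 (cst c : R -> R^o).
Proof. by apply: l2_continuous => // t; exact: cvg_cst. Qed.

Lemma l2_itv_integrable f a b : l2 f -> mu.-integrable `[a, b] (EFin \o f).
Proof.
move=> lf; have := l2_mul_integrable lf (l2_cst 1).
under [X in mu.-integrable _ X]eq_fun do rewrite /= mulr1.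
by case: lf => fp mf _; exact: periodic_integrable.
Qed.

Lemma l2D f g : l2 f -> l2 g -> l2 (f \+ g).
Proof.
move=> lf lg; case: (lf) (lg) => [pf mf f2] [pg mg g2]; split.
- by move=> t; rewrite /= pf pg.
- exact: measurable_funD.
- have fg := l2_mul_integrable lf lg.
  have H1 := @integrableD _ _ _ mu _ (measurable_itv _) _ _ f2 g2.
  have H2 := @integrableD _ _ _ mu _ (measurable_itv _) _ _ fg fg.
  have H := @integrableD _ _ _ mu _ (measurable_itv _) _ _ H1 H2.
  apply: eq_integrable H => // t _ /=.
  by rewrite -!EFinD; congr EFin; ring.
Qed.

Lemma l2Z c f : l2 f -> l2 (c \*: f).
Proof.
move=> [pf mf f2]; split.
- by move=> t; rewrite /= pf.
- exact: measurable_funM.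
- have H := @integrableZl _ _ _ mu _ (measurable_itv _) (c ^+ 2) _ f2.
  apply: eq_integrable H => // t _ /=.
  by rewrite -EFinM exprMn.
Qed.

Lemma l2dotC f g : l2dot f g = l2dot g f.
Proof. by rewrite /l2dot; under eq_Rintegral do rewrite mulrC. Qed.

Lemma l2dotDl f g h : l2 f -> l2 g -> l2 h ->
  l2dot (f \+ g) h = l2dot f h + l2dot g h.
Proof.
move=> lf lg lh; rewrite /l2dot -RintegralD//; try exact: l2_mul_integrable.
by under eq_Rintegral do rewrite /= mulrDl.
Qed.

Lemma l2dotZl c f g : l2 f -> l2 g -> l2dot (c \*: f) g = c * l2dot f g.
Proof.
move=> lf lg; rewrite /l2dot -RintegralZl//; last exact: l2_mul_integrable.
by under eq_Rintegral do rewrite /= -mulrA.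
Qed.

Lemma l2dotDr f g h : l2 f -> l2 g -> l2 h ->
  l2dot h (f \+ g) = l2dot h f + l2dot h g.
Proof. by move=> lf lg lh; rewrite ![l2dot h _]l2dotC l2dotDl. Qed.

Lemma l2dotZr c f g : l2 f -> l2 g -> l2dot g (c \*: f) = c * l2dot g f.
Proof. by move=> lf lg; rewrite ![l2dot g _]l2dotC l2dotZl. Qed.

Lemma l2dot_ge0 f : 0 <= l2dot f f.
Proof. by apply: Rintegral_ge0 => t _; rewrite -expr2 sqr_ge0. Qed.

Lemma l2dot_cauchy f g : l2 f -> l2 g ->
  l2dot f g ^+ 2 <= l2dot f f * l2dot g g.
Proof.
move=> lf lg.
have H a b : 0 <= a ^+ 2 * l2dot f f + 2 * a * b * l2dot f g + b ^+ 2 * l2dot g g.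
  have := l2dot_ge0 ((a \*: f) \+ (b \*: g)).
  have laf := l2Z a lf; have lbg := l2Z b lg.
  rewrite l2dotDl ?l2dotDr//; try exact: l2D.
  rewrite !l2dotZl ?l2dotZr// [l2dot g f]l2dotC => /le_trans; apply.
  by rewrite le_eqVlt; apply/orP; left; apply/eqP; ring.
have := l2dot_ge0 f; have := l2dot_ge0 g.
set F := l2dot f f in H *; set G := l2dot g g in H *; set P := l2dot f g in H *.
move=> G0 F0.
have [G0'|G0'] := eqVneq G 0; last first.
  have := H G (- P); have Gp : 0 < G by rewrite lt_def G0' G0.
  have -> : G ^+ 2 * F + 2 * G * - P * P + (- P) ^+ 2 * G = G * (F * G - P ^+ 2).
    by ring.
  by rewrite pmulr_rge0// subr_ge0.
rewrite G0' mulr0.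
have [->|P0] := eqVneq P 0; first by rewrite expr0n.
(* With [G = 0] and [P != 0] this choice of [b] gives the form the value [F - (F + 1) = -1], which
   is absurd. *)
have := H 1 (- (F + 1) / (2 * P)); rewrite G0'.
have -> : 1 ^+ 2 * F + 2 * 1 * (- (F + 1) / (2 * P)) * P +
    (- (F + 1) / (2 * P)) ^+ 2 * 0 = -1 by field.
lra.
Qed.

Lemma l2norm_sq f : l2norm f ^+ 2 = l2dot f f.
Proof. by rewrite sqr_sqrtr// l2dot_ge0. Qed.

Lemma l2norm_ge0 f : 0 <= l2norm f.
Proof. exact: sqrtr_ge0. Qed.

Lemma ler_sqr_nng (x y : R) : 0 <= y -> x ^+ 2 <= y ^+ 2 -> x <= y.
Proof. by move=> y0 xy; rewrite real_leNgt ?num_real//; apply/negP => yx; nra. Qed.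

Lemma l2dot_norm f g : l2 f -> l2 g -> `|l2dot f g| <= l2norm f * l2norm g.
Proof.
move=> lf lg; apply: ler_sqr_nng; first by rewrite mulr_ge0// l2norm_ge0.
by rewrite exprMn !l2norm_sq real_normK ?num_real// l2dot_cauchy.
Qed.

Lemma l2normD f g : l2 f -> l2 g -> l2norm (f \+ g) <= l2norm f + l2norm g.
Proof.
move=> lf lg; apply: ler_sqr_nng; first by rewrite addr_ge0// l2norm_ge0.
rewrite sqrrD !l2norm_sq l2dotDl ?l2dotDr//; try exact: l2D.
rewrite [l2dot g f]l2dotC; have := l2dot_norm lf lg.
have := ler_norm (l2dot f g); lra.
Qed.

Lemma l2normZ c f : l2 f -> l2norm (c \*: f) = `|c| * l2norm f.
Proof.
move=> lf; rewrite /l2norm l2dotZl ?l2dotZr//; last exact: l2Z.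
by rewrite mulrA -expr2 sqrtrM ?sqr_ge0// sqrtr_sqr.
Qed.

Lemma l2dot_ae f g h : l2 f -> l2 g -> l2 h -> f = g %[ae mu] ->
  l2dot f h = l2dot g h.
Proof.
move=> lf lg lh fg; congr fine; apply: ae_eq_integral => //.
- by apply: measurable_int (l2_mul_integrable lf lh).
- by apply: measurable_int (l2_mul_integrable lg lh).
- move: fg; apply: filterS; first exact: (ae_filter_ringOfSetsType mu).
  by move=> t /= /(_ I) -> _.
Qed.

Lemma l2norm_ae f g : l2 f -> l2 g -> f = g %[ae mu] -> l2norm f = l2norm g.
Proof.
move=> lf lg fg; rewrite /l2norm (l2dot_ae lf lg lf fg) [l2dot g f]l2dotC.
by rewrite (l2dot_ae lf lg lg fg).
Qed.

Lemma is_derive_translate F f c : (forall t, is_derive t 1 F (f t)) ->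
  forall t, is_derive t 1 (fun x => F (x + c)) (f (t + c)).
Proof.
move=> dF t.
have d1 : is_derive t 1 (fun x => x + c : R^o) (1 + 0).
  exact: is_deriveD.
have := @is_derive1_comp R F (fun x => x + c) t _ _ (dF (t + c)) d1.
by rewrite addr0 mulr1.
Qed.

Lemma primitive_periodic F f : (forall t, is_derive t 1 F (f t)) ->
  periodic f 1 -> F 1 = F 0 -> periodic F 1.
Proof.
move=> dF pf F10 t.
have d t' : is_derive t' 1 (fun x => F (x + 1) - F x : R^o) 0.
  rewrite -(subrr (f t')) -[X in X - _]pf.
  by apply: is_deriveB; exact: is_derive_translate.
have := @is_derive_0_is_cst R (fun x => F (x + 1) - F x) t 0 d.
by rewrite add0r F10 subrr => /eqP; rewrite subr_eq0 => /eqP.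
Qed.

(** The primitive of [f^2] is nondecreasing and, its increment over a period being 0, periodic.
    Hence it is constant and its derivative [f^2] vanishes. *)
Lemma l2dot_continuous_eq0 f : continuous f -> periodic f 1 ->
  l2dot f f = 0 -> forall t, f t = 0.
Proof.
move=> cf pf f0 t.
have cf2 : continuous (fun x => f x * f x : R^o).
  by move=> x; apply: continuousM; exact: cf.
pose F := primitive (fun x => f x * f x : R^o).
have dF (x : R) : is_derive x 1 F (f x * f x) by exact: is_derive_primitive.
have fi a b := continuous_integrable a b cf2.
have F10 : F 1 = F 0.
  by apply/eqP; rewrite -subr_eq0 primitiveB//; exact/eqP.
have pF : periodic F 1.
  by apply: (primitive_periodic dF) => // x; rewrite pf.
have mF x y : x <= y -> F x <= F y.
  move=> xy; rewrite -subr_ge0 primitiveB//.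
  by apply: Rintegral_ge0 => z _; rewrite -expr2 sqr_ge0.
have cF : {near t, (cst (F t) : R -> R^o) =1 F}.
  have h0 : t - 2^-1 < t by rewrite ltrBlDr ltrDl invr_gt0.
  have h1 : t < t + 2^-1 by rewrite ltrDl invr_gt0.
  near=> x; rewrite /cst; apply/eqP; rewrite eq_le.
  have x0 : t - 2^-1 < x by near: x; exact: lt_nbhsr.
  have x1 : x < t + 2^-1 by near: x; exact: lt_nbhsl.
  by rewrite -{1}(periodicB1 pF t) -(pF t) !mF//; lra.
have H : is_derive t 1 F 0 by apply: near_eq_is_derive cF (is_derive_cst _ _ _).
have := @derive_val _ _ _ _ _ _ _ H; rewrite (@derive_val _ _ _ _ _ _ _ (dF t)).
by move/eqP; rewrite mulf_eq0 orbb => /eqP.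
Unshelve. all: by end_near. Qed.

End l2_theory.

(** * Absolutely continuous functions and the space H^2 *)

Section h2_theory.
Context {R : realType}.
Implicit Types (f g h k F G : R -> R^o) (a b c s t : R).
Local Notation mu := (@lebesgue_measure R).

Lemma l2_derivative_continuous F g : l2_derivative F g -> continuous F.
Proof.
move=> [lg FE] t.
have i1 := @l2_itv_integrable _ g (t - 1) (t + 1) lg.
have tt : t - 1 < t + 1 by lra.
have tin : t \in `]t - 1, t + 1[ by rewrite in_itv/=; apply/andP; split; lra.
have ct := within_continuous_continuous tt
  (parameterized_integral_continuous (ltW tt) i1) tin.
have cG : parameterized_integral mu (t - 1) x g + F (t - 1) @[x --> t] -->
    parameterized_integral mu (t - 1) t g + F (t - 1).
  by apply: cvgD; [exact: ct|exact: cvg_cst].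
have E x : t - 1 <= x -> parameterized_integral mu (t - 1) x g + F (t - 1) = F x.
  by move=> tx; rewrite /parameterized_integral -FE// subrK.
rewrite E in cG; last lra.
apply: cvg_trans cG; apply: near_eq_cvg; near=> x; rewrite E//.
apply: ltW; near: x; apply: lt_nbhsr; lra.
Unshelve. all: by end_near. Qed.

(** The difference has zero integral over every interval, so Lebesgue differentiation makes it
    vanish almost everywhere. This is done to the right of each [- n], and the countably many null
    sets are then united. *)
Lemma l2_derivative_unique F g1 g2 : l2_derivative F g1 ->
  l2_derivative F g2 -> g1 = g2 %[ae mu].
Proof.
move=> [lg1 E1] [lg2 E2].
pose d : R -> R^o := g1 \+ ((-1) \*: g2).
have ld : l2 d by apply: l2D => //; exact: l2Z.
have di a b := l2_itv_integrable a b ld.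
have d00 s t : \int[mu]_(x in `[s, t]) d x = 0.
  have [st|ts] := leP s t; last first.
    by rewrite set_itv_ge ?Rintegral_set0// bnd_simp -ltNge.
  rewrite RintegralD//; last 2 first.
    exact: l2_itv_integrable.
    by apply: (l2_itv_integrable _ _ (l2Z (-1) lg2)).
  rewrite RintegralZl//; last exact: l2_itv_integrable.
  by rewrite -E1// -E2// mulN1r subrr.
have locd : locally_integrable setT d.
  split; [by case: ld|exact: openT|move=> K _ cK].
  have [M [Mr MK]] := compact_bounded cK.
  have KM : K `<=` `[- (M + 1), M + 1].
    move=> x Kx; rewrite /= in_itv/= -ler_norml; apply: MK => //.
    by rewrite ltrDl.
  have : mu.-integrable K (EFin \o d).
    by apply: integrableS (di (- (M + 1)) (M + 1)) => //; exact: compact_measurable.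
  by move=> /integrableP[_].
have d0 (n : nat) : {ae mu, forall x, - n%:R < x -> d x = 0}.
  have := FTC1 (a := BLeft (- n%:R)) (di _) locd.
  apply: filterS; first exact: (ae_filter_ringOfSetsType mu).
  move=> x H nx; have [|_ <-] := H; first by rewrite lte_fin.
  rewrite (_ : (fun y => _) = cst 0) ?derive1_cst//.
  by apply/funext => y; exact: d00.
have : {ae mu, forall x (n : nat), - n%:R < x -> d x = 0} by exact: ae_foralln d0.
apply: filterS; first exact: (ae_filter_ringOfSetsType mu).
move=> t /= H _; apply/eqP; rewrite -subr_eq0 -mulN1r; apply/eqP.
apply: (H (Num.truncn (- t)).+1); rewrite ltrNl; exact: truncnS_gt.
Qed.

Lemma periodic_reduce t : exists2 s : R, 0 <= s <= 1 &
  forall f, periodic f 1 -> f t = f s.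
Proof.
have pz (m : int) f : periodic f 1 -> forall u, f (u + m%:~R) = f u.
  move=> pf u; case: m => n; first by rewrite -pmulrn periodicn.
  by rewrite NegzE mulrNz -pmulrn -[in RHS](subrK (n.+1%:R) u) periodicn.
exists (t - (Num.floor t)%:~R).
  have := Num.Theory.floor_itv t; rewrite intrD => /andP[? ?]; lra.
by move=> f pf; rewrite -[in LHS](subrK (Num.floor t)%:~R t) pz.
Qed.

Lemma periodic_bounded f : continuous f -> periodic f 1 ->
  exists2 M : R, 0 <= M & forall t, `|f t| <= M.
Proof.
move=> cf pf.
have cnf : {within `[0, 1], continuous (fun x => `|f x|)}.
  by apply: continuous_subspaceT => x; apply: continuous_comp; [exact: cf|exact: norm_continuous].
have [c c01 cM] := EVT_max ler01 cnf.
exists `|f c| => // t; have [s s01 ->//] := periodic_reduce t.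
by apply: cM; rewrite in_itv.
Qed.
(** The difference quotient of [Phi] is at most [|C|] times an increment of [Psi], which tends to 0
    by continuity. This stands in for a product rule when one factor is merely absolutely
    continuous. *)
Lemma is_derive0_bound (Phi Psi : R -> R^o) (C : R) t : continuous Psi ->
  (forall s t, s <= t -> `|Phi t - Phi s| <= C * (t - s) * (Psi t - Psi s)) ->
  is_derive t 1 Phi 0.
Proof.
move=> cPsi H.
have H' (h : R) : h != 0 ->
    `|h^-1 *: (Phi (h *: 1 + t) - Phi t)| <= `|C| * `|Psi (h + t) - Psi t|.
  move=> h0; rewrite /GRing.scale/= mulr1 normrM normfV.
  rewrite ler_pdivrMl ?normr_gt0//.
  have [h0'|h0'] := leP 0 h.
    have := H t (h + t); rewrite lerDr => /(_ h0') /le_trans; apply.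
    apply: (le_trans (ler_norm _)); rewrite !normrM (addrK t h).
    by rewrite mulrCA mulrA.
  have := H (h + t) t; rewrite gerDr => /(_ (ltW h0')).
  rewrite distrC => /le_trans; apply.
  apply: (le_trans (ler_norm _)); rewrite !normrM distrC (addrK t h).
  by rewrite distrC mulrCA mulrA.
suff cvg0 : h^-1 *: (Phi (h *: 1 + t) - Phi t) @[h --> (0 : R)^'] --> (0 : R^o).
  split; first by apply/cvg_ex; exists 0.
  by apply: cvg_lim => //; exact: Rhausdorff.
apply/cvgrPdist_lt => e e0; near=> h; rewrite sub0r normrN.
apply: (le_lt_trans (H' _ _)); first by near: h; exact: nbhs_dnbhs_neq.
have C1 : 0 < `|C| + 1 by rewrite ltr_wpDl.
have : `|Psi (h + t) - Psi t| < e / (`|C| + 1).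
  rewrite distrC; near: h; apply: nbhs_dnbhs.
  have cP : Psi (h + t) @[h --> (0 : R)] --> Psi t.
    have ht : h + t @[h --> (0 : R)] --> 0 + t.
      by apply: cvgD; [exact: cvg_id|exact: cvg_cst].
    by rewrite add0r in ht; apply: cvg_comp ht _; exact: cPsi.
  by move/cvgrPdist_lt : cP; apply; rewrite divr_gt0.
rewrite ltr_pdivlMr// mulrC; apply: le_lt_trans.
by rewrite ler_wpM2r// lerDl.
Unshelve. all: by end_near. Qed.

Lemma Rintegral_itv_cst c s t : s  <= t ->
  \int[mu]_(x in `[s, t]) c = c * (t - s).
Proof.
move=> st; rewrite Rintegral_cst//=.
rewrite [lebesgue_measure _](lebesgue_measure_itv `[s, t]) /= lte_fin.
by case: ltgtP st => //= -> _; rewrite subrr.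
Qed.

Lemma l2_periodic_mul_integrable f g a b : l2 f -> l2 g ->
  mu.-integrable `[a, b] (fun t => (f t * g t)%:E).
Proof.
move=> lf lg; apply: (@periodic_integrable _ (fun t => f t * g t)).
- by case: lf lg => _ mf _ [_ mg _]; exact: measurable_funM.
- by move=> t; case: lf lg => pf _ _ [pg _ _]; rewrite pf pg.
- exact: l2_mul_integrable.
Qed.

Lemma l2_abs g : l2 g -> l2 (fun t => `|g t|).
Proof.
case=> pg mg g2; split.
- by move=> t; rewrite pg.
- exact: measurableT_comp.
- by apply: eq_integrable g2 => // t _; rewrite real_normK ?num_real.
Qed.

(* [Phi t := \int_0^t (g k + F k') - F t k t] satisfies
   [|Phi t - Phi s| <= 2 M |t - s| |\int_s^t |g||] with [M] a bound of [k'],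
   so its derivative vanishes. *)
Lemma l2_derivative_by_parts F g k k' : l2_derivative F g -> periodic F 1 ->
  (forall t, is_derive t 1 k (k' t)) -> continuous k' -> periodic k 1 ->
  periodic k' 1 -> l2dot g k = - l2dot F k'.
Proof.
move=> dFg pF dk ck' pk pk'; have cF := l2_derivative_continuous dFg.
have [lg FE] := dFg; have ck := is_derive_continuous dk.
have lF := l2_continuous cF pF.
have lk := l2_continuous ck pk; have lk' := l2_continuous ck' pk'.
have [M M0 Mk'] := periodic_bounded ck' pk'.
pose u : R -> R^o := fun t => g t * k t + F t * k' t.
have ui a b : mu.-integrable `[a, b] (EFin \o u).
  have := @integrableD _ _ _ mu `[a, b] (measurable_itv _) _ _
    (l2_periodic_mul_integrable a b lg lk) (l2_periodic_mul_integrable a b lF lk').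
  by apply: eq_integrable.
have ln := l2_abs lg.
have ni a b : mu.-integrable `[a, b] (EFin \o (fun t => `|g t|)).
  exact: l2_itv_integrable ln.
pose Phi : R -> R^o := fun t => primitive u t - F t * k t.
pose Psi : R -> R^o := primitive (fun t => `|g t|).
have kE s t : s <= t -> \int[mu]_(x in `[s, t]) k' x = k t - k s.
  by move=> st; exact: integral_derive.
have key s t : s <= t -> `|Phi t - Phi s| <= 2 * M * (t - s) * (Psi t - Psi s).
  move=> st.
  have W0 x y : 0 <= \int[mu]_(z in `[x, y]) `|g z| by exact: Rintegral_ge0.
  have PsiE : Psi t - Psi s = \int[mu]_(x in `[s, t]) `|g x| by rewrite primitiveB.
  (* Splitting [F t k t - F s k s] as [F t (k t - k s) + k s (F t - F s)] leaves only increments of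
     [k] and [F] as factors under the integral. *)
  have -> : Phi t - Phi s = \int[mu]_(x in `[s, t])
      (g x * (k x - k s) + (F x - F t) * k' x).
    have -> : Phi t - Phi s = \int[mu]_(x in `[s, t]) u x -
        (F t * \int[mu]_(x in `[s, t]) k' x + k s * \int[mu]_(x in `[s, t]) g x).
      by rewrite kE// -FE// -(primitiveB ui)// /Phi; ring.
    rewrite -!RintegralZl//; last 2 first.
    - exact: l2_itv_integrable.
    - exact: l2_itv_integrable.
    rewrite -RintegralD//; last 2 first.
    - by apply: (l2_itv_integrable s t (l2Z (F t) lk')).
    - by apply: (l2_itv_integrable s t (l2Z (k s) lg)).
    rewrite -RintegralB//; last first.
      by apply: (l2_itv_integrable s t (l2D (l2Z (F t) lk') (l2Z (k s) lg))).
    by apply: eq_Rintegral => x _; rewrite /u; ring.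
  have vi : mu.-integrable `[s, t]
      (EFin \o (fun x => g x * (k x - k s) + (F x - F t) * k' x)).
    have := @integrableB _ _ _ mu `[s, t] (measurable_itv _) _ _ (ui s t)
      (l2_itv_integrable s t (l2D (l2Z (F t) lk') (l2Z (k s) lg))).
    apply: eq_integrable => // x _; rewrite /= /u -EFinB /GRing.scale/=.
    by congr EFin; ring.
  apply: (le_trans (le_normr_Rintegral _ vi)) => //.
  set W := \int[mu]_(x in `[s, t]) `|g x| in PsiE.
  have bound x : `[s, t]%classic x ->
      `|g x * (k x - k s) + (F x - F t) * k' x| <=
      M * (t - s) * `|g x| + M * W.
    rewrite /= in_itv/= => /andP[sx xt].
    apply: (le_trans (ler_normD _ _)); rewrite !normrM; apply: lerD.
      rewrite mulrC ler_wpM2r//.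
      rewrite -kE//; apply: (le_trans (le_normr_Rintegral _ _)) => //.
        exact: l2_itv_integrable.
      have := @le_Rintegral _ _ R mu `[s, x] (fun y => `|k' y|) (fun=> M)
        (measurable_itv _).
      rewrite Rintegral_itv_cst// => H; apply: (le_trans (H _ _ _)) => //.
      - by apply: integrable_norm; exact: l2_itv_integrable.
      - exact: (l2_itv_integrable s x (l2_cst M)).
      - by rewrite ler_wpM2l// lerB.
    rewrite mulrC ler_pM// distrC FE//.
    apply: (le_trans (le_normr_Rintegral _ _)) => //.
      exact: l2_itv_integrable.
    by rewrite /W (@integral_itv_split _ _ s t x)// lerDr.
  have le_int := @le_Rintegral _ _ R mu `[s, t]
    (fun x => `|g x * (k x - k s) + (F x - F t) * k' x|)
    (fun x => M * (t - s) * `|g x| + M * W) (measurable_itv _).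
  apply: (le_trans (le_int _ _ bound)) => //.
  - exact: integrable_norm.
  - exact: (l2_itv_integrable s t (l2D (l2Z (M * (t - s)) ln) (l2_cst (M * W)))).
  rewrite RintegralD//; last 2 first.
  - exact: (l2_itv_integrable s t (l2Z (M * (t - s)) ln)).
  - exact: (l2_itv_integrable s t (l2_cst (M * W))).
  by rewrite RintegralZl// -/W Rintegral_itv_cst// PsiE le_eqVlt; apply/orP; left; apply/eqP; ring.
have cPsi : continuous Psi.
  apply: (@l2_derivative_continuous _ (fun t => `|g t|)).
  by split=> // s t st; rewrite primitiveB.
have dPhi (t : R) : is_derive t 1 Phi 0 by exact: is_derive0_bound cPsi key.
have E := @is_derive_0_is_cst R Phi 1 0 dPhi.
have : primitive u 1 - primitive u 0 = F 1 * k 1 - F 0 * k 0.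
  by move: E; rewrite /Phi; lra.
have F10 : F 1 = F 0 by rewrite -(pF 0) add0r.
have k10 : k 1 = k 0 by rewrite -(pk 0) add0r.
rewrite primitiveB// F10 k10 subrr /u RintegralD//.
- rewrite -/(l2dot g k) -/(l2dot F k') => /eqP.
  by rewrite addr_eq0 => /eqP.
- exact: l2_mul_integrable.
- exact: l2_mul_integrable.
Qed.

Lemma h2_is_derive f : h2 f -> forall t, is_derive t 1 f (derive1 f t).
Proof. by move=> [_ df _] t; split => //; rewrite derive1E. Qed.

Lemma h2_second_derivative f : h2 f ->
  l2_derivative (derive1 f) (second_derivative f).
Proof. by move=> [_ _ exg]; exact: getPex exg. Qed.

Lemma h2_periodic f : h2 f -> periodic f 1.
Proof. by case. Qed.

Lemma h2_continuous f : h2 f -> continuous f.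
Proof. by move/h2_is_derive/is_derive_continuous. Qed.

Lemma h2_derive1_continuous f : h2 f -> continuous (derive1 f).
Proof. by move/h2_second_derivative/l2_derivative_continuous. Qed.

Lemma periodic_is_derive F f : (forall t, is_derive t 1 F (f t)) ->
  periodic F 1 -> periodic f 1.
Proof.
move=> dF pF t; have d1 := is_derive_translate 1 dF t.
have E : (fun x => F (x + 1)) = F by apply/funext.
rewrite E in d1.
by rewrite -(@derive_val _ _ _ _ _ _ _ d1) (@derive_val _ _ _ _ _ _ _ (dF t)).
Qed.

Lemma h2_derive1_periodic f : h2 f -> periodic (derive1 f) 1.
Proof. by move=> hf; apply: periodic_is_derive (h2_is_derive hf) (h2_periodic hf). Qed.

Lemma h2_l2 f : h2 f -> l2 f.
Proof. by move=> hf; apply: l2_continuous; [exact: h2_continuous|exact: h2_periodic]. Qed.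

Lemma h2_l2_derive1 f : h2 f -> l2 (derive1 f).
Proof.
by move=> hf; apply: l2_continuous; [exact: h2_derive1_continuous|exact: h2_derive1_periodic].
Qed.

Lemma h2_l2_second f : h2 f -> l2 (second_derivative f).
Proof. by move/h2_second_derivative => []. Qed.

Lemma l2_derivative_lin F g G k a : l2_derivative F g -> l2_derivative G k ->
  l2_derivative (fun t => a * F t + G t) (fun t => a * g t + k t).
Proof.
move=> [lg FE] [lk GE]; have lag := l2Z a lg.
split; first exact: l2D.
move=> s t st; rewrite RintegralD//; last 2 first.
- exact: l2_itv_integrable lag.
- exact: l2_itv_integrable.
rewrite RintegralZl//; last exact: l2_itv_integrable.
by rewrite -FE// -GE//; ring.
Qed.

Lemma is_derive_lin F G a (t : R) (x y : R^o) : is_derive t 1 F x ->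
  is_derive t 1 G y -> is_derive t 1 (a *: F + G) (a *: x + y).
Proof.
by move=> dF dG; exact: is_deriveD.
Qed.

Lemma h2_derive1_lin f g a : h2 f -> h2 g ->
  derive1 (a *: f + g) = a *: derive1 f + derive1 g.
Proof.
move=> hf hg; apply/funext => t; rewrite derive1E.
exact: (@derive_val _ _ _ _ _ _ _ (is_derive_lin a (h2_is_derive hf t) (h2_is_derive hg t))).
Qed.

Lemma h2_lin f g a : h2 f -> h2 g -> h2 (a *: f + g).
Proof.
move=> hf hg; split.
- by move=> t; rewrite /= !fctE (h2_periodic hf) (h2_periodic hg).
- move=> t; apply: (@ex_derive _ _ _ _ _ _ _ (is_derive_lin a (h2_is_derive hf t) (h2_is_derive hg t))).
- rewrite h2_derive1_lin//; eexists.
  exact: l2_derivative_lin (h2_second_derivative hf) (h2_second_derivative hg).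
Qed.

Lemma second_derivative_lin f g a : h2 f -> h2 g ->
  second_derivative (a *: f + g)
    = a *: second_derivative f + second_derivative g %[ae mu].
Proof.
move=> hf hg; apply: l2_derivative_unique (h2_second_derivative (h2_lin a hf hg)) _.
rewrite h2_derive1_lin//.
exact: l2_derivative_lin (h2_second_derivative hf) (h2_second_derivative hg).
Qed.

Lemma h2_by_parts f k : h2 f -> h2 k ->
  l2dot (second_derivative f) k = - l2dot (derive1 f) (derive1 k).
Proof.
move=> hf hk; apply: l2_derivative_by_parts (h2_second_derivative hf) _ _ _ _ _.
- exact: h2_derive1_periodic.
- exact: h2_is_derive.
- exact: h2_derive1_continuous.
- exact: h2_periodic.
- exact: h2_derive1_periodic.
Qed.

Lemma derive1_is_derive F f : (forall t, is_derive t 1 F (f t)) ->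
  derive1 F = f.
Proof.
by move=> dF; apply/funext => t; rewrite derive1E (@derive_val _ _ _ _ _ _ _ (dF t)).
Qed.

Section twice_differentiable.
Variables f f' f'' : R -> R^o.
Hypotheses (pf : periodic f 1) (df : forall t, is_derive t 1 f (f' t))
  (df' : forall t, is_derive t 1 f' (f'' t)) (cf'' : continuous f'').

Let l2d : l2_derivative (derive1 f) f''.
Proof.
rewrite (derive1_is_derive df); split; last by move=> s t st; rewrite (integral_derive st cf'' df').
by apply: l2_continuous => //; exact: periodic_is_derive df' (periodic_is_derive df pf).
Qed.

Lemma h2_twice_differentiable : h2 f.
Proof.
by split => //; exists f''.
Qed.

Lemma second_derivative_ae : second_derivative f = f'' %[ae mu].
Proof.
exact: l2_derivative_unique (h2_second_derivative h2_twice_differentiable) l2d.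
Qed.

End twice_differentiable.

(** [derive1 f] and the primitive of the continuous [f''] have equal increments, so they differ by a
    constant. This is how an almost everywhere equation becomes a classical one. *)
Lemma h2_is_derive2 f f'' : h2 f -> continuous f'' -> periodic f'' 1 ->
  second_derivative f = f'' %[ae mu] ->
  forall t, is_derive t 1 (derive1 f) (f'' t).
Proof.
move=> hf cf'' pf'' E t.
have [l2s DE] := h2_second_derivative hf.
have fi a b := continuous_integrable a b cf''.
have dE s t' : s <= t' -> derive1 f t' - derive1 f s = primitive f'' t' - primitive f'' s.
  move=> st; rewrite DE// primitiveB//; congr fine.
  apply: ae_eq_integral => //.
  - exact: measurable_int (l2_itv_integrable s t' l2s).
  - exact: measurable_int (fi s t').
  - move: E; apply: filterS; first exact: (ae_filter_ringOfSetsType mu).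
    by move=> x /= /(_ I) -> _.
have -> : derive1 f = (fun t => primitive f'' t + derive1 f 0 : R^o).
  apply/funext => x; have [x0|/ltW x0] := leP 0 x.
    by have := dE _ _ x0; rewrite primitive0; lra.
  by have := dE _ _ x0; rewrite primitive0; lra.
rewrite -[f'' t]addr0; apply: is_deriveD; exact: is_derive_primitive.
Qed.

Lemma h2_cst c : h2 (cst c : R -> R^o).
Proof.
apply: (@h2_twice_differentiable _ (cst 0) (cst 0)) => //.
by move=> t; exact: cvg_cst.
Qed.

End h2_theory.

(** * Frechet calculus on H^2 with values in seminormed spaces *)

Section frechet.
Context {R : realType}.
Local Notation V := ((R -> R^o) * (R -> R^o))%type.
Local Notation mu := (@lebesgue_measure R).

Lemma H2_lin (a : R) (h k : V) : H2 h -> H2 k -> H2 (a *: h + k).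
Proof. by move=> [h1 h2] [k1 k2]; split; exact: h2_lin. Qed.

Lemma H2norm_ge0 (h : V) : 0 <= H2norm h.
Proof. exact: sqrtr_ge0. Qed.

(* [nb x r] reads: [x] belongs to the space and its norm is at most [r]. This
   allows spaces that are not types of their own (L2, periodic continuous
   functions) and avoids suprema. *)
Record seminorm (W : lmodType R) (nb : W -> R -> Prop) : Prop := Seminorm {
  nb_ge0 : forall x r, nb x r -> 0 <= r;
  nb_le : forall x r s, r <= s -> nb x r -> nb x s;
  nb0 : nb 0 0;
  nbD : forall x y r s, nb x r -> nb y s -> nb (x + y) (r + s);
  nbZ : forall a x r, nb x r -> nb (a *: x) (`|a| * r) }.

(** The bound on [F z] also records membership in the space, as the product rule requires. Linearity
    is asked only up to vectors of norm 0, because second derivatives are determined up to null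
    sets. *)
Definition fdiff (W : lmodType R) (nb : W -> R -> Prop) (F : V -> W) (z : V)
    (A : V -> W) : Prop :=
  [/\ exists C, nb (F z) C,
      forall (a : R) h k, H2 h -> H2 k -> nb (A (a *: h + k) - (a *: A h + A k)) 0,
      exists2 C : R, 0 <= C & forall h, H2 h -> nb (A h) (C * H2norm h) &
      forall e : R, 0 < e -> exists2 d : R, 0 < d &
        forall h, H2 h -> H2norm h < d ->
          nb (F (z + h) - F z - A h) (e * H2norm h)].

Section one_space.
Variables (W : lmodType R) (nb : W -> R -> Prop) (nbS : seminorm nb).

Lemma nb0_le x r : 0 <= r -> nb x 0 -> nb x r.
Proof. exact: nb_le. Qed.

Lemma fdiff_linear (P : V -> W) (z : V) (C : R) : H2 z ->
  (forall h, H2 h -> nb (P h) (C * H2norm h)) ->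
  (forall (a : R) h k, H2 h -> H2 k -> nb (P (a *: h + k) - (a *: P h + P k)) 0) ->
  fdiff nb P z P.
Proof.
move=> Hz PC Plin; split => //.
- by exists (C * H2norm z); exact: PC.
- exists `|C| => // h Hh; apply: nb_le (PC _ Hh) => //.
  by rewrite ler_wpM2r ?H2norm_ge0// ler_norm.
- move=> e e0; exists 1 => // h Hh _.
  apply: nb0_le; first by rewrite mulr_ge0 ?H2norm_ge0// ltW.
  have := Plin 1 z h Hz Hh; rewrite !scale1r opprD addrA.
  exact.
Qed.

Lemma fdiff_cst (x : W) (z : V) (C : R) : nb x C ->
  fdiff nb (fun=> x) z (fun=> 0).
Proof.
move=> xC; split; first by exists C.
- by move=> a h k _ _; rewrite scaler0 addr0 subrr; exact: nb0.
- by exists 0 => // h _; rewrite mul0r; exact: nb0.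
- move=> e e0; exists 1 => // h _ _; rewrite !subrr.
  by apply: nb0_le; [rewrite mulr_ge0 ?H2norm_ge0// ltW|exact: nb0].
Qed.

Lemma fdiff_add F G A B z : fdiff nb F z A -> fdiff nb G z B ->
  fdiff nb (fun w => F w + G w) z (fun h => A h + B h).
Proof.
have BB (x y p q : W) : (x + y) - (p + q) = (x - p) + (y - q).
  by rewrite opprD addrACA.
move=> [[C1 F1] F2 [C3 C30 F3] F4] [[D1 G1] G2 [D3 D30 G3] G4]; split.
- by exists (C1 + D1); exact: nbD.
- move=> a h k Hh Hk.
  have := nbD nbS (F2 a h k Hh Hk) (G2 a h k Hh Hk).
  by rewrite addr0 -BB scalerDr [a *: A h + _ + _]addrACA.
- exists (C3 + D3); first exact: addr_ge0.
  by move=> h Hh; rewrite mulrDl; apply: nbD => //; [exact: F3|exact: G3].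
- move=> e e0; have e2 : 0 < e / 2 by lra.
  have [d d0 Fd] := F4 _ e2; have [d' d'0 Gd] := G4 _ e2.
  exists (Num.min d d'); first by rewrite lt_min d0.
  move=> h Hh; rewrite lt_min => /andP[hd hd'].
  have := nbD nbS (Fd h Hh hd) (Gd h Hh hd').
  by rewrite -mulrDl -splitr -!BB.
Qed.

Lemma fdiff_ext F G A z : F =1 G -> fdiff nb F z A -> fdiff nb G z A.
Proof. by move/funext ->. Qed.

End one_space.

Lemma fdiff_weaken (W : lmodType R) (nb nb' : W -> R -> Prop) F z A :
  (forall x r, nb x r -> nb' x r) -> fdiff nb F z A -> fdiff nb' F z A.
Proof.
move=> H [[C1 F1] F2 [C3 C30 F3] F4]; split.
- by exists C1; exact: H.
- by move=> a h k Hh Hk; apply: H; exact: F2.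
- by exists C3 => // h Hh; apply: H; exact: F3.
- by move=> e e0; have [d d0 Fd] := F4 e e0; exists d => // h Hh hd; apply: H; exact: Fd.
Qed.

Section bilinear.
Variables (W1 W2 W3 : lmodType R) (nb1 : W1 -> R -> Prop) (nb2 : W2 -> R -> Prop).
Variables (nb3 : W3 -> R -> Prop) (b : W1 -> W2 -> W3).
Hypotheses (S1 : seminorm nb1) (S2 : seminorm nb2) (S3 : seminorm nb3).
Hypothesis bb : forall x y r s, nb1 x r -> nb2 y s -> nb3 (b x y) (r * s).
Hypothesis bl : forall a x x' y r r' s, nb1 x r -> nb1 x' r' -> nb2 y s ->
  b (a *: x + x') y = a *: b x y + b x' y.
Hypothesis br : forall a x y y' r s s', nb1 x r -> nb2 y s -> nb2 y' s' ->
  b x (a *: y + y') = a *: b x y + b x y'.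

Let blB x x' y r r' s : nb1 x r -> nb1 x' r' -> nb2 y s ->
  b (x - x') y = b x y - b x' y.
Proof.
move=> nx nx' ny; rewrite addrC -scaleN1r (bl _ nx' nx ny).
by rewrite scaleN1r addrC.
Qed.

Let brB x y y' r s s' : nb1 x r -> nb2 y s -> nb2 y' s' ->
  b x (y - y') = b x y - b x y'.
Proof.
move=> nx ny ny'; rewrite addrC -scaleN1r (br _ nx ny' ny).
by rewrite scaleN1r addrC.
Qed.

(* With F' = F (z + h), G' = G (z + h): the remainder is
   b (F' - F) (G' - G) + b (F' - F - A h) G + b F (G' - G - B h). *)
Lemma fdiff_bilinear F G A B z : fdiff nb1 F z A -> fdiff nb2 G z B ->
  fdiff nb3 (fun w => b (F w) (G w)) z (fun h => b (A h) (G z) + b (F z) (B h)).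
Proof.
move=> [[C F1] F2 [CA CA0 F3] F4] [[D G1] G2 [CB CB0 G3] G4].
have C0 := nb_ge0 S1 F1; have D0 := nb_ge0 S2 G1.
split.
- by exists (C * D); exact: bb.
- move=> a h k Hh Hk.
  have Hm := H2_lin a Hh Hk.
  have nA := F3 _ Hh; have nA' := F3 _ Hk; have nA'' := F3 _ Hm.
  have nB := G3 _ Hh; have nB' := G3 _ Hk; have nB'' := G3 _ Hm.
  have nAl := nbD S1 (nbZ S1 a nA) nA'; have nBl := nbD S2 (nbZ S2 a nB) nB'.
  have := nbD S3 (bb (F2 a h k Hh Hk) G1) (bb F1 (G2 a h k Hh Hk)).
  rewrite mul0r mulr0 addr0 (blB nA'' nAl G1) (brB F1 nB'' nBl).
  rewrite (bl _ nA nA' G1) (br _ F1 nB nB').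
  by rewrite addrACA -opprD [a *: b (A h) _ + _ + _]addrACA -scalerDr.
- exists (CA * D + C * CB); first by rewrite addr_ge0 ?mulr_ge0.
  move=> h Hh; rewrite mulrDl; apply: nbD => //.
    by rewrite mulrAC; apply: bb => //; exact: F3.
  by rewrite -mulrA; apply: bb => //; exact: G3.
- move=> e e0.
  (* [S] collects the coefficients of [e' * H2norm h] in the bounds of the three remainder terms,
     plus 1 to be positive. The condition [e' <= 1] yields the constants [CA + 1] and [CB + 1] for
     the increments of [F] and [G]. *)
  pose S : R := (CA + 1) * (CB + 1) + D + C + 1.
  have S0 : 0 < S by rewrite /S ltr_wpDl// !addr_ge0// mulr_ge0// addr_ge0.
  have [e' [e'0 e'1 e'e]] : exists e' : R, [/\ 0 < e', e' <= 1 & e' * S <= e].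
    exists (Num.min 1 (e / S)); split; first by rewrite lt_min ltr01 divr_gt0.
      by rewrite ge_min lexx.
    by rewrite -ler_pdivlMr// ge_min lexx orbT.
  have [d d0 Fd] := F4 _ e'0; have [d' d'0 Gd] := G4 _ e'0.
  exists (Num.min e' (Num.min d d')); first by rewrite !lt_min e'0 d0.
  move=> h Hh; rewrite !lt_min => /and3P[he' hd hd'].
  have r1 := Fd _ Hh hd; have s1 := Gd _ Hh hd'.
  have nA := F3 _ Hh; have nB := G3 _ Hh.
  have dF : nb1 (F (z + h) - F z) ((CA + 1) * H2norm h).
    have := nbD S1 r1 nA; rewrite subrK -mulrDl; apply: nb_le S1 _ _ _ _.
    by rewrite ler_wpM2r ?H2norm_ge0// addrC lerD.
  have dG : nb2 (G (z + h) - G z) ((CB + 1) * H2norm h).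
    have := nbD S2 s1 nB; rewrite subrK -mulrDl; apply: nb_le S2 _ _ _ _.
    by rewrite ler_wpM2r ?H2norm_ge0// addrC lerD.
  have nF' : nb1 (F (z + h)) ((CA + 1) * H2norm h + C).
    by have := nbD S1 dF F1; rewrite subrK.
  have nG' : nb2 (G (z + h)) ((CB + 1) * H2norm h + D).
    by have := nbD S2 dG G1; rewrite subrK.
  have := nbD S3 (nbD S3 (bb dF dG) (bb r1 G1)) (bb F1 s1).
  rewrite (blB nF' F1 dG) (brB nF' nG' G1) (brB F1 nG' G1).
  rewrite (blB dF nA G1) (blB nF' F1 G1) (brB F1 dG nB) (brB F1 nG' G1).
  set p := b (F (z + h)) (G (z + h)); set m := b (F (z + h)) (G z).
  set n := b (F z) (G (z + h)); set v := b (F z) (G z).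
  have -> : p - m - (n - v) + (m - v - b (A h) (G z)) + (n - v - b (F z) (B h))
      = p - v - (b (A h) (G z) + b (F z) (B h)).
    rewrite -addrA [m - v - _ + _]addrC addrA subrKA addrACA subrKA -opprD.
    by rewrite [b (F z) _ + _]addrC.
  apply: nb_le S3 _ _ _ _.
  have h0 := H2norm_ge0 h; set H := H2norm h in he' h0 *.
  apply: (@le_trans _ _ (e' * S * H)); last by rewrite ler_wpM2r.
  have H1 : (CA + 1) * H * ((CB + 1) * H) <= (CA + 1) * (CB + 1) * e' * H.
    rewrite -subr_ge0.
    have -> : (CA + 1) * (CB + 1) * e' * H - (CA + 1) * H * ((CB + 1) * H)
      = (CA + 1) * (CB + 1) * H * (e' - H) by ring.
    apply: mulr_ge0; last by rewrite subr_ge0 ltW.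
    by rewrite !mulr_ge0 ?addr_ge0.
  have H3 : 0 <= e' * H by rewrite mulr_ge0// ltW.
  have -> : e' * S * H = (CA + 1) * (CB + 1) * e' * H + e' * H * D + C * (e' * H)
    + e' * H by rewrite /S; ring.
  lra.
Qed.

End bilinear.

Lemma h2norm_ge (f : R -> R^o) :
  [/\ l2norm f <= h2norm f, l2norm (derive1 f) <= h2norm f &
      l2norm (second_derivative f) <= h2norm f].
Proof.
have n0 := @l2norm_ge0 R.
have := sqr_ge0 (l2norm f); have := sqr_ge0 (l2norm (derive1 f)).
have := sqr_ge0 (l2norm (second_derivative f)) => ???.
by split; apply: ler_sqr_nng; (try exact: sqrtr_ge0); rewrite [leRHS]sqr_sqrtr; lra.
Qed.

Lemma H2norm_sq (h : V) : H2norm h ^+ 2 = h2norm h.1 ^+ 2 + h2norm h.2 ^+ 2.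
Proof.
have H : 0 <= h2norm h.1 ^+ 2 + h2norm h.2 ^+ 2 :> R.
  by apply: addr_ge0; exact: sqr_ge0.
by rewrite /H2norm (sqr_sqrtr H).
Qed.

Lemma H2norm_ge (h : V) : h2norm h.1 <= H2norm h /\ h2norm h.2 <= H2norm h.
Proof.
have H0 := H2norm_ge0 h; have E := H2norm_sq h.
have h1 : 0 <= h2norm h.1 ^+ 2 :> R by exact: sqr_ge0.
have h2 : 0 <= h2norm h.2 ^+ 2 :> R by exact: sqr_ge0.
split; apply: (ler_sqr_nng H0); rewrite E.
  by rewrite lerDl; exact: h2.
by rewrite lerDr; exact: h1.
Qed.

(** With [N = |f'|], two values of [f] on [[0, 1]] differ by at most [N], so
    [f(s)^2 <= 2 f(x)^2 + 2 N^2]; integrating in [x] bounds [f(s)^2] by [2 |f|^2 + 2 N^2]. *)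
Lemma h2_sup (f : R -> R^o) : h2 f -> forall t, `|f t| <= 2 * h2norm f.
Proof.
move=> hf t.
have [s s01 ->] := periodic_reduce t; last exact: h2_periodic.
have [n0 n1 _] := h2norm_ge f.
have lf := h2_l2 hf; have lf' := h2_l2_derive1 hf.
pose N := l2norm (derive1 f); have N0 : 0 <= N by exact: l2norm_ge0.
have dif (x y : R) : 0 <= x -> x <= y -> y <= 1 -> `|f y - f x| <= N.
  move=> x0 xy y1.
  rewrite -(integral_derive xy (h2_derive1_continuous hf) (h2_is_derive hf)).
  apply: (le_trans (le_normr_Rintegral _ _)) => //; first exact: l2_itv_integrable.
  have la := l2_abs lf'.
  have H : \int[mu]_(u in `[0, 1]) `|f^`()%classic u| <= N.
    have := l2dot_norm la (l2_cst 1).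
    have -> : l2norm (fun t => `|f^`()%classic t|) = N.
      congr Num.sqrt; apply: eq_Rintegral => u _.
      by rewrite -normrM -expr2 ger0_norm ?sqr_ge0.
    have -> : l2norm (cst 1 : R -> R^o) = 1.
      by rewrite /l2norm /l2dot /= Rintegral_itv_cst// subr0 !mulr1 sqrtr1.
    rewrite mulr1 => /(le_trans (ler_norm _)); apply: le_trans.
    by rewrite le_eqVlt; apply/orP; left; apply/eqP/eq_Rintegral => u _; rewrite mulr1.
  apply: le_trans H.
  rewrite (@integral_itv_split _ _ 0 1 x)//; last 2 first.
    exact: l2_itv_integrable la.
    exact: le_trans y1.
  rewrite (@integral_itv_split _ _ x 1 y)//; last exact: l2_itv_integrable la.
  have I0 a b : 0 <= \int[mu]_(x0 in `[a, b]) `|f^`()%classic x0|.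
    exact: Rintegral_ge0.
  by rewrite addrCA lerDl; apply: addr_ge0; exact: I0.
have sq (x : R) : 0 <= x <= 1 -> f s ^+ 2 <= 2 * (f x * f x) + 2 * N ^+ 2.
  move=> x01.
  have H : `|f s - f x| <= N.
    have [xs|/ltW sx] := leP x s; first by apply: dif => //; lra.
    by rewrite distrC; apply: dif => //; lra.
  have : (f s - f x) ^+ 2 <= N ^+ 2.
    by rewrite -(real_normK (num_real (f s - f x))) lerXn2r ?nnegrE.
  have := sqr_ge0 (f s - 2 * f x); nra.
have key : f s ^+ 2 <= 2 * l2norm f ^+ 2 + 2 * N ^+ 2.
  have c1 := l2_cst (2 * N ^+ 2).
  have ff : mu.-integrable `[0, 1] (EFin \o (fun x => 2 * (f x * f x))).
    have := l2_mul_integrable (l2Z 2 lf) lf.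
    by apply: eq_integrable => // x _; rewrite /= /GRing.scale/= mulrA.
  have := @le_Rintegral _ _ R mu `[0, 1] (fun=> f s ^+ 2)
    (fun x => 2 * (f x * f x) + 2 * N ^+ 2) (measurable_itv _).
  rewrite Rintegral_itv_cst// subr0 mulr1 RintegralD//; last first.
    exact: (l2_itv_integrable 0 1 c1).
  rewrite Rintegral_itv_cst// subr0 mulr1 RintegralZl//; last exact: l2_mul_integrable.
  rewrite -/(l2dot f f) -l2norm_sq; apply.
  - exact: (l2_itv_integrable 0 1 (l2_cst (f s ^+ 2))).
  - have := @integrableD _ _ _ mu `[0, 1] (measurable_itv _) _ _ ff (l2_itv_integrable 0 1 c1).
    by apply: eq_integrable.
  - by move=> x; rewrite /= in_itv/=; exact: sq.
have h0 : 0 <= h2norm f by exact: le_trans n1.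
apply: ler_sqr_nng; first by rewrite mulr_ge0.
rewrite real_normK ?num_real//; apply: (le_trans key).
have l0 := l2norm_ge0 f.
have : l2norm f ^+ 2 <= h2norm f ^+ 2 by rewrite lerXn2r ?nnegrE.
have : N ^+ 2 <= h2norm f ^+ 2 by rewrite lerXn2r ?nnegrE.
by rewrite exprMn; lra.
Qed.

Definition nbR (x : R^o) (r : R) : Prop := `|x| <= r.

Definition nbL (f : R -> R^o) (r : R) : Prop := l2 f /\ l2norm f <= r.

(** Unlike L2, this space is closed under products: powers are differentiated here, and [nbC_nbL]
    transfers the result to L2. *)
Definition nbC (f : R -> R^o) (r : R) : Prop :=
  [/\ continuous f, periodic f 1 & forall t, `|f t| <= r].

Lemma nbR_seminorm : seminorm nbR.
Proof.
split.
- by move=> x r; apply: le_trans.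
- by move=> x r s rs /le_trans; exact.
- by rewrite /nbR normr0.
- by move=> x y r s xr ys; apply: (le_trans (ler_normD _ _)); exact: lerD.
- by move=> a x r xr; rewrite /nbR /GRing.scale/= normrM ler_wpM2l.
Qed.

Lemma l2norm0 : l2norm (0 : R -> R^o) = 0.
Proof.
rewrite /l2norm /l2dot (@eq_Rintegral _ _ _ _ _ (fun=> 0)).
  by rewrite Rintegral_itv_cst// mul0r sqrtr0.
by move=> x _; rewrite mul0r.
Qed.

Lemma nbL_seminorm : seminorm nbL.
Proof.
split.
- by move=> x r [_]; apply: le_trans; exact: l2norm_ge0.
- by move=> x r s rs [lx xr]; split=> //; exact: le_trans rs.
- split; first exact: (l2_cst 0).
  by rewrite l2norm0.
- move=> x y r s [lx xr] [ly ys]; split; first exact: l2D.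
  by apply: (le_trans (l2normD lx ly)); exact: lerD.
- move=> a x r [lx xr]; split; first exact: l2Z.
  by rewrite (l2normZ a lx) ler_wpM2l.
Qed.

Lemma nbC_seminorm : seminorm nbC.
Proof.
split.
- by move=> x r [_ _ /(_ 0)]; apply: le_trans.
- by move=> x r s rs [cx px xr]; split=> // t; exact: le_trans rs.
- by split=> //= t; [exact: cvg_cst|rewrite normr0].
- move=> x y r s [cx px xr] [cy py ys]; split.
  + by move=> t; apply: cvgD; [exact: cx|exact: cy].
  + by move=> t; rewrite /= !fctE px py.
  + by move=> t; apply: (le_trans (ler_normD _ _)); exact: lerD.
- move=> a x r [cx px xr]; split.
  + by move=> t; apply: cvgZr; exact: cx.
  + by move=> t; rewrite /= !fctE px.
  + by move=> t; rewrite normrM ler_wpM2l.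
Qed.

Lemma nbC_nbL f r : nbC f r -> nbL f r.
Proof.
move=> [cf pf fr]; have lf := l2_continuous cf pf; split => //.
have r0 : 0 <= r by apply: le_trans (fr 0).
apply: ler_sqr_nng => //; rewrite l2norm_sq.
have := @le_Rintegral _ _ R mu `[0, 1] (fun x => f x * f x)
    (fun=> r ^+ 2) (measurable_itv _).
rewrite Rintegral_itv_cst// subr0 mulr1; apply.
- exact: l2_mul_integrable.
- exact: (l2_itv_integrable 0 1 (l2_cst (r ^+ 2))).
- move=> x _; rewrite -expr2 -(real_normK (num_real (f x))).
  by rewrite lerXn2r ?nnegrE.
Qed.

Lemma fdiff_mul (f g A B : V -> R^o) z : fdiff nbR f z A -> fdiff nbR g z B ->
  fdiff nbR (fun w => f w * g w) z (fun h => A h * g z + f z * B h).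
Proof.
apply: (fdiff_bilinear nbR_seminorm nbR_seminorm nbR_seminorm).
- by move=> x y r s xr ys; rewrite /nbR normrM ler_pM.
- by move=> a x x' y *; rewrite /GRing.scale/= mulrDl mulrA.
- by move=> a x y y' *; rewrite /GRing.scale/= mulrDr mulrCA.
Qed.

Lemma fdiff_scale (f A : V -> R^o) (g B : V -> R -> R^o) z :
  fdiff nbR f z A -> fdiff nbL g z B ->
  fdiff nbL (fun w => (f w : R) *: g w) z
    (fun h => (A h : R) *: g z + (f z : R) *: B h).
Proof.
apply: (@fdiff_bilinear _ _ _ _ _ _ (fun (a : R^o) x => (a : R) *: x)
  nbR_seminorm nbL_seminorm nbL_seminorm).
- move=> x y r s xr ys; apply: (nb_le nbL_seminorm) (nbZ nbL_seminorm x ys).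
  by rewrite ler_wpM2r// (nb_ge0 nbL_seminorm ys).
- by move=> a x x' y *; rewrite scalerDl scalerA.
- by move=> a x y y' *; rewrite scalerDr !scalerA mulrC.
Qed.

Lemma fdiff_mulC (f g A B : V -> R -> R^o) z :
  fdiff nbC f z A -> fdiff nbC g z B ->
  fdiff nbC (fun w t => f w t * g w t) z
    (fun h => (fun t => A h t * g z t) + (fun t => f z t * B h t)).
Proof.
apply: (@fdiff_bilinear _ _ _ _ _ _ (fun (x y : R -> R^o) t => x t * y t)
  nbC_seminorm nbC_seminorm nbC_seminorm).
- move=> x y r s [cx px xr] [cy py ys]; split.
  + by move=> t; apply: continuousM; [exact: cx|exact: cy].
  + by move=> t; rewrite px py.
  + by move=> t; rewrite normrM ler_pM.
- move=> a x x' y *; apply/funext => t.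
  by rewrite /= !fctE /GRing.scale/= mulrDl mulrA.
- move=> a x y y' *; apply/funext => t.
  by rewrite /= !fctE /GRing.scale/= mulrDr mulrCA.
Qed.

Lemma fdiff_l2dot (f g A B : V -> R -> R^o) z :
  fdiff nbL f z A -> fdiff nbL g z B ->
  fdiff nbR (fun w => l2dot (f w) (g w) : R^o) z
    (fun h => l2dot (A h) (g z) + l2dot (f z) (B h)).
Proof.
apply: (@fdiff_bilinear _ _ _ _ _ _ (fun x y => l2dot x y : R^o)
  nbL_seminorm nbL_seminorm nbR_seminorm).
- move=> x y r s [lx xr] [ly ys]; apply: (le_trans (l2dot_norm lx ly)).
  by apply: ler_pM => //; exact: l2norm_ge0.
- move=> a x x' y r r' s [lx _] [lx' _] [ly _].
  by rewrite (l2dotDl (l2Z a lx) lx' ly) (l2dotZl a lx ly).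
- move=> a x y y' r s s' [lx _] [ly _] [ly' _].
  by rewrite (l2dotDr (l2Z a ly) ly' lx) (l2dotZr a ly lx).
Qed.

(** Writing [f (z + h) = u + x] with [x = A h + r], the remainder is the quotient of [A h x - r u]
    by [u^2 (u + x)]. *)
Lemma fdiff_inv (f A : V -> R^o) z : f z != 0 -> fdiff nbR f z A ->
  fdiff nbR (fun w => (f w)^-1) z (fun h => - (f z) ^- 2 * A h).
Proof.
move=> u0 [_ A2 [C C0 A3] A4]; set u := f z in u0 *; split.
- by exists `|u^-1|; exact: lexx.
- move=> a h k Hh Hk; have := nbZ nbR_seminorm (- u ^- 2) (A2 a h k Hh Hk).
  rewrite mulr0; congr nbR; rewrite /GRing.scale/=; ring.
- exists (`|- u ^- 2| * C); first by rewrite mulr_ge0.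
  move=> h Hh; have := nbZ nbR_seminorm (- u ^- 2) (A3 h Hh).
  by rewrite mulrA.
- move=> e e0; have n0 : 0 < `|u| by rewrite normr_gt0.
  (* The numerator of the remainder is at most [(C (C + 1) + |u|) e' |h|]. The bound
     [|h| < |u| / (2 (C + 1))] forces [|x| <= |u| / 2], so the denominator is at least [|u|^3 / 2]
     in absolute value. *)
  pose S : R := 2 * (C * (C + 1) + `|u|) / `|u| ^+ 3.
  have S0 : 0 < S by rewrite !mulr_gt0 ?invr_gt0 ?exprn_gt0// ltr_wpDl// mulr_ge0// addr_ge0.
  have [e' [e'0 e'1 e'e]] : exists e' : R, [/\ 0 < e', e' <= 1 & e' * S <= e].
    exists (Num.min 1 (e / S)); split; first by rewrite lt_min ltr01 divr_gt0.
      by rewrite ge_min lexx.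
    by rewrite -ler_pdivlMr// ge_min lexx orbT.
  have [d d0 Ad] := A4 _ e'0.
  have d'0 : 0 < `|u| / (2 * (C + 1)) by rewrite divr_gt0// mulr_gt0// ltr_wpDl.
  exists (Num.min (`|u| / (2 * (C + 1))) (Num.min e' d)).
    by rewrite !lt_min d'0 e'0.
  move=> h Hh; rewrite !lt_min => /and3P[hu he' hd].
  have {Ad} := Ad h Hh hd; have {A3} := A3 h Hh; rewrite /nbR.
  set x' := A h; set r := f (z + h) - u - x'.
  have h0 := H2norm_ge0 h; rewrite -/u; move: (H2norm h) h0 hu he' {hd} => H h0 hu he' xH rH.
  have -> : f (z + h) = u + (x' + r) by rewrite /r; ring.
  set x := x' + r.
  have xH' : `|x| <= (C + 1) * H.
    apply: (le_trans (ler_normD _ _)); rewrite mulrDl lerD//.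
    by apply: (le_trans rH); rewrite ler_wpM2r.
  have xu : `|x| <= `|u| / 2.
    apply: (le_trans xH'); move/ltW: hu; rewrite ler_pdivlMr; last by rewrite mulr_gt0// ltr_wpDl.
    move=> hu; rewrite ler_pdivlMr//; apply: le_trans hu.
    by have -> : (C + 1) * H * 2 = H * (2 * (C + 1)) by ring.
  have ux : `|u| / 2 <= `|u + x|.
    have := lerB_normD u x; lra.
  have ux0 : u + x != 0 by rewrite -normr_gt0; lra.
  have -> : (u + x)^-1 - u^-1 - - u ^- 2 * x' = (x' * x - r * u) / (u ^+ 2 * (u + x)).
    by rewrite /x in ux0 *; field; rewrite ux0 u0.
  rewrite normrM normfV normrM normrX.
  rewrite ler_pdivrMr; last by rewrite mulr_gt0 ?exprn_gt0// normr_gt0.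
  have num : `|x' * x - r * u| <= (C * (C + 1) + `|u|) * e' * H.
    apply: (le_trans (ler_normB _ _)); rewrite !normrM.
    have -> : (C * (C + 1) + `|u|) * e' * H =
      C * (C + 1) * H * e' + (e' * H) * `|u| by ring.
    apply: lerD; last by rewrite ler_wpM2r.
    have h1 : `|x'| * `|x| <= (C * H) * ((C + 1) * H) by rewrite ler_pM.
    apply: (le_trans h1).
    have -> : C * H * ((C + 1) * H) = C * (C + 1) * H * H by ring.
    by apply: ler_wpM2l; [rewrite !mulr_ge0// addr_ge0|exact: ltW].
  apply: (le_trans num).
  have -> : (C * (C + 1) + `|u|) * e' * H = e' * S * H * (`|u| ^+ 2 * (`|u| / 2)).
    by rewrite /S; field; rewrite gt_eqF.
  apply: ler_pM.
  + by apply: mulr_ge0 => //; apply: mulr_ge0; exact: ltW.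
  + by apply: mulr_ge0; [exact: exprn_ge0|exact: divr_ge0].
  + by rewrite ler_wpM2r.
  + by rewrite ler_wpM2l// exprn_ge0.
Qed.

Section components.
Variable pr : V -> R -> R^o.
Hypotheses (pr_lin : forall (a : R) h k, pr (a *: h + k) = a *: pr h + pr k)
  (pr_H2 : forall h, H2 h -> h2 (pr h))
  (pr_norm : forall h, h2norm (pr h) <= H2norm h).

Lemma fdiff_component z : H2 z -> fdiff nbC pr z pr.
Proof.
move=> Hz; apply: (@fdiff_linear _ _ nbC_seminorm _ _ 2) => //.
- move=> h Hh; have hf := pr_H2 Hh; split.
  + exact: h2_continuous.
  + exact: h2_periodic.
  + move=> t; apply: (le_trans (h2_sup hf t)).
    by rewrite ler_wpM2l.
- by move=> a h k Hh Hk; rewrite pr_lin subrr; exact: nb0 nbC_seminorm.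
Qed.

Lemma fdiff_component_derive1 z : H2 z ->
  fdiff nbL (fun w => derive1 (pr w)) z (fun h => derive1 (pr h)).
Proof.
move=> Hz; apply: (@fdiff_linear _ _ nbL_seminorm _ _ 1) => //.
- move=> h Hh; have hf := pr_H2 Hh; split; first exact: h2_l2_derive1.
  rewrite mul1r; have [_ n1 _] := h2norm_ge (pr h).
  exact: le_trans (pr_norm h).
- move=> a h k Hh Hk; rewrite pr_lin h2_derive1_lin ?subrr; first exact: nb0 nbL_seminorm.
  + exact: pr_H2.
  + exact: pr_H2.
Qed.

Lemma fdiff_component_second_derivative z : H2 z ->
  fdiff nbL (fun w => second_derivative (pr w)) z (fun h => second_derivative (pr h)).
Proof.
move=> Hz; apply: (@fdiff_linear _ _ nbL_seminorm _ _ 1) => //.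
- move=> h Hh; have hf := pr_H2 Hh; split; first exact: h2_l2_second.
  rewrite mul1r; have [_ _ n2] := h2norm_ge (pr h).
  exact: le_trans (pr_norm h).
- move=> a h k Hh Hk; have h1 := pr_H2 Hh; have h2 := pr_H2 Hk.
  have l1 := h2_l2_second h1; have l2' := h2_l2_second h2.
  have l3 := h2_l2_second (h2_lin a h1 h2).
  have lr : l2 (a *: second_derivative (pr h) + second_derivative (pr k)).
    by apply: l2D => //; exact: l2Z.
  rewrite pr_lin; split.
    by apply: (l2D l3); rewrite -scaleN1r; exact: l2Z.
  rewrite (@l2norm_ae _ _ 0) ?l2norm0//.
  + by apply: (l2D l3); rewrite -scaleN1r; exact: l2Z.
  + exact: (l2_cst 0).
  + have := second_derivative_lin a h1 h2.
    apply: filterS; first exact: (ae_filter_ringOfSetsType mu).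
    by move=> x /= /(_ I) E _; rewrite fctE /= E subrr.
Qed.

End components.

End frechet.

(** * Explicit gradient and Hessian of the functional *)

Section bav_calculus.
Context {R : realType}.
Local Notation V := ((R -> R^o) * (R -> R^o))%type.
Local Notation mu := (@lebesgue_measure R).

Lemma negligible_translate c (N : set R) : mu.-negligible N ->
  mu.-negligible ((fun x => x + c) @^-1` N).
Proof.
move=> [A [mA A0 NA]].
have mc : measurable_fun setT ((fun x => x + c) : R -> measurableTypeR R).
  by apply: continuous_measurable_fun => x; apply: cvgD; [exact: cvg_id|exact: cvg_cst].
exists ((fun x => x + c) @^-1` A); split.
- by rewrite -[X in measurable X]setTI; exact: mc.
- by rewrite -[RHS]A0 -(lebesgue_measure_translate c mA).
- by move=> x /= /NA.
Qed.

(** The norm only sees [[0, 1]]; the exceptional null set found there is spread over the line by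
    integer translations. *)
Lemma l2norm_eq0_ae (f : R -> R^o) : l2 f -> l2norm f = 0 -> f = 0 %[ae mu].
Proof.
move=> lf f0; have [pf mf _] := lf.
have f2 : l2dot f f = 0 by rewrite -l2norm_sq f0 expr0n.
have ff := l2_mul_integrable lf lf.
have /integrableP[mff _] := ff.
have [N [mN N0 NP]] : ae_eq mu `[0, 1]%classic (fun t => (f t * f t)%:E) (cst 0%E).
  apply/(ae_eq_integral_abs mu (measurable_itv _) mff).
  have : (\int[mu]_(x in `[0%R, 1%R]) (f x * f x)%:E = 0)%E.
    by rewrite -[LHS]fineK ?integrable_fin_num//; congr EFin; exact: f2.
  move=> <-; apply: eq_integral => x _.
  by rewrite gee0_abs// lee_fin -expr2 sqr_ge0.
have negN : mu.-negligible N by exists N; split.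
have H : mu.-negligible (\bigcup_n (((fun x => x + n%:R) @^-1` N) `|`
    ((fun x => x + - n%:R) @^-1` N))).
  apply: negligible_bigcup => n; apply: negligibleU; exact: negligible_translate.
apply: negligibleS H => x /= /not_implyP[_ /= fx0].
pose m : int := Num.floor x.
have := Num.Theory.floor_itv x; rewrite -/m intrD => /andP[mx xm].
have pz (n : nat) u : f (u + n%:R) = f u by rewrite (periodicn pf).
have inN y : 0 <= y <= 1 -> f y = f x -> N y.
  move=> y01 fy; apply: NP => /= /(_ y01) [] /eqP.
  by rewrite mulf_eq0 orbb fy => /eqP.
case: m mx xm => n mx xm.
  exists n => //; right => /=; apply: inN.
    by move: mx xm; rewrite -pmulrn; lra.
  by rewrite -[LHS](pz n) subrK.
exists n.+1 => //; left => /=; apply: inN; last exact: pz.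
by move: mx xm; rewrite NegzE mulrNz -pmulrn; lra.
Qed.

Lemma L2norm_le (h : V) (r : R) : L2 h -> 0 <= r ->
  l2norm h.1 <= r -> l2norm h.2 <= r -> L2norm h <= 2 * r.
Proof.
move=> [l1 l2'] r0 h1 h2.
apply: ler_sqr_nng; first by rewrite mulr_ge0.
have -> : L2norm h ^+ 2 = l2norm h.1 ^+ 2 + l2norm h.2 ^+ 2.
  rewrite !l2norm_sq /L2norm sqr_sqrtr// /L2dot.
  by apply: addr_ge0; exact: l2dot_ge0.
have s1 : l2norm h.1 ^+ 2 <= r ^+ 2.
  by rewrite lerXn2r ?nnegrE ?l2norm_ge0.
have s2 : l2norm h.2 ^+ 2 <= r ^+ 2.
  by rewrite lerXn2r ?nnegrE ?l2norm_ge0.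
move: s1 s2; move: (l2norm h.1) (l2norm h.2) => x y s1 s2.
rewrite exprMn; have := sqr_ge0 r; lra.
Qed.

Lemma fdiff_L2_differential (G A : V -> V) z :
  fdiff nbL (fun w => (G w).1) z (fun h => (A h).1) ->
  fdiff nbL (fun w => (G w).2) z (fun h => (A h).2) ->
  is_L2_differential G z A.
Proof.
move=> [_ F2 [C C0 F3] F4] [_ G2 [D D0 G3] G4]; split.
- by move=> h Hh; split; [case: (F3 h Hh)|case: (G3 h Hh)].
- have H (f g : R -> R^o) : nbL (f - g) 0 -> f = g %[ae mu].
    move=> [lfg n0].
    have fg0 : l2norm (f - g) = 0 by apply/eqP; rewrite eq_le n0 l2norm_ge0.
    have := l2norm_eq0_ae lfg fg0.
    apply: filterS; first exact: (ae_filter_ringOfSetsType mu).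
    by move=> x /= E /E /eqP; rewrite !fctE subr_eq0 => /eqP.
  by move=> a h k Hh Hk; split; apply: H; [exact: F2|exact: G2].
- exists (2 * (C + D)) => h Hh.
  have H0 := H2norm_ge0 h.
  have [l1 n1] := F3 h Hh; have [l2' n2] := G3 h Hh.
  rewrite -mulrA; apply: L2norm_le => //.
  + by rewrite mulr_ge0// addr_ge0.
  + by apply: (le_trans n1); rewrite ler_wpM2r// lerDl.
  + by apply: (le_trans n2); rewrite ler_wpM2r// lerDr.
- move=> e e0; have e2 : 0 < e / 2 by rewrite divr_gt0.
  have [d d0 Fd] := F4 _ e2; have [d' d'0 Gd] := G4 _ e2.
  exists (Num.min d d'); first by rewrite lt_min d0.
  move=> h Hh; rewrite lt_min => /andP[hd hd'].
  have H0 := H2norm_ge0 h.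
  have [l1 n1] := Fd h Hh hd; have [l2' n2] := Gd h Hh hd'.
  have -> : e * H2norm h = 2 * (e / 2 * H2norm h) by field.
  by apply: L2norm_le => //; rewrite mulr_ge0// ltW.
Qed.

Lemma fdiff_eq (W : lmodType R) (nb : W -> R -> Prop) (F : V -> W) z A A' :
  (forall h, H2 h -> A h = A' h) -> fdiff nb F z A -> fdiff nb F z A'.
Proof.
move=> E [F1 F2 [C C0 F3] F4]; split => //.
- by move=> a h k Hh Hk; rewrite -!E//; [exact: F2|exact: H2_lin].
- by exists C => // h Hh; rewrite -E//; exact: F3.
- by move=> e e0; have [d d0 Fd] := F4 e e0; exists d => // h Hh hd; rewrite -E//; exact: Fd.
Qed.

Definition cube (f : R -> R^o) : R -> R^o := fun t => f t ^+ 3.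
Definition mass (f : R -> R^o) : R := l2dot f f.
Definition kinetic (f : R -> R^o) : R := l2dot (derive1 f) (derive1 f).
Definition quartic (f : R -> R^o) : R := l2dot (sq f) (sq f).

(** First variations in the direction [h]. The kinetic one is integrated by parts, so that all three
    are L2 pairings with [h], as a gradient requires. *)
Definition dmass (f h : R -> R^o) : R := 2 * l2dot f h.
Definition dkinetic (f h : R -> R^o) : R := - 2 * l2dot (second_derivative f) h.
Definition dquartic (f h : R -> R^o) : R := 4 * l2dot (cube f) h.

Lemma h2_l2_mul (f g : R -> R^o) : h2 f -> h2 g -> l2 (fun t => f t * g t).
Proof.
move=> hf hg; apply: l2_continuous.
- by move=> t; apply: continuousM; exact: h2_continuous.
- by move=> t; rewrite (h2_periodic hf) (h2_periodic hg).
Qed.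

Lemma h2_l2_cube (f : R -> R^o) : h2 f -> l2 (cube f).
Proof.
move=> hf; apply: l2_continuous.
- move=> t; apply: (@continuousM R R^o f (fun x => f x * f x)).
    exact: h2_continuous.
  by apply: continuousM; exact: h2_continuous.
- by move=> t; rewrite /cube (h2_periodic hf).
Qed.

Section components.
Variable pr : V -> R -> R^o.
Hypotheses (pr_lin : forall (a : R) h k, pr (a *: h + k) = a *: pr h + pr k)
  (pr_H2 : forall h, H2 h -> h2 (pr h))
  (pr_norm : forall h, h2norm (pr h) <= H2norm h).

Lemma fdiff_mass z : H2 z ->
  fdiff nbR (fun w => mass (pr w) : R^o) z (fun h => dmass (pr z) (pr h)).
Proof.
move=> Hz; have dC := fdiff_component pr_lin pr_H2 pr_norm Hz.
have dL := fdiff_weaken nbC_nbL dC.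
apply: fdiff_eq (fdiff_l2dot dL dL) => h Hh.
by rewrite [l2dot (pr h) _]l2dotC /dmass mulr2n mulrDl mul1r.
Qed.

Lemma fdiff_kinetic z : H2 z ->
  fdiff nbR (fun w => kinetic (pr w) : R^o) z (fun h => dkinetic (pr z) (pr h)).
Proof.
move=> Hz; have dL := fdiff_component_derive1 pr_lin pr_H2 pr_norm Hz.
apply: fdiff_eq (fdiff_l2dot dL dL) => h Hh.
rewrite [l2dot _ (derive1 (pr z))]l2dotC /dkinetic h2_by_parts; last 2 first.
- exact: pr_H2.
- exact: pr_H2.
ring.
Qed.

Lemma fdiff_quartic z : H2 z ->
  fdiff nbR (fun w => quartic (pr w) : R^o) z (fun h => dquartic (pr z) (pr h)).
Proof.
move=> Hz; have dC := fdiff_component pr_lin pr_H2 pr_norm Hz.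
have d2 := fdiff_weaken nbC_nbL (fdiff_mulC dC dC).
apply: (@fdiff_ext _ _ _ (fun w => l2dot (fun t => pr w t * pr w t) (fun t => pr w t * pr w t))).
  by move=> w; congr l2dot; apply/funext => t; rewrite /sq expr2.
apply: fdiff_eq (fdiff_l2dot d2 d2) => h Hh.
have hz := pr_H2 Hz; have hh := pr_H2 Hh.
have lzz := h2_l2_mul hz hz; have lzh := h2_l2_mul hz hh.
rewrite [X in X + _]l2dotC /dquartic.
have -> : (fun t => pr h t * pr z t) + (fun t => pr z t * pr h t)
    = (2 \*: (fun t => pr z t * pr h t)) :> (R -> R^o).
  by apply/funext => t; rewrite /= !fctE /GRing.scale/=; ring.
rewrite (l2dotZr 2 lzh lzz).
have -> : l2dot (fun t => pr z t * pr z t) (fun t => pr z t * pr h t)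
    = l2dot (cube (pr z)) (pr h).
  by apply: eq_Rintegral => t _; rewrite /cube; ring.
ring.
Qed.

Lemma fdiff_cube z : H2 z ->
  fdiff nbL (fun w => cube (pr w)) z (fun h t => 3 * pr z t ^+ 2 * pr h t).
Proof.
move=> Hz; have dC := fdiff_component pr_lin pr_H2 pr_norm Hz.
have d3 := fdiff_weaken nbC_nbL (fdiff_mulC dC (fdiff_mulC dC dC)).
apply: (@fdiff_ext _ _ _ (fun w t => pr w t * (pr w t * pr w t))).
  by move=> w; apply/funext => t; rewrite /cube; ring.
apply: fdiff_eq d3 => h Hh; apply/funext => t.
by rewrite /= !fctE; ring.
Qed.

End components.

Lemma fst_H2 (h : V) : H2 h -> h2 h.1. Proof. by case. Qed.
Lemma snd_H2 (h : V) : H2 h -> h2 h.2. Proof. by case. Qed.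
Lemma fst_norm (h : V) : h2norm h.1 <= H2norm h. Proof. by case: (H2norm_ge h). Qed.
Lemma snd_norm (h : V) : h2norm h.2 <= H2norm h. Proof. by case: (H2norm_ge h). Qed.
Lemma fst_lin (a : R) (h k : V) : (a *: h + k).1 = a *: h.1 + k.1. Proof. by []. Qed.
Lemma snd_lin (a : R) (h k : V) : (a *: h + k).2 = a *: h.2 + k.2. Proof. by []. Qed.

Lemma fdiff_const (c : R) z : fdiff nbR (fun=> c : R^o) z (fun=> 0).
Proof. exact: (fdiff_cst nbR_seminorm z (lexx `|c|)). Qed.

(** The denominator of the last term of [Bav], positive on [Hav]. *)
Definition gap (w : V) : R := quartic w.1 * mass w.2 - quartic w.2 * mass w.1.

Definition dgap (z h : V) : R :=
  dquartic z.1 h.1 * mass z.2 + quartic z.1 * dmass z.2 h.2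
  - dquartic z.2 h.2 * mass z.1 - quartic z.2 * dmass z.1 h.1.

Lemma BavE (w : V) : Bav w =
  2 * ((mass w.1 * kinetic w.1 + (mass w.1)^-1)
       + (mass w.2 * kinetic w.2 + (mass w.2)^-1))
  - mass w.1 * mass w.2 / gap w.
Proof.
rewrite /Bav /gap.
by congr (2 * ((_ * _ + _^-1) + (_ * _ + _^-1)) - _ * _ / (_ * _ - _ * _));
  exact: l2norm_sq.
Qed.

Lemma fdiff_cmul (c : R) (f A : V -> R^o) z : fdiff nbR f z A ->
  fdiff nbR (fun w => c * f w : R^o) z (fun h => c * A h).
Proof.
move=> df; apply: fdiff_eq (fdiff_mul (fdiff_const c z) df) => h _.
by rewrite mul0r add0r.
Qed.

(** Coefficients of [z_i] and [z_i^3] in the gradient. The derivatives of the numerator and of the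
    denominator of the last fraction of [Bav] combine through [gap w + quartic w.2 * mass w.1 =
    quartic w.1 * mass w.2]. *)
Definition coef_id1 (w : V) : R := 4 * kinetic w.1 - 4 / mass w.1 ^+ 2
  - 2 * quartic w.1 * mass w.2 ^+ 2 / gap w ^+ 2.
Definition coef_id2 (w : V) : R := 4 * kinetic w.2 - 4 / mass w.2 ^+ 2
  + 2 * quartic w.2 * mass w.1 ^+ 2 / gap w ^+ 2.
Definition coef_cube1 (w : V) : R := 4 * mass w.1 * mass w.2 ^+ 2 / gap w ^+ 2.
Definition coef_cube2 (w : V) : R := - 4 * mass w.1 ^+ 2 * mass w.2 / gap w ^+ 2.

Definition dcoef_id1 (z h : V) : R := 4 * dkinetic z.1 h.1
  + 8 * dmass z.1 h.1 / mass z.1 ^+ 3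
  - 2 * dquartic z.1 h.1 * mass z.2 ^+ 2 / gap z ^+ 2
  - 4 * quartic z.1 * mass z.2 * dmass z.2 h.2 / gap z ^+ 2
  + 4 * quartic z.1 * mass z.2 ^+ 2 * dgap z h / gap z ^+ 3.
Definition dcoef_id2 (z h : V) : R := 4 * dkinetic z.2 h.2
  + 8 * dmass z.2 h.2 / mass z.2 ^+ 3
  + 2 * dquartic z.2 h.2 * mass z.1 ^+ 2 / gap z ^+ 2
  + 4 * quartic z.2 * mass z.1 * dmass z.1 h.1 / gap z ^+ 2
  - 4 * quartic z.2 * mass z.1 ^+ 2 * dgap z h / gap z ^+ 3.
Definition dcoef_cube1 (z h : V) : R :=
  4 * dmass z.1 h.1 * mass z.2 ^+ 2 / gap z ^+ 2
  + 8 * mass z.1 * mass z.2 * dmass z.2 h.2 / gap z ^+ 2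
  - 8 * mass z.1 * mass z.2 ^+ 2 * dgap z h / gap z ^+ 3.
Definition dcoef_cube2 (z h : V) : R :=
  - 8 * mass z.1 * dmass z.1 h.1 * mass z.2 / gap z ^+ 2
  - 4 * mass z.1 ^+ 2 * dmass z.2 h.2 / gap z ^+ 2
  + 8 * mass z.1 ^+ 2 * mass z.2 * dgap z h / gap z ^+ 3.

Definition grad_bav (w : V) : V :=
  (coef_id1 w *: w.1 + (- 4 * mass w.1) *: second_derivative w.1
     + coef_cube1 w *: cube w.1,
   coef_id2 w *: w.2 + (- 4 * mass w.2) *: second_derivative w.2
     + coef_cube2 w *: cube w.2).

Definition hess_bav (z h : V) : V :=
  ((dcoef_id1 z h *: z.1 + coef_id1 z *: h.1)
   + ((- 4 * dmass z.1 h.1) *: second_derivative z.1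
      + (- 4 * mass z.1) *: second_derivative h.1)
   + (dcoef_cube1 z h *: cube z.1
      + coef_cube1 z *: (fun t => 3 * z.1 t ^+ 2 * h.1 t)),
   (dcoef_id2 z h *: z.2 + coef_id2 z *: h.2)
   + ((- 4 * dmass z.2 h.2) *: second_derivative z.2
      + (- 4 * mass z.2) *: second_derivative h.2)
   + (dcoef_cube2 z h *: cube z.2
      + coef_cube2 z *: (fun t => 3 * z.2 t ^+ 2 * h.2 t))).

Section at_point.
Variable z : V.
Hypotheses (Hz : H2 z) (m1 : mass z.1 != 0) (m2 : mass z.2 != 0)
  (D0 : gap z != 0).

Let dm1 := fdiff_mass fst_lin fst_H2 fst_norm Hz.
Let dm2 := fdiff_mass snd_lin snd_H2 snd_norm Hz.
Let dk1 := fdiff_kinetic fst_lin fst_H2 fst_norm Hz.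
Let dk2 := fdiff_kinetic snd_lin snd_H2 snd_norm Hz.
Let dp1 := fdiff_quartic fst_lin fst_H2 fst_norm Hz.
Let dp2 := fdiff_quartic snd_lin snd_H2 snd_norm Hz.

Lemma fdiff_gap : fdiff nbR (fun w => gap w : R^o) z (fun h => dgap z h).
Proof.
have := fdiff_add nbR_seminorm (fdiff_mul dp1 dm2)
  (fdiff_cmul (- 1) (fdiff_mul dp2 dm1)).
move=> /(fdiff_eq _) H; apply: (fdiff_ext _ (H _ _)).
  by move=> w; rewrite /gap mulN1r.
move=> h _; rewrite /dgap.
move: (dquartic _ _) (mass _) (quartic _) (dmass _ _) (dquartic _ _) (mass _) (quartic _) (dmass _ _) => *; ring.
Qed.

Let dD := fdiff_gap.
Let dim1 := fdiff_inv m1 dm1.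
Let dim2 := fdiff_inv m2 dm2.
Let diD := fdiff_inv D0 dD.
Let diD2 := fdiff_mul diD diD.
Let add (f g A B : V -> R^o) (df : fdiff nbR f z A) (dg : fdiff nbR g z B) :=
  fdiff_add nbR_seminorm df dg.

Lemma fdiff_bav : fdiff nbR (fun w => Bav w : R^o) z (fun h => L2dot (grad_bav z) h).
Proof.
have := add (fdiff_cmul 2 (add (add (fdiff_mul dm1 dk1) dim1)
  (add (fdiff_mul dm2 dk2) dim2))) (fdiff_cmul (- 1) (fdiff_mul (fdiff_mul dm1 dm2) diD)).
move=> /(fdiff_eq _) H; apply: (fdiff_ext _ (H _ _)).
  by move=> w; rewrite BavE mulN1r.
move=> h [h1 h2]; have [z1 z2] := Hz.
have lz1 := h2_l2 z1; have lz2 := h2_l2 z2; have lh1 := h2_l2 h1; have lh2 := h2_l2 h2.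
have ls1 := h2_l2_second z1; have ls2 := h2_l2_second z2.
have lc1 := h2_l2_cube z1; have lc2 := h2_l2_cube z2.
have lin (x y u : R) (f g k l : R -> R^o) : l2 f -> l2 g -> l2 k -> l2 l ->
    l2dot (x *: f + y *: g + u *: k) l = x * l2dot f l + y * l2dot g l + u * l2dot k l.
  move=> lf lg lk ll; have lxf := l2Z x lf; have lyg := l2Z y lg; have luk := l2Z u lk.
  rewrite (l2dotDl (l2D lxf lyg) luk ll) (l2dotDl lxf lyg ll).
  by rewrite (l2dotZl x lf ll) (l2dotZl y lg ll) (l2dotZl u lk ll).
rewrite /L2dot (lin _ _ _ _ _ _ _ lz1 ls1 lc1 lh1) (lin _ _ _ _ _ _ _ lz2 ls2 lc2 lh2).
rewrite /coef_id1 /coef_id2 /coef_cube1 /coef_cube2 /dgap /dmass /dkinetic /dquartic.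
move: m1 m2 D0.
have : gap z = quartic z.1 * mass z.2 - quartic z.2 * mass z.1 by [].
move: (gap z) (mass z.1) (mass z.2) (quartic z.1) (quartic z.2) (kinetic z.1) (kinetic z.2).
move: (l2dot z.1 _) (l2dot z.2 _) (l2dot (second_derivative z.1) _) (l2dot (second_derivative z.2) _).
move: (l2dot (cube z.1) _) (l2dot (cube z.2) _).
move=> t1 t2 t3 t4 t5 t6 D a1 a2 p1 p2 k1 k2 DE a1n a2n Dn.
(* Eliminating [p1] is how [field] gets to use the definition of [gap], which has been generalized
   to [D]. *)
have -> : p1 = (D + p2 * a1) / a2 by rewrite DE; field.
by field; rewrite a1n a2n Dn.
Qed.

Lemma fdiff_coef_id1 : fdiff nbR (fun w => coef_id1 w : R^o) z (dcoef_id1 z).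
Proof.
have := add (add (fdiff_cmul 4 dk1) (fdiff_cmul (- 4) (fdiff_mul dim1 dim1)))
  (fdiff_cmul (- 2) (fdiff_mul (fdiff_mul dp1 (fdiff_mul dm2 dm2)) diD2)).
move=> /(fdiff_eq _) H; apply: (fdiff_ext _ (H _ _)).
  move=> w; rewrite /coef_id1 -!exprVn.
  by move: (mass w.1)^-1 (mass w.2) (gap w)^-1 (quartic w.1) (kinetic w.1) => *; ring.
move=> h _; rewrite /dcoef_id1; move: m1 m2 D0.
move: (gap z) (mass z.1) (mass z.2) (quartic z.1) (dgap z h) (dmass z.1 h.1) (dmass z.2 h.2)
  (dkinetic z.1 h.1) (dquartic z.1 h.1) => D a1 a2 *.
by field; apply/andP.
Qed.

Lemma fdiff_coef_id2 : fdiff nbR (fun w => coef_id2 w : R^o) z (dcoef_id2 z).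
Proof.
have := add (add (fdiff_cmul 4 dk2) (fdiff_cmul (- 4) (fdiff_mul dim2 dim2)))
  (fdiff_cmul 2 (fdiff_mul (fdiff_mul dp2 (fdiff_mul dm1 dm1)) diD2)).
move=> /(fdiff_eq _) H; apply: (fdiff_ext _ (H _ _)).
  move=> w; rewrite /coef_id2 -!exprVn.
  by move: (mass w.2)^-1 (mass w.1) (gap w)^-1 (quartic w.2) (kinetic w.2) => *; ring.
move=> h _; rewrite /dcoef_id2; move: m1 m2 D0.
move: (gap z) (mass z.1) (mass z.2) (quartic z.2) (dgap z h) (dmass z.1 h.1) (dmass z.2 h.2)
  (dkinetic z.2 h.2) (dquartic z.2 h.2) => D a1 a2 *.
by field; apply/andP.
Qed.

Lemma fdiff_coef_cube1 : fdiff nbR (fun w => coef_cube1 w : R^o) z (dcoef_cube1 z).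
Proof.
have := fdiff_cmul 4 (fdiff_mul (fdiff_mul dm1 (fdiff_mul dm2 dm2)) diD2).
move=> /(fdiff_eq _) H; apply: (fdiff_ext _ (H _ _)).
  move=> w; rewrite /coef_cube1 -!exprVn.
  by move: (mass w.1) (mass w.2) (gap w)^-1 => *; ring.
move=> h _; rewrite /dcoef_cube1; move: m1 m2 D0.
move: (gap z) (mass z.1) (mass z.2) (dgap z h) (dmass z.1 h.1) (dmass z.2 h.2) => D a1 a2 *.
by field.
Qed.

Lemma fdiff_coef_cube2 : fdiff nbR (fun w => coef_cube2 w : R^o) z (dcoef_cube2 z).
Proof.
have := fdiff_cmul (- 4) (fdiff_mul (fdiff_mul (fdiff_mul dm1 dm1) dm2) diD2).
move=> /(fdiff_eq _) H; apply: (fdiff_ext _ (H _ _)).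
  move=> w; rewrite /coef_cube2 -!exprVn.
  by move: (mass w.1) (mass w.2) (gap w)^-1 => *; ring.
move=> h _; rewrite /dcoef_cube2; move: m1 m2 D0.
move: (gap z) (mass z.1) (mass z.2) (dgap z h) (dmass z.1 h.1) (dmass z.2 h.2) => D a1 a2 *.
by field.
Qed.

Lemma grad_bav_L2 : L2 (grad_bav z).
Proof.
have [z1 z2] := Hz.
split; apply: l2D; try (apply: l2D; apply: l2Z); try apply: l2Z.
- exact: h2_l2.
- exact: h2_l2_second.
- exact: h2_l2_cube.
- exact: h2_l2.
- exact: h2_l2_second.
- exact: h2_l2_cube.
Qed.

Lemma is_gradient_grad_bav : is_L2_gradient Bav z (grad_bav z).
Proof.
split; first exact: grad_bav_L2.
by have [_ _ _] := fdiff_bav.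
Qed.

Lemma is_differential_hess_bav : is_L2_differential grad_bav z (hess_bav z).
Proof.
have dz1 := fdiff_weaken nbC_nbL (fdiff_component fst_lin fst_H2 fst_norm Hz).
have dz2 := fdiff_weaken nbC_nbL (fdiff_component snd_lin snd_H2 snd_norm Hz).
have ds1 := fdiff_component_second_derivative fst_lin fst_H2 fst_norm Hz.
have ds2 := fdiff_component_second_derivative snd_lin snd_H2 snd_norm Hz.
have dc1 := fdiff_cube fst_lin fst_H2 fst_norm Hz.
have dc2 := fdiff_cube snd_lin snd_H2 snd_norm Hz.
apply: fdiff_L2_differential.
- exact: (fdiff_add nbL_seminorm (fdiff_add nbL_seminorm (fdiff_scale fdiff_coef_id1 dz1)
    (fdiff_scale (fdiff_cmul (- 4) dm1) ds1)) (fdiff_scale fdiff_coef_cube1 dc1)).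
- exact: (fdiff_add nbL_seminorm (fdiff_add nbL_seminorm (fdiff_scale fdiff_coef_id2 dz2)
    (fdiff_scale (fdiff_cmul (- 4) dm2) ds2)) (fdiff_scale fdiff_coef_cube2 dc2)).
Qed.

End at_point.

Lemma Hav_nonzero (w : V) : Hav w ->
  [/\ 0 < mass w.1, 0 < mass w.2 & 0 < gap w].
Proof.
move=> [_ n1 n2 E].
have m1 : 0 < mass w.1 by rewrite /mass -l2norm_sq exprn_gt0.
have m2 : 0 < mass w.2 by rewrite /mass -l2norm_sq exprn_gt0.
split => //.
have e1 := l2norm_sq w.1; have e2 := l2norm_sq w.2.
have e3 := l2norm_sq (sq w.1); have e4 := l2norm_sq (sq w.2).
rewrite /= e1 e2 e3 e4 in E.
have : quartic w.2 / mass w.2 < quartic w.1 / mass w.1 := E.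
rewrite /gap; move: (quartic w.1) (quartic w.2) (mass w.1) (mass w.2) m1 m2 => p1 p2 a1 a2 a10 a20.
by rewrite ltr_pdivrMr// mulrAC ltr_pdivlMr// => H; rewrite subr_gt0.
Qed.

Lemma Hav_gradient (w : V) : Hav w -> is_L2_gradient Bav w (grad_bav w).
Proof.
move=> Hw; have [m1 m2 D] := Hav_nonzero Hw; have [Hw2 _ _ _] := Hw.
by apply: is_gradient_grad_bav; rewrite ?gt_eqF.
Qed.

Lemma Hav_hessian (w : V) : Hav w -> is_hessian w (hess_bav w).
Proof.
move=> Hw; have [m1 m2 D] := Hav_nonzero Hw; have [Hw2 _ _ _] := Hw.
exists grad_bav; first exact: Hav_gradient.
by apply: is_differential_hess_bav; rewrite ?gt_eqF.
Qed.

End bav_calculus.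

(** * From vanishing gradient to an almost everywhere equation *)

Section stationarity.
Context {R : realType}.
Local Notation V := ((R -> R^o) * (R -> R^o))%type.
Local Notation mu := (@lebesgue_measure R).
Implicit Types (f g h k u r : R -> R^o).

Lemma second_derivative_cst (c : R) : second_derivative (cst c) = (0 : R -> R^o) %[ae mu].
Proof.
apply: (@second_derivative_ae _ (cst c) (cst 0) 0) => //.
by move=> t; exact: cvg_cst.
Qed.

Lemma derive1_cst0 (c : R) : derive1 (cst c : R -> R^o) = 0.
Proof. by apply/funext => t; rewrite derive1_cst. Qed.

Lemma h2normZ (a : R) f : h2 f -> h2norm (a *: f) = `|a| * h2norm f.
Proof.
move=> hf; have h0 : h2 (0 : R -> R^o) by exact: (h2_cst 0).
have lf := h2_l2 hf; have lf' := h2_l2_derive1 hf; have ls := h2_l2_second hf.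
have E : a *: f = a *: f + 0 by rewrite addr0.
have Ed : derive1 (a *: f) = a *: derive1 f.
  by rewrite E h2_derive1_lin// (derive1_cst0 0) addr0.
have Es : second_derivative (a *: f) = a *: second_derivative f %[ae mu].
  rewrite E.
  have H1 := second_derivative_lin a hf h0; have H2 := second_derivative_cst 0.
  move: H1; apply: filterS2 H2; first exact: (ae_filter_ringOfSetsType mu).
  by move=> t /= /(_ I) E0 /(_ I) -> _; rewrite !fctE E0 addr0.
have haf : h2 (a *: f) by rewrite E; exact: h2_lin.
rewrite /h2norm Ed (l2norm_ae (h2_l2_second haf) (l2Z a ls) Es).
rewrite (l2normZ a lf) (l2normZ a lf') (l2normZ a ls) !exprMn -!mulrDr.
by rewrite sqrtrM ?sqr_ge0// sqrtr_sqr normr_id.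
Qed.

Lemma sqrtr_scale (a x y : R) : Num.sqrt ((`|a| * x) ^+ 2 + (`|a| * y) ^+ 2)
  = `|a| * Num.sqrt (x ^+ 2 + y ^+ 2).
Proof. by rewrite !exprMn -mulrDr sqrtrM ?sqr_ge0// sqrtr_sqr normr_id. Qed.

Lemma H2normZ (a : R) (h : V) : H2 h -> H2norm (a *: h) = `|a| * H2norm h.
Proof.
move=> [h1 h2]; apply: (etrans _ (sqrtr_scale a (h2norm h.1) (h2norm h.2))).
by congr (Num.sqrt (_ ^+ 2 + _ ^+ 2)); exact: h2normZ.
Qed.

Lemma gradient_remainder (b x y n t e gx gy nt : R) : 0 < t ->
  gx = t * x -> gy = t * y -> nt = t * n -> `|b - gx| <= e * nt ->
  `|b - gy| <= e * nt -> `|x - y| <= 2 * e * n.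
Proof.
move=> t0 -> -> -> H1 H2; rewrite -(ler_pM2l t0) -{1}(gtr0_norm t0) -normrM.
have -> : t * (x - y) = (b - t * y) - (b - t * x) by ring.
by apply: (le_trans (ler_normB _ _)); apply: (le_trans (lerD H2 H1)); lra.
Qed.

(** Both expansions hold along [t h] for small [t > 0]; after division by [t], the two pairings with
    [h] differ by at most [2 e |h|], for every [e > 0]. *)
Lemma L2_gradient_unique (B : V -> R) (z g g' : V) : is_L2_gradient B z g ->
  is_L2_gradient B z g' -> forall h : V, H2 h -> L2dot g h = L2dot g' h.
Proof.
move=> [[lg1 lg2] Hg] [[lg1' lg2'] Hg'] h Hh.
have [lh1 lh2] : L2 h by case: Hh => ? ?; split; exact: h2_l2.
have N0 := H2norm_ge0 h.
have dotZ (g0 : V) (t : R) : L2 g0 -> L2dot g0 (t *: h) = t * L2dot g0 h.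
  move=> [l1 l2']; rewrite /L2dot (l2dotZr t lh1 l1) (l2dotZr t lh2 l2').
  by rewrite mulrDr.
have small (e : R) : 0 < e -> `|L2dot g h - L2dot g' h| <= 2 * e * H2norm h.
  move=> e0; have [d d0 Hd] := Hg _ e0; have [d' d'0 Hd'] := Hg' _ e0.
  pose N := H2norm h + 1; have Np : 0 < N by rewrite /N ltr_wpDl.
  pose m := Num.min d d'; have m0 : 0 < m by rewrite lt_min d0.
  pose t := m / (2 * N); have t0 : 0 < t by rewrite divr_gt0// mulr_gt0.
  have Hth : H2 (t *: h).
    rewrite -[t *: h]addr0; apply: H2_lin => //.
    by split; exact: (h2_cst 0).
  have nth : H2norm (t *: h) < m.
    rewrite H2normZ// gtr0_norm// /t -mulrA gtr_pMr// ltr_pdivrMl ?mulr_gt0//.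
    rewrite mulr1 /N; move: (H2norm h) N0 => n; lra.
  move: nth; rewrite lt_min => /andP[nd nd'].
  have Nth : H2norm (t *: h) = t * H2norm h.
    by rewrite (H2normZ t Hh) (gtr0_norm t0).
  exact: (gradient_remainder t0 (dotZ g t (conj lg1 lg2)) (dotZ g' t (conj lg1' lg2'))
    Nth (Hd _ Hth nd) (Hd' _ Hth nd')).
apply/eqP; rewrite -subr_eq0 -normr_le0 leNgt; apply/negP => d0.
set x := `|_| in d0 small.
have Np : 0 < H2norm h + 1 by rewrite ltr_wpDl.
have := small (x / (4 * (H2norm h + 1))); rewrite divr_gt0// ?mulr_gt0// => /(_ isT).
rewrite leNgt => /negP; apply.
have -> : 2 * (x / (4 * (H2norm h + 1))) * H2norm h
    = x * (H2norm h / (2 * (H2norm h + 1))).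
  by field; rewrite gt_eqF.
rewrite gtr_pMr// ltr_pdivrMr ?mulr_gt0// mul1r.
by move: (H2norm h) N0 => n; lra.
Qed.

Lemma l2dot_second_derivative_cst f (c : R) : h2 f ->
  l2dot (second_derivative f) (cst c) = 0.
Proof.
move=> hf; rewrite h2_by_parts//; last exact: h2_cst.
rewrite derive1_cst0 /l2dot (@eq_Rintegral _ _ _ _ _ (fun=> 0)).
  by rewrite Rintegral_itv_cst// mul0r oppr0.
by move=> t _; rewrite mulr0.
Qed.

Lemma primitive_periodic0 r : continuous r -> periodic r 1 ->
  l2dot r (cst 1) = 0 -> periodic (primitive r) 1.
Proof.
move=> cr pr r0; apply: (primitive_periodic (fun t => is_derive_primitive t cr)) => //.
apply/eqP; rewrite -subr_eq0 primitiveB//; last by move=> a b; exact: continuous_integrable.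
by apply/eqP/(etrans _ r0)/eq_Rintegral => t _; rewrite mulr1.
Qed.

(* Test against the function [k] in H^2 with [k'' = r + d u'']. *)
Lemma orthogonal_h2_eq0 r u (d : R) : continuous r -> periodic r 1 -> h2 u ->
  (forall k, h2 k -> l2dot (r + d *: second_derivative u) k = 0) ->
  r + d *: second_derivative u = 0 %[ae mu].
Proof.
move=> cr pr hu orth.
have lr := l2_continuous cr pr; have ls := h2_l2_second hu.
(* Testing against constants shows that [r] has mean 0, so its primitive is periodic. *)
have r0 : l2dot r (cst 1) = 0.
  have := orth _ (h2_cst 1).
  rewrite (l2dotDl lr (l2Z d ls) (l2_cst 1)) (l2dotZl d ls (l2_cst 1)).
  by rewrite l2dot_second_derivative_cst// mulr0 addr0.
pose P := primitive r; have dP (t : R) : is_derive t 1 P (r t) by exact: is_derive_primitive.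
have cP := is_derive_continuous dP.
have pP : periodic P 1 by exact: primitive_periodic0.
(* Removing the mean makes the second primitive periodic as well. *)
pose m := l2dot P (cst 1).
pose P0 : R -> R^o := fun t => P t - m.
have dP0 (t : R) : is_derive t 1 P0 (r t).
  by rewrite -[r t]subr0; apply: is_deriveB.
have cP0 := is_derive_continuous dP0.
have pP0 : periodic P0 1 by move=> t; rewrite /P0 pP.
have P00 : l2dot P0 (cst 1) = 0.
  have -> : P0 = P \+ (- m) \*: (cst 1 : R -> R^o).
    by apply/funext => t; rewrite /P0 /= /GRing.scale/= mulr1.
  have lP := l2_continuous cP pP.
  rewrite (l2dotDl lP (l2Z (- m) (l2_cst 1)) (l2_cst 1)) (l2dotZl (- m) (l2_cst 1) (l2_cst 1)).
  have -> : l2dot (cst 1 : R -> R^o) (cst 1) = 1.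
    by rewrite /l2dot /= Rintegral_itv_cst// subr0 !mulr1.
  by rewrite mulr1 -/m subrr.
pose Q := primitive P0; have dQ (t : R) : is_derive t 1 Q (P0 t) by exact: is_derive_primitive.
have pQ : periodic Q 1 by exact: primitive_periodic0.
have hQ : h2 Q := h2_twice_differentiable pQ dQ dP0 cr.
have sQ := second_derivative_ae pQ dQ dP0 cr.
pose k := d *: u + Q; have hk : h2 k by exact: h2_lin.
have sk : second_derivative k = r + d *: second_derivative u %[ae mu].
  have := second_derivative_lin d hu hQ; apply: filterS2 sQ.
    exact: (ae_filter_ringOfSetsType mu).
  by move=> t /= /(_ I) E0 /(_ I) E1 _; rewrite E1 !fctE E0 addrC.
have lsk := h2_l2_second hk.
have lrd : l2 (r + d *: second_derivative u) by apply: (l2D lr); exact: l2Z.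
(* Since [k''] is the residual itself, orthogonality to [k] reads [- |k'|^2 = 0]; thus [k' = 0] and
   the residual vanishes. *)
have k0 : l2dot (derive1 k) (derive1 k) = 0.
  apply/eqP; rewrite -oppr_eq0 -h2_by_parts//.
  by rewrite (l2dot_ae lsk lrd (h2_l2 hk) sk) orth.
have dk0 := l2dot_continuous_eq0 (h2_derive1_continuous hk) (h2_derive1_periodic hk) k0.
have s0 : second_derivative k = (0 : R -> R^o) %[ae mu].
  apply: l2_derivative_unique (h2_second_derivative hk) _; split; first exact: (l2_cst 0).
  by move=> s t st; rewrite !dk0 Rintegral_itv_cst// mul0r subrr.
move: s0; apply: filterS2 sk; first exact: (ae_filter_ringOfSetsType mu).
by move=> t /= /(_ I) E0 /(_ I) E1 _; rewrite -E0 E1.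
Qed.

End stationarity.

(** * Pointwise derivatives, means and moments *)

Section pointwise_derivatives.
Context {R : realType}.
Implicit Types (f g h F : R -> R^o).

Lemma pw_deriveM f g (t x y : R) : is_derive t 1 f x -> is_derive t 1 g y ->
  is_derive t 1 (fun s => f s * g s : R^o) (f t * y + x * g t).
Proof.
move=> df dg; have H : is_derive t 1 (f * g) _ := is_deriveM df dg.
by apply: (is_derive_eq H); rewrite /GRing.scale/= [g t * x]mulrC.
Qed.

Lemma pw_deriveD f g (t x y : R) : is_derive t 1 f x -> is_derive t 1 g y ->
  is_derive t 1 (fun s => f s + g s : R^o) (x + y).
Proof. by move=> df dg; exact: is_deriveD. Qed.

Lemma pw_deriveB f g (t x y : R) : is_derive t 1 f x -> is_derive t 1 g y ->
  is_derive t 1 (fun s => f s - g s : R^o) (x - y).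
Proof. by move=> df dg; exact: is_deriveB. Qed.

Lemma pw_deriveZ (c : R) f (t x : R) : is_derive t 1 f x ->
  is_derive t 1 (fun s => c * f s : R^o) (c * x).
Proof. by move=> df; exact: (@is_deriveZ _ _ _ f c). Qed.

Lemma pw_deriveX n f (t x : R) : is_derive t 1 f x ->
  is_derive t 1 (fun s => f s ^+ n : R^o) (n%:R * f t ^+ n.-1 * x).
Proof.
move=> df; elim: n => [|n IH].
  rewrite !mul0r; under [X in is_derive _ _ X]eq_fun do rewrite expr0.
  exact: is_derive_cst.
under [X in is_derive _ _ X]eq_fun do rewrite exprS.
apply: (is_derive_eq (pw_deriveM df IH)).
case: n {IH} => [|n]; first by rewrite /= !mul0r mulr0 add0r !mul1r expr0 mulr1.
by rewrite -[in RHS]natr1 [n.+2.-1]/= exprS; ring.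
Qed.

Lemma pw_continuousX n f : continuous f -> continuous (fun s => f s ^+ n : R^o).
Proof.
move=> cf; elim: n => [|n IH]; first by move=> t; exact: cvg_cst.
have -> : (fun s => f s ^+ n.+1) = (fun s => f s * f s ^+ n).
  by apply/funext => s; rewrite exprS.
move=> t; exact: (continuousM (cf t) (IH t)).
Qed.

Lemma pw_continuousZ (c : R) f : continuous f -> continuous (fun s => c * f s : R^o).
Proof. by move=> cf t; apply: cvgM; [exact: cvg_cst|exact: cf]. Qed.

Definition mean f : R := l2dot f (cst 1).

Definition moment f (n : nat) : R := mean (fun t => f t ^+ n : R^o).

Lemma meanE f : mean f = \int[lebesgue_measure]_(t in `[0, 1]) f t.
Proof. by apply: eq_Rintegral => t _; rewrite mulr1. Qed.

Lemma mean_derivative f g : (forall t : R, is_derive t 1 f (g t)) -> continuous g ->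
  periodic f 1 -> mean g = 0.
Proof.
move=> df cg pf; rewrite meanE (integral_derive _ cg df)//.
by rewrite -[X in f X - _](add0r 1) pf subrr.
Qed.

Lemma mean_lin3 (a b c : R) f g h : continuous f -> continuous g -> continuous h ->
  mean (fun t => a * f t + b * g t + c * h t) = a * mean f + b * mean g + c * mean h.
Proof.
move=> cf cg ch; rewrite !meanE.
have i (k : R -> R^o) : continuous k -> lebesgue_measure.-integrable `[0, 1] (EFin \o k).
  by move=> ck; exact: continuous_integrable.
rewrite RintegralD//; last 2 first.
- apply: (i (fun t => a * f t + b * g t)) => t.
  by apply: cvgD; exact: pw_continuousZ.
- by apply: (i (fun t => c * h t)); exact: pw_continuousZ.
rewrite RintegralD//; last 2 first.
- by apply: (i (fun t => a * f t)); exact: pw_continuousZ.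
- by apply: (i (fun t => b * g t)); exact: pw_continuousZ.
by rewrite !RintegralZl//; exact: i.
Qed.

(** Source of the moment identities: the derivative of a periodic function has mean 0. *)
Lemma mean_derivative3 (a b c : R) F f g h :
  (forall t : R, is_derive t 1 F (a * f t + b * g t + c * h t)) ->
  continuous f -> continuous g -> continuous h -> periodic F 1 ->
  a * mean f + b * mean g + c * mean h = 0.
Proof.
move=> dF cf cg ch pF; rewrite -mean_lin3//; apply: mean_derivative dF _ pF => t.
by apply: cvgD; [apply: cvgD|]; exact: pw_continuousZ.
Qed.

Lemma mean_cst (c : R) : mean (cst c) = c.
Proof. by rewrite meanE Rintegral_itv_cst// subr0 mulr1. Qed.

Lemma mean_cauchy f g : continuous f -> continuous g -> periodic f 1 -> periodic g 1 ->
  mean (fun t => f t * g t) ^+ 2 <= mean (fun t => f t ^+ 2) * mean (fun t => g t ^+ 2).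
Proof.
move=> cf cg pf pg.
have := l2dot_cauchy (l2_continuous cf pf) (l2_continuous cg pg).
by rewrite !meanE.
Qed.

End pointwise_derivatives.

(** * The Duffing equation and its linearization *)

Section duffing.
Context {R : realType}.
Variables (z p : R -> R^o) (al be : R).
Hypotheses (pz : periodic z 1) (dz : forall t : R, is_derive t 1 z (p t))
  (dp : forall t : R, is_derive t 1 p (al * z t - be * z t ^+ 3)).

Local Notation B := (moment p 2).

Let cz : continuous z := is_derive_continuous dz.
Let cp : continuous p := is_derive_continuous dp.
Let pp : periodic p 1 := periodic_is_derive dz pz.
Let czX n : continuous (fun t => z t ^+ n : R^o).
Proof. exact: pw_continuousX. Qed.
Let cpX n : continuous (fun t => p t ^+ n : R^o).
Proof. exact: pw_continuousX. Qed.

(** The first integral [p^2 / 2 - al z^2 / 2 + be z^4 / 4], evaluated at time 0. *)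
Definition duffing_energy : R :=
  (p 0 ^+ 2 - al * z 0 ^+ 2 + be * z 0 ^+ 4 / 2) / 2.
Local Notation e := duffing_energy.

Lemma duffing_energyP t : p t ^+ 2 = al * z t ^+ 2 - be / 2 * z t ^+ 4 + 2 * e.
Proof.
pose F : R -> R^o := fun t => p t ^+ 2 + (- al) * z t ^+ 2 + be / 2 * z t ^+ 4.
have dF (t' : R) : is_derive t' 1 F 0.
  have H := pw_deriveD (pw_deriveD (pw_deriveX 2 (dp t')) (pw_deriveZ (- al) (pw_deriveX 2 (dz t'))))
    (pw_deriveZ (be / 2) (pw_deriveX 4 (dz t'))).
  by apply: (is_derive_eq H); rewrite /=; field.
have := @is_derive_0_is_cst R F t 0 dF.
rewrite /F /duffing_energy => E.
have -> : p t ^+ 2 = (p t ^+ 2 + - al * z t ^+ 2 + be / 2 * z t ^+ 4) + al * z t ^+ 2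
  - be / 2 * z t ^+ 4 by ring.
by rewrite E; field.
Qed.

(** The mean of [(z p)'] is 0. *)
Lemma duffing_kinetic : B = be * moment z 4 - al * moment z 2.
Proof.
have dF (t : R) : is_derive t 1 (fun s => z s * p s : R^o)
    (1 * p t ^+ 2 + al * z t ^+ 2 + (- be) * z t ^+ 4).
  by apply: (is_derive_eq (pw_deriveM (dz t) (dp t))); ring.
have pF : periodic (fun s => z s * p s : R^o) 1 by move=> t; rewrite pz pp.
have := mean_derivative3 dF (@cpX 2) (@czX 2) (@czX 4) pF.
rewrite -/(moment p 2) -/(moment z 2) -/(moment z 4).
move: B (moment z 2) (moment z 4) => b m2 m4; lra.
Qed.

Lemma duffing_kinetic_energy : B = al * moment z 2 - be / 2 * moment z 4 + 2 * e.
Proof.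
rewrite /moment (_ : (fun t => _) = (fun t => al * z t ^+ 2 + (- be / 2) * z t ^+ 4
    + (2 * e) * (cst 1 : R -> R^o) t)); last first.
  by apply/funext => t; rewrite duffing_energyP /=; field.
rewrite mean_lin3 ?mean_cst -/(moment z 2) -/(moment z 4)//; last by move=> t; exact: cvg_cst.
by field.
Qed.

(** The mean of [(z^3 p)'] is 0, with [p^2] eliminated through the energy. *)
Lemma duffing_moment6 : 5 / 2 * (be * moment z 6) = 4 * al * moment z 4 + 6 * e * moment z 2.
Proof.
have dF (t : R) : is_derive t 1 (fun s => z s ^+ 3 * p s : R^o)
    (4 * al * z t ^+ 4 + (- 5 / 2 * be) * z t ^+ 6 + 6 * e * z t ^+ 2).
  apply: (is_derive_eq (pw_deriveM (pw_deriveX 3 (dz t)) (dp t))) => /=.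
  have -> : 3%:R * z t ^+ 2 * p t * p t = 3 * z t ^+ 2 * p t ^+ 2 by ring.
  by rewrite duffing_energyP; field.
have pF : periodic (fun s => z s ^+ 3 * p s : R^o) 1 by move=> t; rewrite pz pp.
have := mean_derivative3 dF (@czX 4) (@czX 6) (@czX 2) pF.
rewrite -/(moment z 2) -/(moment z 4) -/(moment z 6).
move: (moment z 2) (moment z 4) (moment z 6) e => a b c d; lra.
Qed.

Lemma duffing_cauchy2 : moment z 2 ^+ 2 <= moment z 4.
Proof.
have c1 : continuous (cst 1 : R -> R^o) by move=> t; exact: cvg_cst.
have := mean_cauchy (@czX 2) c1 _ _.
have -> : (fun t => z t ^+ 2 * (cst 1 : R -> R^o) t) = (fun t => z t ^+ 2).
  by apply/funext => t; rewrite /= mulr1.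
have -> : (fun t => (z t ^+ 2) ^+ 2) = (fun t => z t ^+ 4).
  by apply/funext => t; rewrite -exprM.
have -> : (fun t => (cst 1 : R -> R^o) t ^+ 2) = cst 1.
  by apply/funext => t; rewrite /= expr1n.
rewrite mean_cst mulr1; apply => //.
by move=> t; rewrite pz.
Qed.

Lemma duffing_cauchy4 : moment z 4 ^+ 2 <= moment z 2 * moment z 6.
Proof.
have := mean_cauchy cz (@czX 3) pz _.
have -> : (fun t => z t * z t ^+ 3) = (fun t => z t ^+ 4).
  by apply/funext => t; rewrite -exprS.
have -> : (fun t => (z t ^+ 3) ^+ 2) = (fun t => z t ^+ 6).
  by apply/funext => t; rewrite -exprM.
by apply; move=> t; rewrite pz.
Qed.

(** If [B] were 0, adding its two expressions would give [be / 2 * moment z 4 + 2 e = 0], although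
    the first term is nonnegative and the second positive. *)
Lemma duffing_kinetic_gt0 : 0 < be -> 0 < e -> 0 < B.
Proof.
move=> be0 e0.
have B0 : 0 <= B by rewrite /moment meanE; apply: Rintegral_ge0 => t _; rewrite sqr_ge0.
rewrite lt_def B0 andbT; apply/negP => /eqP BE.
have := duffing_kinetic; have := duffing_kinetic_energy; rewrite BE.
have : 0 <= moment z 4.
  rewrite /moment meanE; apply: Rintegral_ge0 => t _.
  by rewrite (_ : 4%N = (2 * 2)%N)// exprM sqr_ge0.
move: (moment z 2) (moment z 4) e e0 => a b c; nra.
Qed.

(** Subtracting the mean is what makes a primitive of [z^2] periodic. *)
Definition centered_primitive : R -> R^o :=
  primitive (fun t => z t ^+ 2 - moment z 2 : R^o).
Local Notation Z := centered_primitive.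

(* With the operator [L h := h'' - al h + 3 be z^2 h], one has
   [L z = 2 be z^3], [L p = 0] and [L w0 = (2 b be - 4 al) z^3 - 6 B z], where
   [b] is the mean of [z^2] and [B] the mean of [p^2]. *)
Definition duffing_w0 : R -> R^o := fun t => Z t * p t - z t ^+ 3.
Local Notation w0 := duffing_w0.

Let dZ (t : R) : is_derive t 1 Z (z t ^+ 2 - moment z 2).
Proof.
have c2 : continuous (fun t => z t ^+ 2 - moment z 2 : R^o).
  by move=> s; apply: cvgB; [exact: (@czX 2)|exact: cvg_cst].
exact: is_derive_primitive.
Qed.

Let cZ : continuous Z := is_derive_continuous dZ.

Let pZ : periodic Z 1.
Proof.
have c2 : continuous (fun t => z t ^+ 2 - moment z 2 : R^o).
  by move=> s; apply: cvgB; [exact: (@czX 2)|exact: cvg_cst].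
apply: (primitive_periodic dZ); first by move=> t; rewrite pz.
apply/eqP; rewrite -subr_eq0 /centered_primitive primitiveB//; last first.
  by move=> a b; exact: continuous_integrable.
have c1 : continuous (cst 1 : R -> R^o) by move=> t; exact: cvg_cst.
have := mean_lin3 1 (- moment z 2) 0 (@czX 2) c1 c1.
rewrite mean_cst -/(moment z 2) meanE => E.
apply/eqP; apply: (etrans _ (etrans E _)); last ring.
by apply: eq_Rintegral => t _ /=; ring.
Qed.

Let p' (t : R) : R := al * z t - be * z t ^+ 3.
Let w0' (t : R) : R^o := Z t * p' t - (2 * z t ^+ 2 + moment z 2) * p t.

Let dp' (t : R) : is_derive t 1 (p' : R -> R^o) (al * p t - 3 * be * z t ^+ 2 * p t).
Proof.
apply: (is_derive_eq (pw_deriveB (pw_deriveZ al (dz t)) (pw_deriveZ be (pw_deriveX 3 (dz t))))).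
by rewrite /=; ring.
Qed.

Let dw0 (t : R) : is_derive t 1 w0 (w0' t).
Proof.
apply: (is_derive_eq (pw_deriveB (pw_deriveM (dZ t) (dp t)) (pw_deriveX 3 (dz t)))).
by rewrite /w0' /p' /=; ring.
Qed.

Let energy2 := duffing_energyP.

(** Elimination of [moment z 4] between the two expressions of [B]. *)
Let six_B : 8 * e + 2 * moment z 2 * al = 6 * B.
Proof.
have := duffing_kinetic; have := duffing_kinetic_energy.
move: B (moment z 2) (moment z 4) e => b m2 m4 E; lra.
Qed.

(** After substituting the energy for [p^2], both [L (Z p)] and [L (z^3)] contain [- 3 be z^5]; only
    [z] and [z^3] survive in the difference. *)
Let dw0' (t : R) : is_derive t 1 w0' (al * w0 t - 3 * be * z t ^+ 2 * w0 t
  + (2 * moment z 2 * be - 4 * al) * z t ^+ 3 - 6 * B * z t).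
Proof.
apply: (is_derive_eq (pw_deriveB (pw_deriveM (dZ t) (dp' t))
  (pw_deriveM (pw_deriveD (pw_deriveZ 2 (pw_deriveX 2 (dz t))) (is_derive_cst (moment z 2 : R^o) t 1)) (dp t)))).
rewrite -six_B /w0 /p' /=; have := energy2 t.
move: (Z t) (z t) (p t) (moment z 2) e => Zt zt pt b E H.
have -> : (2 * (2%:R * zt ^+ 1 * pt) + 0) * pt = 4 * zt * pt ^+ 2 by ring.
by rewrite H; field.
Qed.

(** The linearized equation has no first-order term. *)
Lemma wronskian_cst (f f' g g' : R -> R^o) :
  (forall t : R, is_derive t 1 f (f' t)) -> (forall t : R, is_derive t 1 g (g' t)) ->
  (forall t : R, is_derive t 1 f' (al * f t - 3 * be * z t ^+ 2 * f t)) ->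
  (forall t : R, is_derive t 1 g' (al * g t - 3 * be * z t ^+ 2 * g t)) ->
  exists w : R, forall t, f t * g' t - f' t * g t = w.
Proof.
move=> df dg df' dg'; pose W : R -> R^o := fun t => f t * g' t - f' t * g t.
have dW (t : R) : is_derive t 1 W 0.
  apply: (is_derive_eq (pw_deriveB (pw_deriveM (df t) (dg' t)) (pw_deriveM (df' t) (dg t)))).
  by ring.
by exists (W 0) => t; exact: (@is_derive_0_is_cst R W t 0 dW).
Qed.

(** Chosen so that the [z^3] terms of [L phi] cancel; the terms in [z] cancel because
    [L (z + t p) = 2 al z]. *)
Let nu : R := al * (2 * moment z 2 * be - 4 * al) / be.
(* [L (t p) = 2 p'], so that [phi] below solves [L phi = 0]; it is not periodic
   since [phi (t + 1) = phi t + 6 B p t]. *)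
Let phi (t : R) : R^o := 2 * al * w0 t + 6 * B * (z t + t * p t) - nu * z t.
Let phi' (t : R) : R^o := 2 * al * w0' t + 6 * B * (2 * p t + t * p' t) - nu * p t.

Let dphi (t : R) : is_derive t 1 phi (phi' t).
Proof.
have did := is_derive_id (t : R^o) 1.
apply: (is_derive_eq (pw_deriveB (pw_deriveD (pw_deriveZ (2 * al) (dw0 t))
  (pw_deriveZ (6 * B) (pw_deriveD (dz t) (pw_deriveM did (dp t))))) (pw_deriveZ nu (dz t)))).
by rewrite /phi' /p'; ring.
Qed.

Section kernel.
Hypotheses (be0 : 0 < be) (e0 : 0 < e).

Let B0 : 0 < B := duffing_kinetic_gt0 be0 e0.

Let dphi' (t : R) : is_derive t 1 phi' (al * phi t - 3 * be * z t ^+ 2 * phi t).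
Proof.
have did := is_derive_id (t : R^o) 1.
apply: (is_derive_eq (pw_deriveB (pw_deriveD (pw_deriveZ (2 * al) (dw0' t))
  (pw_deriveZ (6 * B) (pw_deriveD (pw_deriveZ 2 (dp t)) (pw_deriveM did (dp' t))))) (pw_deriveZ nu (dp t)))).
rewrite /phi /p' /nu; move: (w0 t) (z t) (p t) (moment z 2) B => w zt pt b B'.
by field; rewrite gt_eqF.
Qed.

(** The terms with [Z] and those with an explicit factor [t] cancel. The energy turns the rest into
    a constant, nonzero because [e] and [be] are positive. *)
Let wronskian_phi : exists2 w : R, w != 0 & forall t, phi t * p' t - phi' t * p t = w.
Proof.
exists (- (8 * e / be) * (4 * e * be + al ^+ 2)).
  rewrite mulNr oppr_eq0 mulf_neq0// gt_eqF//.
    by rewrite divr_gt0// mulr_gt0.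
  have ebe : 0 < 4 * e * be by apply: mulr_gt0 => //; apply: mulr_gt0.
  exact: (ltr_wpDr (sqr_ge0 al) ebe).
move=> t.
have -> : phi t * p' t - phi' t * p t = 2 * al * (- z t ^+ 3 * p' t + (2 * z t ^+ 2 + moment z 2) * p t ^+ 2)
    + 6 * B * (z t * p' t - 2 * p t ^+ 2) - nu * (z t * p' t - p t ^+ 2).
  by rewrite /phi /phi' /w0' /w0; ring.
rewrite energy2 -six_B /nu /p'; move: (z t) (moment z 2) e => zt b E.
by field; rewrite gt_eqF.
Qed.

Lemma duffing_kernel (h k : R -> R^o) : periodic h 1 ->
  (forall t : R, is_derive t 1 h (k t)) ->
  (forall t : R, is_derive t 1 k (al * h t - 3 * be * z t ^+ 2 * h t)) ->
  exists d : R, forall t, h t = d * p t.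
Proof.
move=> ph dh dk.
have [w1 W1] := wronskian_cst dh dp dk dp'.
have [w2 W2] := wronskian_cst dh dphi dk dphi'.
have [w wn0 W] := wronskian_phi.
(* Cramer's rule with the three constant Wronskians. *)
have hE t : h t = w1 / w * phi t - w2 / w * p t.
  have -> : h t = h t * (phi t * p' t - phi' t * p t) / w by rewrite W mulfK.
  by rewrite -(W1 t) -(W2 t) /p'; field.
have pw : periodic w0 1 by move=> t; rewrite /duffing_w0 pZ pp pz.
have phi1 t : phi (t + 1) - phi t = 6 * B * p t.
  by rewrite /phi pw pz pp; ring.
(* Comparing [hE] at [t] and [t + 1]: among [h], [p] and [phi] only [phi] changes, by [6 B p t], so
   its coefficient times this increment vanishes. *)
have w10 t : w1 * p t = 0.
  have := ph t; rewrite !hE pp => E.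
  have : w1 / w * (phi (t + 1) - phi t) = 0 by rewrite mulrBr; lra.
  rewrite phi1 => /eqP; rewrite !mulf_eq0 invr_eq0 (negbTE wn0) orbF.
  by rewrite (gt_eqF B0) pnatr_eq0 /= => /orP[/eqP ->|/eqP ->]; rewrite ?mul0r ?mulr0.
exists (- w2 / w) => t.
have w1E : w1 = 0.
  apply/eqP/negPn/negP => w1n.
  have p0 s : p s = 0 by move/eqP: (w10 s); rewrite mulf_eq0 (negbTE w1n) => /eqP.
  have : B = 0.
    rewrite /moment (_ : (fun t => _) = cst 0) ?mean_cst//.
    by apply/funext => s; rewrite p0 expr0n.
  by move/eqP; rewrite gt_eqF.
by rewrite hE w1E; field.
Qed.

Lemma duffing_linearized (h k : R -> R^o) (A C : R) : periodic h 1 ->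
  (forall t : R, is_derive t 1 h (k t)) ->
  (forall t : R, is_derive t 1 k
     (al * h t - 3 * be * z t ^+ 2 * h t + A * z t + C * z t ^+ 3)) ->
  exists x y d : R, [/\ forall t, h t = x * z t + y * w0 t + d * p t,
    A = - 6 * B * y & C = 2 * be * x + (2 * moment z 2 * be - 4 * al) * y].
Proof.
move=> ph dh dk.
(* Only [L w0] contributes a multiple of [z], which fixes [y]; then [x] absorbs what is left of
   [z^3]. *)
pose y := - A / (6 * B); pose x := (C - (2 * moment z 2 * be - 4 * al) * y) / (2 * be).
have Bn : B != 0 by rewrite gt_eqF.
have ben : be != 0 by rewrite gt_eqF.
have AE : A = - 6 * B * y by rewrite /y; field.
have CE : C = 2 * be * x + (2 * moment z 2 * be - 4 * al) * y by rewrite /x; field.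
pose g : R -> R^o := fun t => h t - (x * z t + y * w0 t).
pose g' : R -> R^o := fun t => k t - (x * p t + y * w0' t).
have pw : periodic w0 1 by move=> t; rewrite /duffing_w0 pZ pp pz.
have [d gE] : exists d : R, forall t, g t = d * p t.
  apply: (@duffing_kernel g g').
  - by move=> t; rewrite /g ph pz pw.
  - move=> t; exact: pw_deriveB (dh t) (pw_deriveD (pw_deriveZ x (dz t)) (pw_deriveZ y (dw0 t))).
  - move=> t.
    apply: (is_derive_eq (pw_deriveB (dk t) (pw_deriveD (pw_deriveZ x (dp t)) (pw_deriveZ y (dw0' t))))).
    by rewrite AE CE /g; ring.
exists x, y, d; split => // t.
by rewrite -gE /g; ring.
Qed.

End kernel.

(** [z p] and [z^3 p] are derivatives of periodic functions, and the zero means of [(Z z^2)'] and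
    [(Z z^4)'] express those of [z w0] and [z^3 w0] through moments of [z]. *)
Lemma duffing_means (h : R -> R^o) (x y d : R) :
  (forall t, h t = x * z t + y * w0 t + d * p t) ->
  mean (fun t => z t * h t : R^o) = x * moment z 2 + y * (moment z 2 ^+ 2 / 2 - 3 / 2 * moment z 4) /\
  mean (fun t => z t ^+ 3 * h t : R^o)
    = x * moment z 4 + y * (moment z 2 * moment z 4 / 4 - 5 / 4 * moment z 6).
Proof.
move=> hE.
have cw : continuous w0.
  by move=> t; apply: cvgB; [apply: cvgM; [exact: cZ|exact: cp]|exact: (@czX 3)].
have cm (f g : R -> R^o) : continuous f -> continuous g -> continuous (fun t => f t * g t : R^o).
  by move=> cf cg t; exact: (continuousM (cf t) (cg t)).
have m1 : mean (fun t => z t * p t : R^o) = 0.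
  have dF (t : R) : is_derive t 1 (fun s => 2^-1 * z s ^+ 2 : R^o) (z t * p t).
    by apply: (is_derive_eq (pw_deriveZ 2^-1 (pw_deriveX 2 (dz t)))); rewrite /=; field.
  by apply: (mean_derivative dF); [exact: cm|move=> t; rewrite pz].
have m3 : mean (fun t => z t ^+ 3 * p t : R^o) = 0.
  have dF (t : R) : is_derive t 1 (fun s => 4^-1 * z s ^+ 4 : R^o) (z t ^+ 3 * p t).
    by apply: (is_derive_eq (pw_deriveZ 4^-1 (pw_deriveX 4 (dz t)))); rewrite /=; field.
  by apply: (mean_derivative dF); [apply: cm => //; exact: (@czX 3)|move=> t; rewrite pz].
have w1 : 2 * mean (fun t => z t * w0 t : R^o) + 3 * moment z 4 + - moment z 2 * moment z 2 = 0.
  apply: (@mean_derivative3 _ _ _ _ (fun s => Z s * z s ^+ 2 : R^o)).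
  - move=> t; apply: (is_derive_eq (pw_deriveM (dZ t) (pw_deriveX 2 (dz t)))).
    by rewrite /w0 /=; ring.
  - exact: cm.
  - exact: (@czX 4).
  - exact: (@czX 2).
  - by move=> t; rewrite pZ pz.
have w3 : 4 * mean (fun t => z t ^+ 3 * w0 t : R^o) + 5 * moment z 6 + - moment z 2 * moment z 4 = 0.
  apply: (@mean_derivative3 _ _ _ _ (fun s => Z s * z s ^+ 4 : R^o)).
  - move=> t; apply: (is_derive_eq (pw_deriveM (dZ t) (pw_deriveX 4 (dz t)))).
    by rewrite /w0 /=; ring.
  - by apply: cm => //; exact: (@czX 3).
  - exact: (@czX 6).
  - exact: (@czX 4).
  - by move=> t; rewrite pZ pz.
split.
- rewrite (_ : (fun t => _) = (fun t => x * z t ^+ 2 + y * (z t * w0 t) + d * (z t * p t))); last first.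
    by apply/funext => t; rewrite hE; ring.
  rewrite (mean_lin3 x y d (@czX 2) (cm _ _ cz cw) (cm _ _ cz cp)) m1 -/(moment z 2).
  move: w1; move: (mean _) (moment z 2) (moment z 4) => a b c E.
  by have -> : a = (b * b - 3 * c) / 2; [lra|field].
- rewrite (_ : (fun t => _) = (fun t => x * z t ^+ 4 + y * (z t ^+ 3 * w0 t) + d * (z t ^+ 3 * p t))); last first.
    by apply/funext => t; rewrite hE; ring.
  rewrite (mean_lin3 x y d (@czX 4) (cm _ _ (@czX 3) cw) (cm _ _ (@czX 3) cp)) m3 -/(moment z 4).
  move: w3; move: (mean _) (moment z 2) (moment z 4) (moment z 6) => a b c c6 E.
  by have -> : a = (b * c - 5 * c6) / 4; [lra|field].
Qed.

End duffing.

(** * The linear system for the kernel and the sign of its bracket *)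

Section algebra.
Context {R : realType}.

(* In [linearized_system] below, [u = be q], [v = al b], [s = be b^2] and
   [k = sqrt 2 - 1]; the last two hypotheses are [be b^2 <= be q] and
   [be^2 q^2 <= be^2 b M6]. *)
Lemma bracket_gt0 (u v s e k : R) : 0 < u -> 0 < s -> 0 < e -> 0 < k ->
  k ^+ 2 + 2 * k = 1 -> e = 3 / 4 * u - v -> u ^+ 2 = 2 * k ^+ 2 * s * e ->
  s <= u -> 5 * u ^+ 2 <= 8 * v * u + 12 * e * s ->
  0 < (u - 2 * v) * (7 * u * s - 8 * v * s - 4 * e * u) + 2 * (u - v) * u * s.
Proof.
move=> u0 s0 e0 k0 kE eE uE su cs.
have vE : v = 3 / 4 * u - e by rewrite eE; ring.
rewrite vE in cs *.
pose K := k ^+ 2; have K0 : 0 < K by rewrite exprn_gt0.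
have K1 : K < 1 by rewrite /K; lra.
rewrite -/K in uE.
(* The first Cauchy-Schwarz inequality enters: [u^2 = 2 K s e <= 2 K u e]. *)
have uKe : u <= 2 * K * e.
  rewrite -(ler_pM2l u0) -expr2 uE.
  have -> : u * (2 * K * e) = 2 * K * u * e by ring.
  by rewrite ler_pM2r// ler_pM2l// mulr_gt0.
(* This is [K] times [cs], divided by [u], where [12 K e s] equals [6 u^2]. *)
have h1 : 8 * (K * e) <= (K + 6) * u.
  rewrite -(ler_pM2l u0).
  have : K * (8 * e * u) <= K * (u ^+ 2 + 12 * e * s).
    by rewrite ler_pM2l//; move: cs; lra.
  have -> : K * (u ^+ 2 + 12 * e * s) = K * u ^+ 2 + 6 * (2 * K * s * e) by ring.
  rewrite -uE => H; apply: le_trans (le_trans _ H) _.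
    by rewrite le_eqVlt; apply/orP; left; apply/eqP; ring.
  by rewrite le_eqVlt; apply/orP; left; apply/eqP; ring.
(* As [K < 1], [h1] gives [8 K e < 7 u]. Together with [u^2 = 2 s (K e)] this yields [u < 2 s],
   which makes the second factor of the bracket positive. *)
have Keu : K * e < u.
  have Ku : K * u < u by rewrite -[ltRHS]mul1r ltr_pM2r.
  have -> : K * e = 8 * (K * e) / 8 by field.
  by move: h1 Ku; rewrite mulrDl; lra.
have us2 : u < 2 * s.
  rewrite -(ltr_pM2l u0) -expr2 uE.
  have -> : 2 * K * s * e = 2 * s * (K * e) by ring.
  by rewrite mulrC ltr_pM2r// mulr_gt0.
have t1 : 0 < u - 2 * (3 / 4 * u - e).
  have : K * e < e by rewrite -[ltRHS]mul1r ltr_pM2r.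
  by move: uKe; rewrite -mulrA; lra.
have -> : 7 * u * s - 8 * (3 / 4 * u - e) * s - 4 * e * u
    = u * s + 4 * e * (2 * s - u) by field.
have t2 : 0 < u * s + 4 * e * (2 * s - u).
  by apply: addr_gt0; rewrite !mulr_gt0// subr_gt0.
apply: addr_gt0; first exact: mulr_gt0.
by rewrite !mulr_gt0//; lra.
Qed.

(* [b], [q], [M6] are the moments of order 2, 4, 6 of [z] and [B] is the mean of
   [z'^2]; [db], [dq], [dE] are their variations in the direction
   [(eta, x z + y w0 + d z')]. *)
Lemma linearized_system (c b E q B M6 al be e eta x y db dq dE A C : R) :
  c != 0 -> 0 < b -> 0 < E -> 0 < q -> q = b * (c ^+ 2 - E) -> c ^+ 4 = 2 * E ^+ 2 ->
  be = (b ^+ 2 * E ^+ 2)^-1 ->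
  al = (B - b ^- 2 + q / (2 * b ^+ 2 * E ^+ 2)) / b ->
  B = be * q - al * b -> B = al * b - be / 2 * q + 2 * e ->
  5 / 2 * (be * M6) = 4 * al * q + 6 * e * b ->
  b ^+ 2 <= q -> q ^+ 2 <= b * M6 ->
  db = 2 * (x * b + y * (b ^+ 2 / 2 - 3 / 2 * q)) ->
  dq = 4 * (x * q + y * (b * q / 4 - 5 / 4 * M6)) ->
  dE = 2 * c * eta - dq / b + q * db / b ^+ 2 ->
  12 * eta / c ^+ 4 + 2 * eta / E ^+ 2 - 4 * c * dE / E ^+ 3 = 0 ->
  A = - 6 * B * y -> C = 2 * be * x + (2 * b * be - 4 * al) * y ->
  A = (4 * (- al * db + be / 2 * dq) + 8 * db / b ^+ 3 + 2 * dq / (b ^+ 2 * E ^+ 2)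
       - 4 * q * db / (b ^+ 3 * E ^+ 2) - 4 * q * dE / (b ^+ 2 * E ^+ 3)
       - 4 * db * al) / (4 * b) ->
  C = (4 * db / (b ^+ 2 * E ^+ 2) + 8 * dE / (b * E ^+ 3) + 4 * db * be) / (4 * b) ->
  [/\ eta = 0, x = 0 & y = 0].
Proof.
move=> c0 b0 E0 q0 qE c4 beE alE B1 B2 M6E bq qM dbE dqE dEE eq1 AE CE A2 C2.
have cn := c0; have bn : b != 0 by rewrite gt_eqF.
(* The number [k] introduced next is the ratio of [q / b = c^2 - E] to [E]; the relation
   [c^4 = 2 E^2] then says [(1 + k)^2 = 2]. *)
have En : E != 0 by rewrite gt_eqF.
pose k := q / (b * E); have k0 : 0 < k by rewrite divr_gt0// mulr_gt0.
have qk : q = k * b * E by rewrite /k; field; rewrite bn En.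
have c2 : c ^+ 2 = (1 + k) * E by rewrite /k qE; field; rewrite bn En.
have kk : k ^+ 2 + 2 * k = 1.
  have : ((1 + k) ^+ 2 - 2) * E ^+ 2 = 0.
    by rewrite mulrBl -exprMn -c2 -exprM c4; ring.
  move/eqP; rewrite mulf_eq0 expf_eq0/= (negbTE En) orbF => /eqP; lra.
(* [w] is the relative variation of [c^2]. The first equation says that [E] has the same one, as
   linearizing [c^4 = 2 E^2] suggests; hence so does [q / b = c^2 - E]. *)
pose w : R := 2 * eta / c.
have dEw : dE = E * w.
  have : (12 * eta / c ^+ 4 + 2 * eta / E ^+ 2 - 4 * c * dE / E ^+ 3) * (E ^+ 3 / (4 * c)) = 0.
    by rewrite eq1 mul0r.
  rewrite c4.
  have -> : (12 * eta / (2 * E ^+ 2) + 2 * eta / E ^+ 2 - 4 * c * dE / E ^+ 3) * (E ^+ 3 / (4 * c))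
    = E * w - dE by rewrite /w; field; rewrite cn En.
  by move/eqP; rewrite subr_eq0 => /eqP.
have cw : 2 * c * eta = (1 + k) * E * w by rewrite -c2 /w; field.
have kEw : dq / b - q * db / b ^+ 2 = k * E * w.
  have : dE = (1 + k) * E * w - (dq / b - q * db / b ^+ 2) by rewrite dEE cw; ring.
  by rewrite dEw => H; lra.
have kn : k != 0 by rewrite gt_eqF.
pose u := k / (b * E); pose s := E ^- 2; pose v := 3 / 4 * u - e.
have u0 : 0 < u by rewrite divr_gt0// mulr_gt0.
have s0 : 0 < s by rewrite invr_gt0 exprn_gt0.
have ubq : be * q = u by rewrite beE qk /u; field; rewrite bn En.
have alb : al * b = B - b ^- 2 + u / 2.
  by rewrite alE -ubq beE; field; rewrite bn En.
(* Inserting [alb] in the energy average [B2] cancels [B] and the terms [u / 2]. *)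
have eE : e = b ^- 2 / 2 by lra.
have alv : al = v / b.
  have alb' : al * b = v by rewrite /v; lra.
  by rewrite -alb' mulfK.
have BE : B = u - v by rewrite B1 ubq alv; field.
have e0 : 0 < e by rewrite eE divr_gt0// invr_gt0 exprn_gt0.
have M6q : M6 = 2 / 5 * b * E ^+ 2 * (4 * v * q + 3).
  have ben : be != 0 by rewrite beE invr_eq0 mulf_neq0// expf_neq0.
  have -> : M6 = 5 / 2 * (be * M6) * (2 / (5 * be)) by field.
  by rewrite M6E alv eE beE; field; rewrite bn En.
(* [X] is the relative variation of [b]; that of [q / b] being [w], the relative variation of [q] is
   [w + X]. *)
pose X := db / b; pose Y := b * y.
have XE : X = 2 * x + Y * (1 - 3 * k * E / b).
  by rewrite /X /Y dbE qk; field.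
have dqE2 : dq = q * (w + X).
  have -> : dq = b * (dq / b - q * db / b ^+ 2) + q * db / b by field.
  by rewrite kEw qk /X; field.
have wX : w + X = 4 * x + Y * (1 - 8 * v * E ^+ 2 - 6 * E / (k * b)).
  have qn : q != 0 by rewrite gt_eqF.
  have -> : w + X = dq / q by rewrite dqE2; field.
  by rewrite dqE M6q qk /Y; field; rewrite bn En kn.
(* A second expression of [w + X], from the coefficient of [z^3]; equated with the one given by the
   moments, it determines [x] from [Y]. *)
have wX2 : w + X = x + (1 - 2 * v * E ^+ 2) * Y.
  have : C * (b ^+ 2 * E ^+ 2) / 2 = x + (1 - 2 * v * E ^+ 2) * Y.
    by rewrite CE alv beE /Y; field; rewrite bn En.
  by move=> <-; rewrite C2 dEw beE /X; field; rewrite bn En.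
have xY : x = Y * (2 * v * E ^+ 2 + 2 * E / (k * b)).
  have : 3 * x = 3 * (Y * (2 * v * E ^+ 2 + 2 * E / (k * b))).
    have -> : 3 * x = (4 * x + Y * (1 - 8 * v * E ^+ 2 - 6 * E / (k * b))) - x
        - Y * (1 - 8 * v * E ^+ 2 - 6 * E / (k * b)) by ring.
    by rewrite -wX wX2; field; rewrite bn kn.
  by move=> H; lra.
(* In the coefficient of [z] the contributions of [w] cancel, so this relation involves [X] and [Y]
   only. *)
have AX : - 6 * B * Y = (3 * u - 6 * v) * X.
  have -> : - 6 * B * Y = A * b by rewrite AE /Y; ring.
  have qE1 : q * E^-1 ^+ 2 / b ^+ 2 = u by rewrite qk /u; field; rewrite bn En.
  rewrite A2 dEw.
  have dbX : db = b * X by rewrite /X; field.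
  have e4 : b ^- 2 = 2 * e by rewrite eE; field.
  have vE : v = 3 / 4 * u - b ^- 2 / 2 by rewrite /v eE.
  by rewrite dqE2 dbX alv beE vE qk /u; field; rewrite bn En.
(* Substituting [XE] and [xY] in [AX] leaves a multiple of [Y]; the factor [u s / 3] brings it to
   the form of [bracket_gt0]. *)
have bracket : Y * ((u - 2 * v) * (7 * u * s - 8 * v * s - 4 * e * u) + 2 * (u - v) * u * s) = 0.
  have -> : Y * ((u - 2 * v) * (7 * u * s - 8 * v * s - 4 * e * u) + 2 * (u - v) * u * s)
    = ((3 * u - 6 * v) * X + 6 * B * Y) * (u * s / 3).
    by rewrite BE XE xY /v eE /u /s; field; rewrite bn En kn.
  by rewrite -AX; ring.
have su : s <= u.
  have -> : s = be * b ^+ 2 by rewrite beE /s; field; rewrite bn En.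
  by rewrite -ubq ler_pM2l// beE invr_gt0 mulr_gt0// exprn_gt0.
have cs : 5 * u ^+ 2 <= 8 * v * u + 12 * e * s.
  have be2 : 0 < 5 * be ^+ 2 by rewrite beE mulr_gt0// exprn_gt0// invr_gt0 mulr_gt0// exprn_gt0.
  have := qM; rewrite -(ler_pM2l be2).
  have -> : 5 * be ^+ 2 * q ^+ 2 = 5 * u ^+ 2 by rewrite -ubq; ring.
  have -> // : 5 * be ^+ 2 * (b * M6) = 8 * v * u + 12 * e * s.
  by rewrite M6q beE eE qk /s /u; field; rewrite bn En.
have pos := bracket_gt0 u0 s0 e0 k0 kk _ _ su cs.
have Y0 : Y = 0.
  move/eqP: bracket; rewrite mulf_eq0 => /orP[/eqP//|].
  rewrite gt_eqF//; apply: pos.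
    by rewrite /v; ring.
  by rewrite eE /u /s; field; rewrite bn En.
have x0 : x = 0 by rewrite xY Y0 mul0r.
have X0 : X = 0 by rewrite XE x0 Y0 !mulr0 mul0r addr0.
have w0 : w = 0 by move: wX; rewrite X0 x0 Y0 mulr0 mul0r !addr0.
split => //.
- by move/eqP: w0; rewrite /w mulf_eq0 invr_eq0 (negbTE cn) orbF mulf_eq0 pnatr_eq0/= => /eqP.
- by move/eqP: Y0; rewrite /Y mulf_eq0 (negbTE bn) => /eqP.
Qed.

End algebra.

(** * Critical points with constant first component and the kernel of their Hessian *)

Section critical_points.
Context {R : realType}.
Local Notation V := ((R -> R^o) * (R -> R^o))%type.
Local Notation mu := (@lebesgue_measure R).
Implicit Types f g h : R -> R^o.

Lemma l2dot_lin3 (x y u : R) f g h (l : R -> R^o) : l2 f -> l2 g -> l2 h -> l2 l ->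
  l2dot (x *: f + y *: g + u *: h) l = x * l2dot f l + y * l2dot g l + u * l2dot h l.
Proof.
move=> lf lg lh ll; have lxf := l2Z x lf; have lyg := l2Z y lg; have luh := l2Z u lh.
rewrite (l2dotDl (l2D lxf lyg) luh ll) (l2dotDl lxf lyg ll).
by rewrite (l2dotZl x lf ll) (l2dotZl y lg ll) (l2dotZl u lh ll).
Qed.

Lemma l2dot_cst (c d : R) : l2dot (cst c : R -> R^o) (cst d) = c * d.
Proof. by rewrite /l2dot /= Rintegral_itv_cst// subr0 mulr1. Qed.

Lemma l2dot_mean f g : l2dot f g = mean (fun t => f t * g t : R^o).
Proof. by rewrite meanE. Qed.

Lemma massE f : mass f = moment f 2.
Proof. by rewrite /moment meanE. Qed.

Lemma kineticE f : kinetic f = moment (derive1 f) 2.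
Proof. by rewrite /moment meanE. Qed.

Lemma quarticE f : quartic f = moment f 4.
Proof.
by rewrite /moment meanE; apply: eq_Rintegral => t _; rewrite /sq; ring.
Qed.

Lemma mass_cst (c : R) : mass (cst c : R -> R^o) = c ^+ 2.
Proof. exact: l2dot_cst. Qed.

Lemma quartic_cst (c : R) : quartic (cst c : R -> R^o) = c ^+ 4.
Proof.
have -> : quartic (cst c : R -> R^o) = c ^+ 2 * c ^+ 2 := l2dot_cst (c ^+ 2) (c ^+ 2).
ring.
Qed.

Lemma kinetic_cst (c : R) : kinetic (cst c : R -> R^o) = 0.
Proof. by rewrite /kinetic derive1_cst0 [LHS](l2dot_cst 0 0) mul0r. Qed.

Lemma l2dot0r f : l2dot f 0 = 0.
Proof.
rewrite /l2dot (@eq_Rintegral _ _ _ _ _ (fun=> 0)).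
  by rewrite Rintegral_itv_cst// mul0r.
by move=> t _; rewrite mulr0.
Qed.

Lemma h2_0 : h2 (0 : R -> R^o).
Proof. exact: (h2_cst 0). Qed.

(* [E] is the difference of the two quotients in the definition of [Hav]. *)
Lemma first_equation (c b q D E : R) : c != 0 -> b != 0 -> E != 0 ->
  D = c ^+ 2 * b * E ->
  (4 * 0 - 4 / (c ^+ 2) ^+ 2 - 2 * c ^+ 4 * b ^+ 2 / D ^+ 2) * c
    + 4 * c ^+ 2 * b ^+ 2 / D ^+ 2 * c ^+ 3 = 0 ->
  c ^+ 4 = 2 * E ^+ 2.
Proof.
move=> cn bn En -> H.
have : ((4 * 0 - 4 / (c ^+ 2) ^+ 2 - 2 * c ^+ 4 * b ^+ 2 / (c ^+ 2 * b * E) ^+ 2) * c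
    + 4 * c ^+ 2 * b ^+ 2 / (c ^+ 2 * b * E) ^+ 2 * c ^+ 3) * (c ^+ 3 * E ^+ 2 / 2) = 0.
  by rewrite H mul0r.
have -> : ((4 * 0 - 4 / (c ^+ 2) ^+ 2 - 2 * c ^+ 4 * b ^+ 2 / (c ^+ 2 * b * E) ^+ 2) * c
    + 4 * c ^+ 2 * b ^+ 2 / (c ^+ 2 * b * E) ^+ 2 * c ^+ 3) * (c ^+ 3 * E ^+ 2 / 2)
    = c ^+ 4 - 2 * E ^+ 2 by field; rewrite cn bn En.
by move/eqP; rewrite subr_eq0 => /eqP.
Qed.

Section at_critical_point.
Variables (c : R) (z : R -> R^o).
Local Notation Z := ((cst c : R -> R^o), z).
Hypothesis crit : critical_point Z.

Let HZ : Hav Z := crit.1.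
Let hz : h2 z. Proof. by case: HZ => -[]. Qed.
Let lz : l2 z := h2_l2 hz.
Let lcube : l2 (cube z) := h2_l2_cube hz.
Let ls : l2 (second_derivative z) := h2_l2_second hz.

Local Notation b := (mass z).
Local Notation q := (quartic z).
Local Notation B := (kinetic z).
Let E : R := c ^+ 2 - q / b.

Let c0 : c != 0.
Proof.
have [m1 _ _] := Hav_nonzero HZ; move: m1; rewrite mass_cst.
by apply: contraTneq => ->; rewrite expr0n ltxx.
Qed.

Let b0 : 0 < b. Proof. by have [_ m2 _] := Hav_nonzero HZ. Qed.
Let bn : b != 0. Proof. by rewrite gt_eqF. Qed.

Let gapE : gap Z = c ^+ 2 * b * E.
Proof.
rewrite /gap /= mass_cst quartic_cst /E; move: b0 bn; move: b q => b' q' _ bn'.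
by field.
Qed.

Let E0 : 0 < E.
Proof.
have [_ _] := Hav_nonzero HZ; rewrite gapE pmulr_rgt0// mulr_gt0//.
by rewrite lt_def sqr_ge0 sqrf_eq0 c0.
Qed.
Let En : E != 0. Proof. by rewrite gt_eqF. Qed.

Let qE : q = b * (c ^+ 2 - E).
Proof. by rewrite /E; move: bn; move: b q => b' q' bn'; field. Qed.

Let orth (h : V) : H2 h -> L2dot (grad_bav Z) h = 0.
Proof.
move=> Hh; rewrite (L2_gradient_unique (Hav_gradient HZ) crit.2 Hh).
by rewrite /L2dot /= ![l2dot 0 _]l2dotC !l2dot0r addr0.
Qed.

(** Pairing the gradient with the direction [(1, 0)] leaves a scalar equation, since second
    derivatives have mean 0. *)
Lemma critical_c4 : c ^+ 4 = 2 * E ^+ 2.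
Proof.
have := orth (conj (h2_cst 1) h2_0 : H2 (cst 1 : R -> R^o, 0 : R -> R^o)).
rewrite /L2dot /= l2dot0r addr0.
have hc := h2_cst c; have lc := h2_l2 hc; have lc3 := h2_l2_cube hc.
rewrite (l2dot_lin3 _ _ _ lc (h2_l2_second hc) lc3 (l2_cst 1)).
rewrite (l2dot_cst c 1) (l2dot_second_derivative_cst 1 hc) mulr0 addr0.
have -> : l2dot (cube (cst c)) (cst 1) = c ^+ 3.
  by rewrite [LHS](l2dot_cst (c ^+ 3) 1) mulr1.
rewrite mulr1 /coef_id1 /coef_cube1 /= mass_cst quartic_cst kinetic_cst.
exact: first_equation c0 bn En gapE.
Qed.

(** With these signs, the second component of the gradient divided by [4 b] reads
    [al z - be z^3 - z'']. *)
Local Notation al := (coef_id2 Z / (4 * b)).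
Local Notation be := (- coef_cube2 Z / (4 * b)).

Lemma critical_be : be = (b ^+ 2 * E ^+ 2)^-1.
Proof.
rewrite /coef_cube2 gapE /= mass_cst; move: c0 bn En; move: E b => E' b' cn bn' En'.
by field; rewrite cn bn' En'.
Qed.

Lemma critical_al : al = (B - b ^- 2 + q / (2 * b ^+ 2 * E ^+ 2)) / b.
Proof.
rewrite /coef_id2 gapE /= mass_cst; move: c0 bn En; move: E b q B => E' b' q' B' cn bn' En'.
by field; rewrite cn bn' En'.
Qed.

Lemma critical_second_derivative :
  second_derivative z = (fun t => al * z t - be * z t ^+ 3) %[ae mu].
Proof.
pose r : R -> R^o := coef_id2 Z *: z + coef_cube2 Z *: cube z.
have cr : continuous r.
  have cz := h2_continuous hz.
  have c3 : continuous (cube z) := pw_continuousX cz.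
  have c1 := @pw_continuousZ _ (coef_id2 Z) _ cz; have c2 := @pw_continuousZ _ (coef_cube2 Z) _ c3.
  by move=> t; apply: cvgD; [exact: c1|exact: c2].
have pr : periodic r 1.
  by move=> t; rewrite /r !fctE /cube (h2_periodic hz).
have rE : r + (- 4 * b) *: second_derivative z = (grad_bav Z).2 by rewrite /r addrAC.
have orth2 k : h2 k -> l2dot (r + (- 4 * b) *: second_derivative z) k = 0.
  move=> hk; have := orth (conj h2_0 hk : H2 (0 : R -> R^o, k)).
  by rewrite rE /L2dot l2dot0r add0r.
have := orthogonal_h2_eq0 cr pr hz orth2.
apply: filterS; first exact: (ae_filter_ringOfSetsType mu).
move=> t /= H /H {H}; rewrite /r !fctE /GRing.scale/= /cube.
move: bn; move: (coef_id2 _) (coef_cube2 _) b (z t) (second_derivative z t) => x y b' zt s bn' H.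
have {}H : x * zt + y * zt ^+ 3 + - 4 * b' * s = 0 := H.
have -> : s = ((x * zt + y * zt ^+ 3) - (x * zt + y * zt ^+ 3 + - 4 * b' * s)) / (4 * b') by field.
by rewrite [X in _ - X]H; field.
Qed.

Let p : R -> R^o := derive1 z.

Let pz : periodic z 1 := h2_periodic hz.
Let dz (t : R) : is_derive t 1 z (p t) := h2_is_derive hz t.
Let dp (t : R) : is_derive t 1 p (al * z t - be * z t ^+ 3).
Proof.
have cz := h2_continuous hz.
have c1 := @pw_continuousZ _ al _ cz; have c2 := @pw_continuousZ _ be _ (@pw_continuousX _ 3 _ cz).
have cf : continuous (fun t => al * z t - be * z t ^+ 3 : R^o).
  by move=> s; apply: cvgB; [exact: c1|exact: c2].
apply: (h2_is_derive2 hz cf _ critical_second_derivative).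
by move=> s; rewrite pz.
Qed.

Local Notation e := (duffing_energy z p al be).

Let BE : B = be * q - al * b.
Proof. by rewrite {1}kineticE {1}quarticE [X in _ - _ * X]massE; exact: (duffing_kinetic pz dz dp). Qed.

Let BE2 : B = al * b - be / 2 * q + 2 * e.
Proof.
rewrite {1}kineticE {1}quarticE [X in _ * X - _ + _]massE.
exact: (duffing_kinetic_energy dz dp).
Qed.

Let be0 : 0 < be.
Proof. by rewrite critical_be invr_gt0 mulr_gt0// exprn_gt0. Qed.

(** In fact [2 e = b^(-2)]: the formula for [al b], inserted in [BE2], cancels both [B] and
    [be q / 2]. *)
Let e0 : 0 < e.
Proof.
have alb : al * b = B - b ^- 2 + be * q / 2.
  rewrite critical_al critical_be; move: bn En; move: E b q B => E' b' q' B' bn' En'.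
  by field; rewrite bn' En'.
have : 0 < b ^- 2 by rewrite invr_gt0 exprn_gt0.
move: BE BE2 alb; move: e => E2.
have -> : be / 2 * q = be * q / 2 by field.
move: (al * b) (b ^- 2) (be * q) => x y u; lra.
Qed.

Let kinetic_gt0 : 0 < moment p 2 := duffing_kinetic_gt0 pz dz dp be0 e0.

Let cz : continuous z := h2_continuous hz.

Let ddp (t : R) : is_derive t 1 (fun s => al * z s - be * z s ^+ 3 : R^o)
  (al * p t - 3 * be * z t ^+ 2 * p t).
Proof.
apply: (is_derive_eq (pw_deriveB (pw_deriveZ al (dz t)) (pw_deriveZ be (pw_deriveX 3 (dz t))))).
by rewrite /=; ring.
Qed.

Let cp : continuous p := is_derive_continuous dp.
Let pp : periodic p 1 := periodic_is_derive dz pz.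

Let cddp : continuous (fun t => al * p t - 3 * be * z t ^+ 2 * p t : R^o).
Proof.
have c2 := @pw_continuousX _ 2 _ cz.
have c3 := @pw_continuousZ _ (3 * be) _ c2.
have c1 := @pw_continuousZ _ al _ cp.
by move=> t; apply: cvgB; [exact: c1|apply: cvgM; [exact: c3|exact: cp]].
Qed.

Let hp : h2 p := h2_twice_differentiable pp dp ddp cddp.

Let sp : second_derivative p = (fun t => al * p t - 3 * be * z t ^+ 2 * p t) %[ae mu].
Proof. exact: second_derivative_ae pp dp ddp cddp. Qed.

Let lp : l2 p := h2_l2 hp.

Let dotp : l2dot z p = 0 /\ l2dot (cube z) p = 0.
Proof.
have hE t : p t = 0 * z t + 0 * duffing_w0 z p t + 1 * p t by ring.
have := duffing_means pz dz dp hE; rewrite !mul0r !addr0 => -[H1 H2].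
by rewrite !l2dot_mean.
Qed.

Let dkineticE (h : R -> R^o) : h2 h ->
  dkinetic z h = - al * dmass z h + be / 2 * dquartic z h.
Proof.
move=> hh; have lh := h2_l2 hh.
have lzz : l2 (al *: z + (- be) *: cube z) by apply: l2D; exact: l2Z.
have sE : second_derivative z = al *: z + (- be) *: cube z %[ae mu].
  have := critical_second_derivative.
  apply: filterS; first exact: (ae_filter_ringOfSetsType mu).
  move=> t /= H /H {H} ->; rewrite !fctE /GRing.scale/= /cube.
  by congr (_ + _); rewrite -mulNr.
rewrite /dkinetic /dmass /dquartic (l2dot_ae ls lzz lh sE).
rewrite (l2dotDl (l2Z al lz) (l2Z (- be) lcube) lh) (l2dotZl al lz lh) (l2dotZl (- be) lcube lh).
move: al be (l2dot z h) (l2dot (cube z) h) => x y u v; by field.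
Qed.

(** The infinitesimal time shift. As [z] and [z^3] are orthogonal to [p], every nonlocal variation
    vanishes, and the second component reduces to [- 4 a b L p = 0]. *)
Let hess_generator (a : R) : L2eq (hess_bav Z (0 : R -> R^o, a *: p)) 0.
Proof.
have m0 f : dmass f 0 = 0 by rewrite /dmass l2dot0r mulr0.
have k0 f : dkinetic f 0 = 0 by rewrite /dkinetic l2dot0r mulr0.
have q0 f : dquartic f 0 = 0 by rewrite /dquartic l2dot0r mulr0.
have [dp1 dp3] := dotp.
have hap : h2 (a *: p) by rewrite -[a *: p]addr0; exact: h2_lin hp h2_0.
have m1 : dmass z (a *: p) = 0 by rewrite /dmass (l2dotZr a lp lz) dp1 !mulr0.
have q1 : dquartic z (a *: p) = 0 by rewrite /dquartic (l2dotZr a lp lcube) dp3 !mulr0.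
have k1 : dkinetic z (a *: p) = 0 by rewrite dkineticE// m1 q1 !mulr0 addr0.
have g0 : dgap Z (0 : R -> R^o, a *: p) = 0.
  by rewrite /dgap /= m0 q0 m1 q1 !(mulr0, mul0r, subr0, addr0).
have c1 : dcoef_id1 Z (0 : R -> R^o, a *: p) = 0.
  by rewrite /dcoef_id1 /= g0 m0 q0 k0 m1 !(mulr0, mul0r, subr0, addr0).
have c2 : dcoef_id2 Z (0 : R -> R^o, a *: p) = 0.
  by rewrite /dcoef_id2 /= g0 m0 k1 q1 m1 !(mulr0, mul0r, subr0, addr0).
have c3 : dcoef_cube1 Z (0 : R -> R^o, a *: p) = 0.
  by rewrite /dcoef_cube1 /= g0 m0 m1 !(mulr0, mul0r, subr0, addr0).
have c4 : dcoef_cube2 Z (0 : R -> R^o, a *: p) = 0.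
  by rewrite /dcoef_cube2 /= g0 m0 m1 !(mulr0, mul0r, subr0, addr0).
rewrite /hess_bav c1 c2 c3 c4 /= m0 m1; split.
- have := second_derivative_cst (0 : R).
  apply: filterS; first exact: (ae_filter_ringOfSetsType mu).
  move=> t /= H /H {}H; rewrite !fctE /GRing.scale/= H.
  by rewrite !(mulr0, mul0r, subr0, addr0).
- have apE : second_derivative (a *: p) = a *: second_derivative p %[ae mu].
    have := second_derivative_lin a hp h2_0; rewrite addr0.
    apply: filterS2 (second_derivative_cst (0 : R)); first exact: (ae_filter_ringOfSetsType mu).
    by move=> t /= H0 H1 tT; rewrite (H1 tT) !fctE (H0 tT) addr0.
  move: apE; apply: filterS2 sp; first exact: (ae_filter_ringOfSetsType mu).
  move=> t /= H0 H1 tT; have {}H0 := H0 tT; have {}H1 := H1 tT.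
  rewrite !fctE /GRing.scale/= H1 !fctE /GRing.scale/= H0.
  move: bn; move: (coef_id2 Z) (coef_cube2 Z) b (z t) (p t) (second_derivative z t) => x y b' zt pt s bn'.
  have -> : (0 : R -> R^o) t = 0 by [].
  by rewrite !(mulr0, mul0r, add0r); field.
Qed.

Section kernel_element.
Variable h : V.
Hypotheses (Hh : H2 h) (kh : L2eq (hess_bav Z h) 0).

Let h1 : h2 h.1. Proof. by case: Hh. Qed.
Let h2' : h2 h.2. Proof. by case: Hh. Qed.

Local Notation K1 := (coef_id1 Z + 3 * c ^+ 2 * coef_cube1 Z).
Local Notation K0 := (dcoef_id1 Z h * c + dcoef_cube1 Z h * c ^+ 3).

(** The relation [c^4 = 2 E^2] turns [- 4 / c^4] into [- 2 / E^2]. The positivity of the result is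
    what forces [h.1] to be constant. *)
Let K1E : K1 = 8 / E ^+ 2.
Proof.
have c4 := critical_c4.
rewrite /coef_id1 /coef_cube1 gapE /= mass_cst quartic_cst kinetic_cst.
have -> : (c ^+ 2) ^+ 2 = c ^+ 4 by ring.
move: c0 bn En c4; move: b E => b' E' cn bn' En' c4.
have -> : 4 * c ^+ 2 * b' ^+ 2 / (c ^+ 2 * b' * E') ^+ 2 = 4 * c ^+ 2 / (c ^+ 4 * E' ^+ 2).
  by field; rewrite cn bn' En'.
have -> : 2 * c ^+ 4 * b' ^+ 2 / (c ^+ 2 * b' * E') ^+ 2 = 2 / E' ^+ 2.
  by field; rewrite cn bn' En'.
have -> : 3 * c ^+ 2 * (4 * c ^+ 2 / (c ^+ 4 * E' ^+ 2)) = 12 / E' ^+ 2.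
  by field; rewrite cn En'.
by rewrite c4; field.
Qed.

Let first_component :
  K1 *: h.1 + (- 4 * c ^+ 2) *: second_derivative h.1 + K0 *: (cst 1) = (0 : R -> R^o) %[ae mu].
Proof.
have [kh1 _] := kh; move: kh1.
apply: filterS2 (second_derivative_cst c); first exact: (ae_filter_ringOfSetsType mu).
move=> t /= H0 H1 tT; have {}H0 := H0 tT; have {}H1 := H1 tT.
move: H1; rewrite !fctE /GRing.scale/= H0 mass_cst /cube => H1.
rewrite -[RHS]H1; move: (dmass _ _) (coef_id1 _) (coef_cube1 _) (dcoef_id1 _ _) (dcoef_cube1 _ _).
by move=> x1 x2 x3 x4 x5; have -> : (0 : R -> R^o) t = 0 by []; ring.
Qed.

(** Pairing the equation with 1 and with [h.1] and eliminating [K0] gives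
    [K1 (|h.1|^2 - m^2) + 4 c^2 |h.1'|^2 = 0], with [m] the mean of [h.1]. Both terms are
    nonnegative, the first by Cauchy-Schwarz, so [h.1' = 0]. *)
Lemma kernel_first_cst : exists2 eta : R, h.1 = cst eta & K1 * eta + K0 = 0.
Proof.
have lh := h2_l2 h1; have lsh := h2_l2_second h1; have l1 := l2_cst (1 : R).
have l0 : l2 (0 : R -> R^o) by exact: (l2_cst 0).
have lf : l2 (K1 *: h.1 + (- 4 * c ^+ 2) *: second_derivative h.1 + K0 *: (cst 1)).
  by apply: (l2D (l2D (l2Z K1 lh) (l2Z (- 4 * c ^+ 2) lsh)) (l2Z K0 l1)).
pose m := l2dot h.1 (cst 1); pose M := l2dot h.1 h.1.
pose D := l2dot (derive1 h.1) (derive1 h.1).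
have e1 : K1 * m + K0 = 0.
  have := l2dot_ae lf l0 l1 first_component.
  rewrite (l2dot_lin3 _ _ _ lh lsh l1 l1) (l2dot_cst 1 1).
  rewrite (l2dot_second_derivative_cst 1 h1) (l2dotC 0) l2dot0r.
  by rewrite mulr0 addr0 mulr1 mulr1.
have e2 : K1 * M + 4 * c ^+ 2 * D + K0 * m = 0.
  have := l2dot_ae lf l0 lh first_component.
  rewrite (l2dot_lin3 _ _ _ lh lsh l1 lh) (h2_by_parts h1 h1) (l2dotC 0) l2dot0r.
  by rewrite [l2dot (cst 1) _]l2dotC -/m -/M -/D !mulNr mulrN opprK.
have mM : m ^+ 2 <= M.
  by have := l2dot_cauchy lh l1; rewrite (l2dot_cst 1 1) !mulr1.
have D0 : 0 <= D by exact: l2dot_ge0.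
have D00 : D = 0.
  have K10 : 0 < K1 by rewrite K1E divr_gt0// exprn_gt0.
  have c20 : 0 < c ^+ 2 by rewrite lt_def sqr_ge0 sqrf_eq0 c0.
  move: e1 e2 K10; move: K1 K0 => k1 k0 e1 e2 k10.
  have e3 : k1 * (M - m ^+ 2) + 4 * c ^+ 2 * D = 0.
    have -> : k1 * (M - m ^+ 2) + 4 * c ^+ 2 * D
      = (k1 * M + 4 * c ^+ 2 * D + k0 * m) - (k1 * m + k0) * m by ring.
    by rewrite e1 e2 mul0r subr0.
  have t1 : 0 <= k1 * (M - m ^+ 2) by rewrite mulr_ge0 ?subr_ge0// ltW.
  have t2 : 0 <= 4 * c ^+ 2 * D.
    by apply: mulr_ge0 => //; apply: mulr_ge0 => //; exact: ltW.
  have : 4 * c ^+ 2 * D = 0 by lra.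
  have cn : 4 * c ^+ 2 != 0 by rewrite mulf_neq0 ?pnatr_eq0// expf_neq0.
  by move/eqP; rewrite mulf_eq0 (negbTE cn) => /eqP.
have d0 := l2dot_continuous_eq0 (h2_derive1_continuous h1) (h2_derive1_periodic h1) D00.
have hE : h.1 = cst (h.1 0).
  apply/funext => t; apply: (@is_derive_0_is_cst R h.1 t 0) => s.
  by rewrite -(d0 s); exact: h2_is_derive.
exists (h.1 0) => //.
have mE : m = h.1 0 by rewrite /m hE [LHS](l2dot_cst (h.1 0) 1) mulr1.
by rewrite -mE.
Qed.

(** The terms with [al] and [be] in [A] and [C] come from the variation [- 4 dmass z h.2] of the
    factor of [z''], with [z''] replaced by [al z - be z^3]. *)
Local Notation A := ((dcoef_id2 Z h - 4 * dmass z h.2 * al) / (4 * b)).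
Local Notation C := ((dcoef_cube2 Z h + 4 * dmass z h.2 * be) / (4 * b)).

Let second_component :
  second_derivative h.2
    = (fun t => al * h.2 t - 3 * be * z t ^+ 2 * h.2 t + A * z t + C * z t ^+ 3) %[ae mu].
Proof.
have [_ kh2] := kh; move: kh2.
apply: filterS2 critical_second_derivative; first exact: (ae_filter_ringOfSetsType mu).
move=> t /= H0 H1 tT; have {}H0 := H0 tT; have {}H1 := H1 tT.
move: H1; rewrite !fctE /GRing.scale/= H0 /cube.
have -> : (0 : R -> R^o) t = 0 by [].
move: bn; move: (dmass _ _) (coef_id2 _) (coef_cube2 _) (dcoef_id2 _ _) (dcoef_cube2 _ _) b
  (z t) (h.2 t) (second_derivative h.2 t) => dm x1 x3 y1 y3 b' zt ht s bn' H1.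
have {}H1 : y1 * zt + x1 * ht + (- 4 * dm * (x1 / (4 * b') * zt - - x3 / (4 * b') * zt ^+ 3)
  + - 4 * b' * s) + (y3 * zt ^+ 3 + x3 * (3 * zt ^+ 2 * ht)) = 0 := H1.
have -> : s = (y1 * zt + x1 * ht + (- 4 * dm * (x1 / (4 * b') * zt - - x3 / (4 * b') * zt ^+ 3))
  + (y3 * zt ^+ 3 + x3 * (3 * zt ^+ 2 * ht))
  - (y1 * zt + x1 * ht + (- 4 * dm * (x1 / (4 * b') * zt - - x3 / (4 * b') * zt ^+ 3)
  + - 4 * b' * s) + (y3 * zt ^+ 3 + x3 * (3 * zt ^+ 2 * ht)))) / (4 * b') by field.
by rewrite [X in _ - X]H1; field.
Qed.

Lemma kernel_second : exists x y d : R,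
  [/\ forall t, h.2 t = x * z t + y * duffing_w0 z p t + d * p t,
    A = - 6 * moment p 2 * y & C = 2 * be * x + (2 * moment z 2 * be - 4 * al) * y].
Proof.
have ch := h2_continuous h2'.
have cr : continuous (fun t => al * h.2 t - 3 * be * z t ^+ 2 * h.2 t + A * z t + C * z t ^+ 3 : R^o).
  have c2 := @pw_continuousZ _ (3 * be) _ (@pw_continuousX _ 2 _ cz).
  have c1 := @pw_continuousZ _ al _ ch; have c3 := @pw_continuousZ _ A _ cz.
  have c4 := @pw_continuousZ _ C _ (@pw_continuousX _ 3 _ cz).
  move=> t; apply: cvgD; [apply: cvgD; [apply: cvgB|]|]; [exact: c1| |exact: c3|exact: c4].
  by apply: cvgM; [exact: c2|exact: ch].
have pr : periodic (fun t => al * h.2 t - 3 * be * z t ^+ 2 * h.2 t + A * z t + C * z t ^+ 3 : R^o) 1.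
  by move=> t; rewrite pz (h2_periodic h2').
have dk := h2_is_derive2 h2' cr pr second_component.
exact: duffing_linearized pz dz dp be0 e0 _ _ _ _ (h2_periodic h2') (h2_is_derive h2') dk.
Qed.

Lemma kernel_classification : exists d : R, h = (0 : R -> R^o, d *: p).
Proof.
have [eta h1E eq1] := kernel_first_cst.
have [x [y [d [h2E AE CE]]]] := kernel_second.
have [m1 m3] := duffing_means pz dz dp h2E.
have M6E := duffing_moment6 pz dz dp.
have bq := duffing_cauchy2 pz dz; have qM := duffing_cauchy4 pz dz.
rewrite -quarticE -massE in M6E bq qM m1 m3.
rewrite -kineticE -massE in AE CE.
have dbE : dmass z h.2 = 2 * (x * b + y * (b ^+ 2 / 2 - 3 / 2 * q)).
  by rewrite /dmass l2dot_mean m1.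
have dqE : dquartic z h.2 = 4 * (x * q + y * (b * q / 4 - 5 / 4 * moment z 6)).
  by rewrite /dquartic l2dot_mean m3.
have dm1 : dmass (cst c) (cst eta) = 2 * c * eta by rewrite /dmass l2dot_cst mulrA.
have dq1 : dquartic (cst c) (cst eta) = 4 * c ^+ 3 * eta.
  by rewrite /dquartic [l2dot _ _](l2dot_cst (c ^+ 3) eta) mulrA.
have dk1 : dkinetic (cst c) (cst eta) = 0.
  by rewrite /dkinetic (l2dot_second_derivative_cst eta (h2_cst c)) mulr0.
(* The variation of [E = c^2 - q / b] in the direction [h]. *)
pose dE := 2 * c * eta - dquartic z h.2 / b + q * dmass z h.2 / b ^+ 2.
have dgE : dgap Z h = b * (E * (2 * c * eta) + c ^+ 2 * dE) + c ^+ 2 * dmass z h.2 * E.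
  rewrite /dgap /= h1E dm1 dq1 mass_cst quartic_cst /dE qE.
  by move: bn; move: b E (dmass _ _) (dquartic _ _) => b' E' u v bn'; field.
have q0 : 0 < q.
  by apply: lt_le_trans bq; rewrite exprn_gt0.
have [eta0 x0 y0] : [/\ eta = 0, x = 0 & y = 0].
  apply: (linearized_system c0 b0 E0 q0 qE critical_c4 critical_be critical_al BE BE2 M6E bq qM
    dbE dqE (erefl dE) _ AE CE).
  - move: eq1; rewrite K1E /dcoef_id1 /dcoef_cube1 /= dgE gapE h1E dm1 dq1 dk1 mass_cst quartic_cst.
    rewrite -/dE => eq1; rewrite -{}[RHS]eq1.
    (* The goal thereby becomes [16 eta / c^4 - 4 c dE / E^3], whose first term is the contribution
       of the variation of [- 4 / mass^2] in [coef_id1]. *)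
    have -> : 2 * eta / E ^+ 2 = 4 * eta / c ^+ 4 by rewrite critical_c4; field.
    move: c0 bn En; move: (dE) b E (dmass _ _) => v b' E' u cn bn' En'.
    by field; rewrite cn bn' En'.
  - rewrite /dcoef_id2 /= dgE gapE h1E dm1 mass_cst dkineticE//.
    move: c0 bn En; move: (dE) b E q (coef_id2 _) (coef_cube2 _) (dmass _ _) (dquartic _ _).
    move=> v b' E' q' x1 x3 u u' cn bn' En'.
    by field; rewrite cn bn' En'.
  - rewrite /dcoef_cube2 /= dgE gapE h1E dm1 mass_cst.
    move: c0 bn En; move: (dE) b E (coef_cube2 _) (dmass _ _) => v b' E' x3 u cn bn' En'.
    by field; rewrite cn bn' En'.
exists d; case: h h1E h2E => k1 k2 /= -> kE; rewrite eta0; congr pair.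
by apply/funext => t; rewrite kE x0 y0 !mul0r !add0r.
Qed.

End kernel_element.
Lemma critical_nondegenerate : nondegenerate_at Z.
Proof.
exists (hess_bav Z); first exact: Hav_hessian.
exists (0 : R -> R^o, p).
  move=> [p0]; have := kinetic_gt0.
  by rewrite -kineticE /kinetic -/p p0 l2dot0r ltxx.
apply/seteqP; split => [h [Hh kh]|_ [a _ <-]].
  have [d ->] := kernel_classification Hh kh.
  by exists d => //; congr pair; rewrite scaler0.
have -> : a *: (0 : R -> R^o, p) = (0 : R -> R^o, a *: p) by congr pair; rewrite scaler0.
split; last exact: hess_generator.
by split; [exact: h2_0|rewrite /= -[a *: p]addr0; exact: h2_lin hp h2_0].
Qed.

End at_critical_point.
End critical_points.

Theorem theorem4p1 (R : realType) (z : (R -> R^o) * (R -> R^o))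
  (z_crit : critical_point z) (z1_constant : exists c : R, z.1 = cst c) :
  nondegenerate_at z.
Proof.
case: z z_crit z1_constant => z1 z2 crit [c /= E].
by move: crit; rewrite E => crit; exact: critical_nondegenerate.
Qed.
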